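(* Let $f\in\mathcal{F}$, $f\neq 0$, and write $f=\Delta^{m_1}+\Delta^{m_2}+\cdots+\Delta^{m_r}$ with $m_1\succ m_2\succ\cdots\succ m_r$ (so that $m_1$ is the dominant exponent of $f$). Then: (i) $T_3^{\,n_3(m_1)}\,T_5^{\,n_5(m_1)}\,|f=\Delta$. (ii) The order of nilpotence of $f$ is $g(f)=h(f)+1$.
   Context: Let $\Delta=\sum_{m=0}^{\infty}q^{(2m+1)^2}\in\mathbf{F}_2[[q]]$ (the reduction mod 2 of $q\prod_{n\ge1}(1-q^n)^{24}$). A modular form modulo 2 of level 1 is an element of $\mathbf{F}_2[\Delta]\subset\mathbf{F}_2[[q]]$, and $\mathcal{F}$ denotes the $\mathbf{F}_2$-subspace of $\mathbf{F}_2[\Delta]$ spanned by $\Delta,\Delta^3,\Delta^5,\ldots$ (odd powers). For an odd prime $p$, the Hecke operator $T_p$ sends $f=\sum_{n\ge0}c(n)q^n\in\mathbf{F}_2[\Delta]$ to $T_p|f=\sum_{n\ge0}\gamma(n)q^n$, where $\gamma(n)=c(pn)$ if $p\nmid n$ and $\gamma(n)=c(pn)+c(n/p)$ if $p\mid n$. The operators $T_p$ map $\mathbf{F}_2[\Delta]$ to itself and $\mathcal{F}$ to itself, and they commute. $T_p|f$ is also written $T_p(f)$; powers and products of the $T_p$ denote composition. Order of nilpotence: for $f\in\mathbf{F}_2[\Delta]$ nonzero and without constant term, $g(f)$ is the smallest integer $g\ge 0$ such that for every sequence of $g$ odd primes $p_1,\ldots,p_g$ (not necessarily distinct) one has $T_{p_1}T_{p_2}\cdots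 T_{p_g}|f=0$; and $g(0)=-\infty$. For an integer $k\ge0$ with binary expansion $k=\sum_{i\ge0}\beta_i2^i$, $\beta_i\in\{0,1\}$, set $n_3(k)=\sum_{i\ge0}\beta_{2i+1}2^i$, $n_5(k)=\sum_{i\ge0}\beta_{2i+2}2^i$, $h(k)=n_3(k)+n_5(k)$. For non-negative integers $k,\ell$ of the same parity, $\ell\succ k$ means: $h(k)<h(\ell)$, or $h(k)=h(\ell)$ and $n_5(k)<n_5(\ell)$. This gives a total order on the odd non-negative integers. If $f\in\mathcal{F}$, $f\ne0$, is written $f=\Delta^{m_1}+\cdots+\Delta^{m_r}$ with $m_1\succ\cdots\succ m_r$ (odd positive integers), then $m_1$ is called the dominant exponent of $f$, and $h(f)=h(m_1)=\max_i h(m_i)$. *)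

(* Defs.v *)
From mathcomp Require Import all_boot all_order all_algebra.
Set Implicit Arguments.
Unset Strict Implicit.
Unset Printing Implicit Defensive.
Import GRing.Theory.
Local Open Scope ring_scope.

(* An element of F_2[[q]] is given by its coefficient sequence; equality of
   series is pointwise equality [=1]. *)
Definition qseries := nat -> 'F_2.

Definition qzero : qseries := fun _ => 0.
Definition qone : qseries := fun n => (n == 0%N)%:R.
Definition qmul (f g : qseries) : qseries :=
  fun n => \sum_(i < n.+1) f i * g (n - i)%N.
Definition qexp (f : qseries) (k : nat) : qseries := iter k (qmul f) qone.

(* The indices m <= n suffice, since (2m+1)^2 = n forces m <= n. *)
Definition Delta : qseries :=
  fun n => \sum_(m < n.+1) ((m.*2.+1 ^ 2)%N == n)%:R.

(* P(Delta) in F_2[Delta] *)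
Definition poly_Delta (P : {poly 'F_2}) : qseries :=
  fun n => \sum_(i < size P) P`_i * qexp Delta i n.

Definition calF (f : qseries) : Prop :=
  exists2 P : {poly 'F_2},
    (forall i, P`_i != 0 -> odd i) & f =1 poly_Delta P.

Definition sum_Delta_powers (ms : seq nat) : qseries :=
  fun n => \sum_(m <- ms) qexp Delta m n.

Definition hecke (p : nat) (f : qseries) : qseries :=
  fun n => f (p * n)%N + (if (p %| n)%N then f (n %/ p)%N else 0).

Definition odd_prime (p : nat) : bool := prime p && odd p.

(* [foldr hecke f [:: p1; ...; pg]] is T_p1 (T_p2 (... (T_pg f))). *)
Definition hecke_annihilated (f : qseries) (g : nat) : Prop :=
  forall ps : seq nat, size ps = g -> all odd_prime ps ->
    foldr hecke f ps =1 qzero.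

(* [nilpotence_order f x] means g(f) = x, where [None] stands for -oo. *)
Definition nilpotence_order (f : qseries) (x : option nat) : Prop :=
  match x with
  | None => f =1 qzero
  | Some g => [/\ ~ (f =1 qzero), hecke_annihilated f g
      & forall g', hecke_annihilated f g' -> (g <= g')%N]
  end.

Definition bit (k i : nat) : bool := odd (k %/ 2 ^ i).

(* The bits of k of index > k vanish, so the sums may stop at i = k. *)
Definition n3 (k : nat) : nat := (\sum_(i < k.+1) bit k i.*2.+1 * 2 ^ i)%N.
Definition n5 (k : nat) : nat := (\sum_(i < k.+1) bit k i.*2.+2 * 2 ^ i)%N.
Definition h (k : nat) : nat := (n3 k + n5 k)%N.

(* Meaningful only for l and k of the same parity; used on odd integers. *)
Definition dominates (l k : nat) : bool :=
  ((h k < h l) || (h k == h l) && (n5 k < n5 l))%N.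

(* f = Delta^m1 + ... + Delta^mr with m1, ..., mr odd, strictly decreasing for
   the domination order; then m1 is the dominant exponent of f, and h(f) is
   h(m1). *)
Definition decomposition (f : qseries) (ms : seq nat) : Prop :=
  [/\ all odd ms, sorted dominates ms & f =1 sum_Delta_powers ms].

(* Main.v *)
Require Import Defs.
From HB Require Import structures.
From mathcomp Require Import all_boot all_order all_algebra finfield cyclic.
From mathcomp Require Import boolp.
From mathcomp Require Import zify ring.
Set Implicit Arguments.
Unset Strict Implicit.
Unset Printing Implicit Defensive.
Import Order.TTheory GRing.Theory Num.Theory.
Local Open Scope ring_scope.

(** The proof rests on closed forms for two Hecke operators: modulo 2,
      T_3 Delta^k = sum of C(N - 1 + j, j) Delta^(N + 4 j) over 3 N + 4 j = k, N > 0,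
      T_5 Delta^k = sum of C(3 N - 1 + j, j) Delta^(N + 2 j) over 5 N + 2 j = k, N > 0
    (hecke3_power, hecke5_power). A binomial C(i + j, j) is odd exactly when i and j
    have no common binary digit, so a finite automaton reading the base 4 digits of
    (N - 1) / 2 and j follows n_3 and n_5 on both sides (T3_bound, T5_bound): every
    exponent produced by T_3 or T_5 has a smaller height h, and for odd exponents T_5
    lowers the n_5 of the dominant exponent by one, while T_3 lowers its n_3 by one
    when n_5 is already 0 (lead_Hecke5, lead_Hecke3). This gives (i), and the lower
    bound in (ii).

    For the upper bound it suffices that each T_p lowers the height (Hecke_height).
    The series T_p f is again a sum of odd powers of Delta (span_Hecke_odd), so (i)
    applies to it: if its height were at least h(f), a product A of h(f) or more
    operators T_3 and T_5 would give A T_p f = Delta. But A f has height 0, hence is 0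
    or Delta, and A T_p f = T_p A f = 0 since T_p kills Delta.

    It remains to see why T_p preserves the polynomials in Delta for every odd prime p,
    and where the closed forms come from. Both use the Tate curve over the Laurent
    series in t over a field k of characteristic 2, with q = t^e. The point of
    parameter u has abscissa x(u) = sum of u q^n / (1 + u q^n)^2 over the integers n,
    and x(2 Q) = x(Q)^2 + Delta / x(Q)^2, where Delta is the discriminant of the curve
    and has the expansion of the statement (tx_double, tdiscE). The quotient of the
    curve by a subgroup C of order p is a Tate curve of discriminant
    Y_C = Delta + t_C + t_C^2, where t_C is the sum of the abscissas of the nonzero
    points of C, each pair of opposite points being counted once (velu_root,
    velu_unity). The p + 1 series Y_C are Delta(q^p) and the Delta(zeta q^(1/p)), with
    zeta^p = 1, whence T_p Delta^n = sum of the Y_C^n (hecke_sum).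

    The points killed by 2^m - 1 or 2^m + 1 are those with x(2^m Q) = x(Q). Hence they
    are the roots of a monic polynomial over F_2[Delta] (cycle_poly_split), and for p
    dividing 2^m - 1 the sum of the Y_C^n is a sum, over all these roots, of values of
    one rational function. It is therefore a rational function of Delta; being
    integral over F_2[Delta], it is a polynomial in Delta (hecke_power).

    For p = 3 and p = 5 the relations between the abscissas of C can be solved, and
    Y_C is a root of Y^4 + Delta Y + Delta^4, respectively of
    Y^6 + Delta^2 Y^4 + Delta^4 Y^2 + Delta Y + Delta^6 (Yval3, Yval5). These
    polynomials have constant derivative Delta, so that Newton's identities become
    short recurrences for T_p Delta^k (hecke_low, hecke_recurrence), which the closed
    forms solve by Pascal's rule. *)

(** * Formal power series *)

Definition pseries (k : nzRingType) : Type := nat -> k.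

HB.instance Definition _ (k : nzRingType) := gen_eqMixin (pseries k).
HB.instance Definition _ (k : nzRingType) := gen_choiceMixin (pseries k).

Section PowerSeries.

Variable k : fieldType.
Implicit Types f g h : pseries k.

Definition ps_zero : pseries k := fun _ => 0.
Definition ps_one : pseries k := fun n => (n == 0%N)%:R.
Definition ps_opp f : pseries k := fun n => - f n.
Definition ps_add f g : pseries k := fun n => f n + g n.
Definition ps_mul f g : pseries k := fun n => \sum_(i < n.+1) f i * g (n - i)%N.

Lemma ps_addA : associative ps_add.
Proof. by move=> f g h; apply: funext => n; apply: addrA. Qed.
Lemma ps_addC : commutative ps_add.
Proof. by move=> f g; apply: funext => n; apply: addrC. Qed.
Lemma ps_add0 : left_id ps_zero ps_add.
Proof. by move=> f; apply: funext => n; apply: add0r. Qed.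
Lemma ps_addN : left_inverse ps_zero ps_opp ps_add.
Proof. by move=> f; apply: funext => n; apply: addNr. Qed.

HB.instance Definition _ :=
  GRing.isZmodule.Build (pseries k) ps_addA ps_addC ps_add0 ps_addN.

(* A product coefficient only involves finitely many coefficients, so the ring
   axioms follow from those of polynomials. *)
Let trunc N f : {poly k} := \poly_(i < N) f i.

Let ps_mul_trunc N f g n : (n < N)%N -> ps_mul f g n = (trunc N f * trunc N g)`_n.
Proof.
move=> lt_nN; rewrite coefM; apply: eq_bigr => i _.
have le_in : (i <= n)%N by rewrite -ltnS.
by rewrite !coef_poly (leq_ltn_trans le_in) // (leq_ltn_trans (leq_subr _ _)).
Qed.

Let trunc_mul N f g n : (n < N)%N ->
  (trunc N (ps_mul f g))`_n = (trunc N f * trunc N g)`_n.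
Proof. by move=> lt; rewrite coef_poly lt (ps_mul_trunc _ _ lt). Qed.

Let coefM_eq (p q p' q' : {poly k}) n :
  (forall i, (i <= n)%N -> p`_i = p'`_i) -> (forall i, (i <= n)%N -> q`_i = q'`_i) ->
  (p * q)`_n = (p' * q')`_n.
Proof.
move=> Hp Hq; rewrite !coefM; apply: eq_bigr => i _.
by rewrite Hp ?Hq ?leq_subr // -ltnS.
Qed.

Lemma ps_mulA : associative ps_mul.
Proof.
move=> f g h; apply: funext => n; rewrite !(ps_mul_trunc (N := n.+1)) //.
transitivity ((trunc n.+1 f * (trunc n.+1 g * trunc n.+1 h))`_n).
  by apply: coefM_eq => // i le_i; rewrite trunc_mul.
by rewrite mulrA; apply: coefM_eq => // i le_i; rewrite trunc_mul.
Qed.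

Lemma ps_mulC : commutative ps_mul.
Proof.
by move=> f g; apply: funext => n; rewrite !(ps_mul_trunc (N := n.+1)) // mulrC.
Qed.

Lemma ps_mul1 : left_id ps_one ps_mul.
Proof.
move=> f; apply: funext => n; rewrite /ps_mul big_ord_recl /= mul1r subn0.
by rewrite big1 ?addr0 // => i _; rewrite mul0r.
Qed.

Lemma ps_mulDl : left_distributive ps_mul ps_add.
Proof.
move=> f g h; apply: funext => n; rewrite /ps_mul /ps_add -big_split /=.
by apply: eq_bigr => i _; rewrite mulrDl.
Qed.

Lemma ps_one_neq0 : ps_one != 0.
Proof. by apply/eqP => /(congr1 (@^~ 0%N))/eqP; rewrite oner_eq0. Qed.

HB.instance Definition _ := GRing.Zmodule_isComNzRing.Build (pseries k)
  ps_mulA ps_mulC ps_mul1 ps_mulDl ps_one_neq0.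

(** Inverses are unique, so any choice gives the same function. *)
Definition ps_unit : pred (pseries k) := fun f => `[< exists g, g * f = 1 >].

Definition ps_inv f : pseries k :=
  if pselect (exists g, g * f = 1) is left H then sval (cid H) else f.

Lemma ps_mulVr : {in ps_unit, left_inverse 1 ps_inv *%R}.
Proof.
by move=> f /asboolP H; rewrite /ps_inv; case: pselect => // H'; case: cid.
Qed.

Lemma ps_unitP f g : g * f = 1 -> ps_unit f.
Proof. by move=> H; apply/asboolP; exists g. Qed.

Lemma ps_inv_out : {in [predC ps_unit], ps_inv =1 id}.
Proof.
by move=> f /asboolP H; rewrite /ps_inv; case: pselect.
Qed.

HB.instance Definition _ := GRing.ComNzRing_hasMulInverse.Build (pseries k)
  ps_mulVr ps_unitP ps_inv_out.

Lemma psD f g n : (f + g) n = f n + g n. Proof. by []. Qed.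
Lemma psB f g n : (f - g) n = f n - g n. Proof. by []. Qed.
Lemma ps0 n : (0 : pseries k) n = 0. Proof. by []. Qed.
Lemma ps1 n : (1 : pseries k) n = (n == 0%N)%:R. Proof. by []. Qed.
Lemma psM f g n : (f * g) n = \sum_(i < n.+1) f i * g (n - i)%N.
Proof. by []. Qed.

Lemma ps_sum I (r : seq I) (P : pred I) (F : I -> pseries k) n :
  (\sum_(i <- r | P i) F i) n = \sum_(i <- r | P i) F i n.
Proof. exact: (big_morph (fun f : pseries k => f n) (fun f g => psD f g n) (ps0 n)). Qed.

Lemma ps_idomain : GRing.integral_domain_axiom (pseries k).
Proof.
move=> f g fg0; apply: contraT; rewrite negb_or => /andP[f0 g0].
have low h : h != 0 -> exists2 n, h n != 0 & forall m, (m < n)%N -> h m = 0.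
  move=> h0; have H : exists n, h n != 0.
    apply: contrapT => H; case/eqP: h0; apply: funext => n.
    by apply/eqP/negPn/negP => hn; apply: H; exists n.
  case: (ex_minnP H) => n hn Hmin; exists n => // m lt_mn.
  by apply/eqP/negPn/negP => /Hmin; rewrite leqNgt lt_mn.
have [[n fn Hf] [m gm Hg]] := (low f f0, low g g0).
have := congr1 (@^~ (n + m)%N) fg0; rewrite psM ps0 => /eqP.
have lt : (n < (n + m).+1)%N by rewrite ltnS leq_addr.
rewrite (bigD1 (Ordinal lt)) //= big1 ?addr0 => [|i].
  by rewrite addKn mulf_eq0 (negPf fn) (negPf gm).
rewrite -val_eqE neq_ltn /= => /orP[lt_in | lt_ni].
  by rewrite Hf // mul0r.
by rewrite (Hg (n + m - i)%N) ?mulr0 // ltn_subLR ?ltn_add2r // -ltnS.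
Qed.

HB.instance Definition _ :=
  GRing.ComUnitRing_isIntegral.Build (pseries k) ps_idomain.

(** The monomial c t^d, in the variable t of the series. *)
Definition psmon (c : k) (d : nat) : pseries k := fun n => c *+ (n == d).

Lemma psmonE c d f n : (psmon c d * f) n = if (d <= n)%N then c * f (n - d)%N else 0.
Proof.
rewrite psM; case: leqP => [le_dn | lt_nd].
  have lt : (d < n.+1)%N by [].
  rewrite (bigD1 (Ordinal lt)) //= /psmon eqxx mulr1n big1 ?addr0 // => i.
  by rewrite -val_eqE /= => /negPf->; rewrite mulr0n mul0r.
rewrite big1 // => i _; rewrite /psmon (_ : _ == d = false) ?mulr0n ?mul0r //.
by apply/eqP => E; move: (ltn_ord i); rewrite E ltnS leqNgt lt_nd.
Qed.

Lemma psmonM c d c' d' : psmon c d * psmon c' d' = psmon (c * c') (d + d').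
Proof.
apply: funext => n; rewrite psmonE /psmon mulrnAr; case: leqP => [le|lt].
  by rewrite -(eqn_add2l d) subnKC.
by rewrite (_ : _ == _ = false) //; apply/eqP; lia.
Qed.

Lemma psmon10 : psmon 1 0 = 1.
Proof. by []. Qed.

Lemma psmonX c d n : psmon c d ^+ n = psmon (c ^+ n) (n * d).
Proof. by elim: n => [|n IH]; rewrite ?expr0 ?psmon10 // !exprS IH psmonM. Qed.

Lemma ps_divt M f : (forall n, (n < M)%N -> f n = 0) <->
  exists g, f = psmon 1 M * g.
Proof.
split=> [Hf | [g ->] n lt]; last by rewrite psmonE leqNgt lt.
exists (fun n => f (M + n)%N); apply: funext => n; rewrite psmonE mul1r.
by case: leqP => [le | /Hf //]; rewrite subnKC.
Qed.

End PowerSeries.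

(** * The field of Laurent series and its filtration *)

(** The fraction field of the power series is kept abstract: only the embedding toW
    is used, and the terms stay small. *)
Lemma laurent_sig (k : fieldType) :
  {F : fieldType & {i : {rmorphism pseries k -> F} | injective i}}.
Proof.
exists {fraction (pseries k)}, (@tofrac (pseries k)).
by move=> f g /eqP; rewrite tofrac_eq => /eqP.
Qed.

Definition laurent (k : fieldType) : fieldType := projT1 (laurent_sig k).
Definition toW (k : fieldType) : {rmorphism pseries k -> laurent k} :=
  sval (projT2 (laurent_sig k)).

Section LaurentMorphism.

Variable k : fieldType.
Implicit Types f g : pseries k.

Lemma toW_eq f g : (toW k f == toW k g) = (f == g).
Proof. by apply: inj_eq; rewrite /toW; case: (projT2 _). Qed.

Lemma toW_eq0 f : (toW k f == 0) = (f == 0).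
Proof. by rewrite -(rmorph0 (toW k)) toW_eq. Qed.

Lemma toW0 : toW k 0 = 0. Proof. exact: rmorph0. Qed.
Lemma toW1 : toW k 1 = 1. Proof. exact: rmorph1. Qed.
Lemma toWD f g : toW k (f + g) = toW k f + toW k g. Proof. exact: rmorphD. Qed.
Lemma toWN f : toW k (- f) = - toW k f. Proof. exact: rmorphN. Qed.
Lemma toWB f g : toW k (f - g) = toW k f - toW k g. Proof. exact: rmorphB. Qed.
Lemma toWM f g : toW k (f * g) = toW k f * toW k g. Proof. exact: rmorphM. Qed.
Lemma toWXn n f : toW k (f ^+ n) = toW k f ^+ n. Proof. exact: rmorphXn. Qed.

End LaurentMorphism.

Section Laurent.

Variable k : fieldType.
Local Notation W := (laurent k).
Local Notation "f %:W" := (@toW k f) (at level 2, format "f %:W").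

(** The elements t ^ M f, with f a power series. *)
Definition val_ge (M : nat) (y : W) : Prop := exists f, y = (psmon 1 M * f)%:W.

Lemma val_ge_toW M (f : pseries k) :
  val_ge M f%:W <-> forall n, (n < M)%N -> f n = 0.
Proof.
rewrite ps_divt; split=> -[g]; last by move->; exists g.
by move/eqP; rewrite toW_eq => /eqP->; exists g.
Qed.

Lemma val_ge_ps (f : pseries k) : val_ge 0 f%:W.
Proof. by apply/val_ge_toW. Qed.

Lemma val_ge0P y : val_ge 0 y -> exists f, y = f%:W.
Proof. by case=> f ->; rewrite psmon10 mul1r; exists f. Qed.

Lemma val_ge0 M : val_ge M 0.
Proof. by exists 0; rewrite mulr0 toW0. Qed.

Lemma val_geD M x y : val_ge M x -> val_ge M y -> val_ge M (x + y).
Proof. by case=> f -> [g ->]; exists (f + g); rewrite mulrDr toWD. Qed.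

Lemma val_geN M x : val_ge M x -> val_ge M (- x).
Proof. by case=> f ->; exists (- f); rewrite mulrN toWN. Qed.

Lemma val_geB M x y : val_ge M x -> val_ge M y -> val_ge M (x - y).
Proof. by move=> Hx Hy; apply/val_geD/val_geN. Qed.

Lemma val_geM M N x y : val_ge M x -> val_ge N y -> val_ge (M + N) (x * y).
Proof.
case=> f -> [g ->]; exists (f * g).
by rewrite -toWM mulrACA psmonM mulr1.
Qed.

Lemma val_ge_le M N y : (M <= N)%N -> val_ge N y -> val_ge M y.
Proof.
move=> le [f ->]; exists (psmon 1 (N - M) * f).
by rewrite mulrA psmonM mulr1 subnKC.
Qed.

Lemma val_ge_mull M x y : val_ge 0 x -> val_ge M y -> val_ge M (x * y).
Proof. exact: val_geM. Qed.

Lemma val_ge_mulr M x y : val_ge M x -> val_ge 0 y -> val_ge M (x * y).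
Proof. by rewrite mulrC => Hx Hy; apply: val_ge_mull. Qed.

Lemma val_ge_sqr M x : val_ge M x -> val_ge M (x ^+ 2).
Proof.
by move=> Hx; rewrite expr2; apply: val_ge_mulr => //; apply: val_ge_le Hx.
Qed.

Lemma val_ge_sum M I (r : seq I) (P : pred I) (F : I -> W) :
  (forall i, P i -> val_ge M (F i)) -> val_ge M (\sum_(i <- r | P i) F i).
Proof.
move=> H; elim/big_rec: _ => [|i x Pi Hx]; first exact: val_ge0.
by apply: val_geD => //; apply: H.
Qed.

Lemma val_ge_inf y : (forall M, val_ge M y) -> y = 0.
Proof.
move=> H; have [f Ef] := val_ge0P (H 0%N); rewrite Ef in H *.
suff -> : f = 0 by rewrite toW0.
apply: funext => n; have /val_ge_toW := H n.+1; exact.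
Qed.

(** * Limits in the field of Laurent series *)

Definition tends (s : nat -> W) (l : W) : Prop :=
  forall M, exists L0, forall L, (L0 <= L)%N -> val_ge M (s L - l).

Lemma tends_unique s l l' : tends s l -> tends s l' -> l = l'.
Proof.
move=> Hl Hl'; apply/eqP; rewrite -subr_eq0; apply/eqP/val_ge_inf => M.
have [L1 H1] := Hl M; have [L2 H2] := Hl' M.
have -> : l - l' = (s (maxn L1 L2) - l') - (s (maxn L1 L2) - l) by ring.
by apply: val_geB; [apply: H2; rewrite leq_maxr | apply: H1; rewrite leq_maxl].
Qed.

Lemma tends_eq s s' l : (forall L, s L = s' L) -> tends s l -> tends s' l.
Proof. by move=> E H M; have [L0 HL] := H M; exists L0 => L /HL; rewrite E. Qed.

Lemma tends_cst l : tends (fun _ => l) l.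
Proof. by move=> M; exists 0%N => L _; rewrite subrr; apply: val_ge0. Qed.

Lemma tendsD s s' l l' :
  tends s l -> tends s' l' -> tends (fun L => s L + s' L) (l + l').
Proof.
move=> H H' M; have [L1 H1] := H M; have [L2 H2] := H' M.
exists (maxn L1 L2) => L; rewrite geq_max => /andP[/H1 h1 /H2 h2].
have -> : s L + s' L - (l + l') = (s L - l) + (s' L - l') by ring.
exact: val_geD.
Qed.

Lemma tends_sum (I : Type) (r : seq I) (s : I -> nat -> W) (l : I -> W) :
  (forall i, tends (s i) (l i)) ->
  tends (fun L => \sum_(i <- r) s i L) (\sum_(i <- r) l i).
Proof.
move=> H; elim: r => [|i r IH].
  by apply: tends_eq (tends_cst _) => L; rewrite !big_nil.
rewrite big_cons; apply: tends_eq (tendsD (H i) IH) => L.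
by rewrite big_cons.
Qed.

Lemma tends_val M s l : (forall L, val_ge M (s L)) -> tends s l -> val_ge M l.
Proof.
move=> Hs /(_ M)[L0 /(_ L0 (leqnn _)) H].
by have -> : l = s L0 - (s L0 - l); [ring | apply: val_geB].
Qed.

Lemma tendsM s s' l l' : (forall L, val_ge 0 (s L)) -> (forall L, val_ge 0 (s' L)) ->
  tends s l -> tends s' l' -> tends (fun L => s L * s' L) (l * l').
Proof.
move=> V V' H H' M; have [L1 H1] := H M; have [L2 H2] := H' M.
exists (maxn L1 L2) => L; rewrite geq_max => /andP[/H1 h1 /H2 h2].
have -> : s L * s' L - l * l' = s L * (s' L - l') + (s L - l) * l' by ring.
apply: val_geD; first exact: val_ge_mull.
by apply: val_ge_mulr => //; apply: tends_val H'.
Qed.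

Lemma tends_small s l (e : nat -> W) : tends s l ->
  (forall M, exists L0, forall L, (L0 <= L)%N -> val_ge M (e L)) ->
  tends (fun L => s L + e L) l.
Proof.
move=> Hs He; rewrite -[l]addr0; apply: tendsD => // M.
by have [L0 H] := He M; exists L0 => L /H; rewrite subr0.
Qed.

Lemma tends_subseq s l (r : nat -> nat) :
  (forall L, (L <= r L)%N) -> tends s l -> tends (s \o r) l.
Proof.
move=> Hr H M; have [L0 HL] := H M; exists L0 => L le.
by apply: HL; apply: leq_trans le (Hr L).
Qed.

Lemma series_tends (f : nat -> W) B : (forall n, val_ge (n - B) (f n)) ->
  exists l, tends (fun L => \sum_(n < L) f n) l.
Proof.
move=> Hf; have /choice[F EF] n : exists g, f n = g%:W.
  by apply/val_ge0P/val_ge_le/Hf.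
pose S : pseries k := fun m => \sum_(n < (m + B).+1) F n m.
exists S%:W => M; exists (M + B)%N => L le.
have -> : \sum_(n < L) f n = (\sum_(n < L) F n)%:W.
  by rewrite rmorph_sum; apply: eq_bigr => n _.
rewrite -toWB; apply/val_ge_toW => m lt; rewrite psB ps_sum.
have le' : ((m + B).+1 <= L)%N by lia.
rewrite -(subnKC le') big_split_ord /= /S addrAC subrr add0r big1 // => i _.
have := Hf ((m + B).+1 + i)%N; rewrite EF => /val_ge_toW; apply; lia.
Qed.

(** * Bilateral sums *)

(** The sum over -L <= n < L. *)
Definition bsum (L : nat) (f : int -> W) : W := \sum_(n < L) (f (Posz n) + f (Negz n)).

Lemma bsumS L f : bsum L.+1 f = bsum L f + (f (Posz L) + f (Negz L)).
Proof. by rewrite /bsum big_ord_recr. Qed.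

Lemma eq_bsum L f g : f =1 g -> bsum L f = bsum L g.
Proof. by move=> E; apply: eq_bigr => n _; rewrite !E. Qed.

Lemma bsumD L f g : bsum L (fun n => f n + g n) = bsum L f + bsum L g.
Proof. by rewrite -big_split; apply: eq_bigr => n _ /=; rewrite addrACA. Qed.

Lemma bsum_mulr L f a : bsum L (fun n => f n * a) = bsum L f * a.
Proof. by rewrite /bsum big_distrl; apply: eq_bigr => n _ /=; rewrite mulrDl. Qed.

Lemma bsum_mull L f a : bsum L (fun n => a * f n) = a * bsum L f.
Proof. by rewrite /bsum big_distrr; apply: eq_bigr => n _ /=; rewrite mulrDr. Qed.

Lemma bsum_exchange L (f : int -> int -> W) :
  bsum L (fun n => bsum L (f n)) = bsum L (fun m => bsum L (f^~ m)).
Proof.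
rewrite /bsum; under eq_bigr do rewrite -big_split.
rewrite exchange_big /=; apply: eq_bigr => m _.
by rewrite -big_split; apply: eq_bigr => n _ /=; rewrite addrACA.
Qed.

Lemma bsum_val M L f : (forall n, val_ge M (f n)) -> val_ge M (bsum L f).
Proof. by move=> H; apply: val_ge_sum => n _; apply: val_geD. Qed.

(** Shifting or reversing the index only changes the two end terms, which tend to 0
    for a decaying family. *)
Lemma bsum_shift L f : bsum L (fun n => f (n + 1)) =
  bsum L f + (f (Posz L) - f (- Posz L)).
Proof.
elim: L => [|L IH]; first by rewrite /bsum !big_ord0 oppr0 subrr addr0.
rewrite !bsumS IH.
have -> : Posz L + 1 = Posz L.+1 by lia.
have -> : Negz L + 1 = - Posz L by lia.
have -> : - Posz L.+1 = Negz L by lia.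
ring.
Qed.

Lemma bsum_opp L f : bsum L (fun n => f (- n)) = bsum L f + (f (Posz L) - f (- Posz L)).
Proof.
elim: L => [|L IH]; first by rewrite /bsum !big_ord0 oppr0 subrr addr0.
rewrite !bsumS IH.
have -> : - Negz L = Posz L.+1 by lia.
have -> : - Posz L.+1 = Negz L by lia.
ring.
Qed.

(** The bound on valuations that makes a bilateral series and all its shifts converge,
    since it is linear in the absolute value of n. *)
Definition decays (f : int -> W) : Prop :=
  exists B, forall n, val_ge (`|n|%N - B) (f n).

(** The value 0 for divergent sums makes blim total; all the sums below decay. *)
Definition blim (f : int -> W) : W :=
  if pselect (exists l, tends (bsum^~ f) l) is left H then sval (cid H) else 0.

Lemma blimP f : decays f -> tends (bsum^~ f) (blim f).
Proof.
case=> B Hf; rewrite /blim; case: pselect => [H|[]]; first by case: cid.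
apply: (@series_tends (fun n => f (Posz n) + f (Negz n)) B) => n.
by apply: val_geD; [apply: Hf | apply: val_ge_le (Hf (Negz n)); lia].
Qed.

Lemma blim_eq f l : decays f -> tends (bsum^~ f) l -> blim f = l.
Proof. by move=> Hf Hl; apply: tends_unique (blimP Hf) Hl. Qed.

Lemma decays_end f : decays f -> forall M, exists L0, forall L, (L0 <= L)%N ->
  val_ge M (f (Posz L)) /\ val_ge M (f (- Posz L)).
Proof.
case=> B Hf M; exists (M + B)%N => L le.
by split; [apply: val_ge_le (Hf L) | apply: val_ge_le (Hf (- Posz L))]; lia.
Qed.

Lemma decays_shift f a : decays f -> decays (fun n => f (n + a)).
Proof.
case=> B Hf; exists (B + `|a|)%N => n; apply: val_ge_le (Hf _); lia.
Qed.

Lemma decays_opp f : decays f -> decays (fun n => f (- n)).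
Proof. by case=> B Hf; exists B => n; apply: val_ge_le (Hf _); lia. Qed.

Lemma decaysD f g : decays f -> decays g -> decays (fun n => f n + g n).
Proof.
case=> B Hf [C Hg]; exists (B + C)%N => n.
by apply: val_geD; [apply: val_ge_le (Hf n) | apply: val_ge_le (Hg n)]; lia.
Qed.

Lemma decays_sqr f : decays f -> decays (fun n => f n ^+ 2).
Proof. by case=> B Hf; exists B => n; apply: val_ge_sqr. Qed.

Lemma decays_val f n : decays f -> val_ge 0 (f n).
Proof. by case=> B /(_ n); apply: val_ge_le. Qed.

Lemma blimD f g : decays f -> decays g -> blim (fun n => f n + g n) = blim f + blim g.
Proof.
move=> Hf Hg; apply: blim_eq; first exact: decaysD.
by apply: tends_eq (tendsD (blimP Hf) (blimP Hg)) => L; rewrite bsumD.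
Qed.

Lemma eq_blim f g : f =1 g -> blim f = blim g.
Proof. by move=> E; congr blim; apply: funext. Qed.

Lemma blim_opp f : decays f -> blim (fun n => f (- n)) = blim f.
Proof.
move=> Hf; apply: blim_eq; first exact: decays_opp.
apply: (@tends_eq (fun L => bsum L f + (f (Posz L) - f (- Posz L)))).
  by move=> L; rewrite bsum_opp.
apply: tends_small (blimP Hf) _ => M.
have [L0 H] := decays_end Hf M; exists L0 => L /H[h1 h2]; exact: val_geB.
Qed.

Lemma blim_shift1 f : decays f -> blim (fun n => f (n + 1)) = blim f.
Proof.
move=> Hf; apply: blim_eq; first exact: decays_shift.
apply: (@tends_eq (fun L => bsum L f + (f (Posz L) - f (- Posz L)))).
  by move=> L; rewrite bsum_shift.
apply: tends_small (blimP Hf) _ => M.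
have [L0 H] := decays_end Hf M; exists L0 => L /H[h1 h2]; exact: val_geB.
Qed.

Lemma blim_shift f a : decays f -> blim (fun n => f (n + a)) = blim f.
Proof.
have shiftn g (m : nat) : decays g -> blim (fun n => g (n + Posz m)) = blim g.
  elim: m g => [|m IH] g Hg; first by apply: eq_blim => n; rewrite addr0.
  rewrite -(blim_shift1 Hg) -(IH _ (decays_shift 1 Hg)).
  by apply: eq_blim => n; congr g; lia.
move=> Hf; case: a => m; first exact: shiftn.
rewrite -[RHS](@eq_blim (fun n => f (n + Posz m.+1 + Negz m))).
  by rewrite (shiftn (fun n => f (n + Negz m))) //; apply: decays_shift.
by move=> n; congr f; lia.
Qed.

(** Dominated convergence: the weights decay, so that only finitely many terms matter
    at a given precision. *)
Lemma bsum_dominated (a : int -> W) (s : int -> nat -> W) l :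
  decays a -> (forall n L, val_ge 0 (s n L)) -> (forall n, tends (s n) l) ->
  tends (fun L => bsum L (fun n => a n * s n L)) (blim a * l).
Proof.
move=> Ha Vs Hs.
have Vl : val_ge 0 l by apply: tends_val (Hs 0) => L.
apply: (@tends_eq (fun L => bsum L a * l + bsum L (fun n => a n * (s n L - l)))).
  move=> L; rewrite -bsum_mulr -bsumD; apply: eq_bsum => n; ring.
apply: tends_small.
  apply: tendsM (blimP Ha) (tends_cst l) => // L.
  by apply: bsum_val => n; apply: decays_val.
move=> M; case: (Ha) => B HB.
have [L0 HL0] : exists L0, forall L n, (L0 <= L)%N -> (`|n| < M + B)%N ->
    val_ge M (s n L - l).
  elim: (M + B)%N => [|N [L1 H1]]; first by exists 0%N.
  have [L2 H2] := Hs (Posz N) M; have [L3 H3] := Hs (- Posz N) M.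
  exists (maxn L1 (maxn L2 L3)) => L n; rewrite !geq_max => /and3P[l1 l2 l3].
  rewrite ltnS leq_eqVlt => /orP[/eqP E | lt]; last exact: H1.
  have [->|->] : n = Posz N \/ n = - Posz N by lia.
  - exact: H2.
  - exact: H3.
exists L0 => L le; apply: bsum_val => n.
have [lt|ge] := ltnP `|n| (M + B).
  by apply: val_ge_mull (HL0 _ _ le lt); apply: decays_val.
apply: val_ge_mulr; first by apply: val_ge_le (HB n); lia.
by apply: val_geB.
Qed.

End Laurent.

(** * The Tate curve in characteristic 2 *)

Section Char2Field.

Variable F : fieldType.
Hypothesis F2 : 2%N \in [pchar F].

(** In characteristic 2 an identity between polynomials holds as soon as it holds
    over the integers up to twice some w. *)
Lemma char2_eq (w x y : F) : x = y + (w + w) -> x = y.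
Proof. by rewrite (addrr_pchar2 F2) addr0. Qed.

Lemma char2_opp (x : F) : - x = x.
Proof. exact: (oppr_pchar2 F2). Qed.

Lemma char2_sqrD (x y : F) : (x + y) ^+ 2 = x ^+ 2 + y ^+ 2.
Proof. by apply: (@char2_eq (x * y)); ring. Qed.

Lemma char2_add_eq0 (x y : F) : (x + y == 0) = (x == y).
Proof. by rewrite -{1}(char2_opp y) subr_eq0. Qed.

Lemma char2_mulrn (x : F) n : x *+ n = if odd n then x else 0.
Proof.
elim: n => [|n IH]; first by rewrite mulr0n.
by rewrite mulrS IH /=; case: odd; rewrite ?addr0 // (addrr_pchar2 F2).
Qed.

Lemma char2_sqr_sum I (r : seq I) (P : pred I) (f : I -> F) :
  (\sum_(i <- r | P i) f i) ^+ 2 = \sum_(i <- r | P i) f i ^+ 2.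
Proof. by apply: (big_morph (fun x => x ^+ 2) char2_sqrD); rewrite expr0n. Qed.

(** The functions u / (1 + u) and u / (1 + u)^2, whose sums over u q^n, n an integer,
    give the functions z and x of the point u of the Tate curve; phi_sig makes z an
    Artin-Schreier root of x. *)
Definition sig (u : F) : F := u / (1 + u).
Definition phi (u : F) : F := u / (1 + u) ^+ 2.

Lemma phi_sig u : phi u = sig u ^+ 2 + sig u.
Proof.
have [->|n1] := eqVneq u 1.
  by rewrite /phi /sig (addrr_pchar2 F2) expr0n !invr0 !mulr0 expr0n addr0.
have n0 : 1 + u != 0 by rewrite char2_add_eq0 eq_sym.
rewrite /phi /sig; apply: (@char2_eq (- (u ^+ 2 / (1 + u) ^+ 2))); field.
exact: n0.
Qed.

Lemma sigV u : u != 0 -> u != 1 -> sig u^-1 = 1 + sig u.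
Proof.
move=> u0 u1; have n0 : 1 + u != 0 by rewrite char2_add_eq0 eq_sym.
rewrite /sig; apply: (@char2_eq (- (u / (1 + u)))); field.
by rewrite n0 u0.
Qed.

Lemma phiV u : u != 0 -> phi u^-1 = phi u.
Proof.
move=> u0; have [->|u1] := eqVneq u 1; first by rewrite invr1.
by rewrite !phi_sig sigV // char2_sqrD; apply: (@char2_eq 1); ring.
Qed.

(** The addition law of the Tate curve before summation. *)
Lemma phi_mul u v : u != 0 -> u != 1 -> v != 0 -> v != 1 -> v / u != 1 ->
  phi u * phi v = phi (v / u) * (sig u ^+ 2 + sig v ^+ 2).
Proof.
move=> u0 u1 v0 v1 uv; have U : 1 + u != 0 by rewrite char2_add_eq0 eq_sym.
have V : 1 + v != 0 by rewrite char2_add_eq0 eq_sym.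
have UV : u + v != 0.
  by rewrite char2_add_eq0; apply: contraNneq uv => ->; rewrite divff.
have -> : phi (v / u) = u * v / (u + v) ^+ 2.
  by rewrite /phi; field; rewrite u0 UV.
have -> : sig u ^+ 2 + sig v ^+ 2 = (u + v) ^+ 2 / ((1 + u) ^+ 2 * (1 + v) ^+ 2).
  rewrite -char2_sqrD -exprMn -expr_div_n; congr (_ ^+ 2); rewrite /sig.
  by apply: (@char2_eq (u * v / ((1 + u) * (1 + v)))); field; rewrite U V.
by rewrite /phi; field; rewrite U V UV.
Qed.

End Char2Field.

Section TateCurve.

Variable k : fieldType.
Hypothesis k2 : 2%N \in [pchar k].
Variable gam : k.
Hypothesis gam0 : gam != 0.

Local Notation W := (laurent k).
Local Notation "f %:W" := (@toW k f) (at level 2, format "f %:W").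

Lemma W2 : 2%N \in [pchar W].
Proof.
rewrite inE /= -(rmorph_nat (@toW k)) toW_eq0; apply/eqP.
apply: funext => n; rewrite mulr2n psD ps1.
by rewrite (addrr_pchar2 k2).
Qed.

Lemma psmon_neq0 (c : k) d : c != 0 -> psmon c d != 0 :> pseries k.
Proof.
move=> c0; apply/eqP => /(congr1 (fun f : pseries k => f d)).
by rewrite /psmon eqxx ps0 mulr1n => /eqP; apply/negP.
Qed.

(** Parameters on the curve are written additively: the pair (a, b) stands for
    gam ^ a * t ^ b, with gam a constant that will be a root of unity. *)
Definition up (Q : int * int) : W :=
  (psmon (gam ^ Q.1) 0)%:W * ((psmon 1 1)%:W ^ Q.2).

Let tW0 : (psmon (1 : k) 1)%:W != 0.
Proof. by rewrite toW_eq0 psmon_neq0 ?oner_eq0. Qed.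

Lemma upE Q : up Q = (psmon (gam ^ Q.1) 0)%:W * ((psmon 1 1)%:W ^ Q.2).
Proof. by []. Qed.

Lemma upD P Q : up (P + Q) = up P * up Q.
Proof.
have E : psmon (gam ^ (P + Q).1) 0 = psmon (gam ^ P.1) 0 * psmon (gam ^ Q.1) 0.
  by rewrite psmonM /= expfzDr.
by rewrite /up E toWM /= (expfzDr _ _ tW0) mulrACA.
Qed.

Lemma up0 : up 0 = 1.
Proof. by rewrite /up /= !expr0z psmon10 toW1 mulr1. Qed.

Lemma up_neq0 Q : up Q != 0.
Proof.
apply: mulf_neq0; last exact: (expfz_neq0 _ tW0).
by rewrite toW_eq0; apply/psmon_neq0/expfz_neq0.
Qed.

Lemma upN Q : up (- Q) = (up Q)^-1.
Proof.
apply: (mulIf (up_neq0 Q)); rewrite -upD addNr up0.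
by rewrite (mulVf (up_neq0 Q)).
Qed.

Lemma up_pos a (b : nat) : up (a, Posz b) = (psmon (gam ^ a) b)%:W.
Proof.
by rewrite /up -exprnP -toWXn -toWM psmonX expr1n muln1 psmonM mulr1.
Qed.

Lemma up_eq1 a b : up (a, b) = 1 <-> gam ^ a = 1 /\ b = 0.
Proof.
split=> [|[Ha ->]]; last by rewrite (up_pos a 0) Ha psmon10 toW1.
wlog [n En] : a b / exists n : nat, b = Posz n.
  move=> IH; case: b => n; first by apply: IH; exists n.
  move/(congr1 (@GRing.inv W)); rewrite invr1 -upN => /(IH (- a) n.+1) [].
    by exists n.+1.
  by move=> _ //.
rewrite En up_pos -toW1 => /eqP; rewrite toW_eq => /eqP E.
have E0 := congr1 (fun f : pseries k => f n) E; move: E0.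
rewrite /psmon eqxx mulr1n ps1; case: eqP => [-> /= ->//|_ /eqP].
by rewrite (negPf (expfz_neq0 _ gam0)).
Qed.


(* The geometric series is the inverse of 1 + c t^d in characteristic 2. *)
Let geom (c : k) (d : nat) : pseries k := fun n => if (d %| n)%N then c ^+ (n %/ d) else 0.

Let geomE c d : (0 < d)%N -> (1 + psmon c d) * geom c d = 1.
Proof.
move=> d0; apply: funext => n; rewrite mulrDl mul1r psD psmonE /geom ps1.
have [lt|le] := ltnP n d.
  rewrite addr0; case: (posnP n) => [->|n0]; first by rewrite dvdn0 div0n.
  by rewrite gtnNdvd //; case: n n0 lt.
have n0 : (0 < n)%N by apply: leq_trans le.
rewrite (_ : n == 0%N = false); last by case: n n0 {le}.
rewrite -{1 2}(subnK le) dvdn_addl // divnDr // divnn d0 addn1.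
case: ifP => _; rewrite ?mulr0 ?addr0 //.
by rewrite exprS (addrr_pchar2 k2).
Qed.

Lemma sig_psmon (c : k) d : (0 < d)%N ->
  exists g : pseries k, sig (psmon c d)%:W = (psmon c d * g)%:W.
Proof.
move=> d0; exists (geom c d); rewrite /sig toWM; congr (_ * _).
have E : (1 + (psmon c d)%:W) * (geom c d)%:W = 1.
  by rewrite -toW1 -toWD -toWM geomE // toW1.
have n0 : 1 + (psmon c d)%:W != 0.
  by apply: contra_eq_neq E => ->; rewrite mul0r eq_sym oner_eq0.
by apply: (mulfI n0); rewrite E divff.
Qed.

Lemma sig_val_pos a (b : nat) : val_ge b (sig (up (a, Posz b))).
Proof.
rewrite up_pos; case: (posnP b) => [->|b0].
  have -> : sig (psmon (gam ^ a) 0)%:W = (psmon (sig (gam ^ a)) 0)%:W.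
    rewrite /sig -toW1 -psmon10 -toWD.
    have -> : psmon 1 0 + psmon (gam ^ a) 0 = psmon (1 + gam ^ a) 0.
      by apply: funext => n; rewrite psD /psmon mulrnDl.
    have [E|n0] := eqVneq (1 + gam ^ a) 0.
      rewrite E invr0 mulr0.
      have -> : psmon (0 : k) 0 = 0 by apply: funext => n; rewrite /psmon mul0rn.
      by rewrite toW0 invr0 mulr0.
    apply: (mulIf (_ : (psmon (1 + gam ^ a) 0)%:W != 0)).
      by rewrite toW_eq0 psmon_neq0.
    rewrite mulfVK ?toW_eq0 ?psmon_neq0 // -toWM psmonM.
    by rewrite mulfVK.
  exact: val_ge_ps.
have [g ->] := sig_psmon (gam ^ a) b0.
by apply/val_ge_toW => n lt; rewrite psmonE leqNgt lt.
Qed.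

(** Towards negative exponents sig tends to 1, so the series for z needs a correcting
    term 1 at the negative indices. *)
Lemma sig_val_neg a (b : nat) : val_ge b.+1 (sig (up (a, Negz b)) + 1).
Proof.
have -> : (a, Negz b) = - (- a, Posz b.+1) by rewrite /= -[RHS]/(- - a, _) opprK.
have n1 : up (- a, Posz b.+1) != 1 by apply/eqP => /up_eq1[].
rewrite upN (sigV W2 (up_neq0 _) n1) addrAC (addrr_pchar2 W2) add0r.
exact: sig_val_pos.
Qed.

Lemma phi_val a b : val_ge `|b|%N (phi (up (a, b))).
Proof.
case: b => b; rewrite (phi_sig W2).
  by apply: val_geD; [apply: val_ge_sqr|]; apply: sig_val_pos.
set s := sig _; have -> : s ^+ 2 + s = (s + 1) ^+ 2 + (s + 1).
  by apply: (char2_eq W2 (w := - s - 1)); ring.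
by apply: val_geD; [apply: val_ge_sqr|]; apply: sig_val_neg.
Qed.

End TateCurve.

Section TateSeries.

Variable k : fieldType.
Hypothesis k2 : 2%N \in [pchar k].
Variable gam : k.
Hypothesis gam0 : gam != 0.

Local Notation W := (laurent k).
Local Notation up := (up gam).
Let W2 := W2 k2.

(** The parameter q ^ n, for q = t ^ E. *)
Definition qpt (E : nat) (n : int) : int * int := (0, Posz E * n).

Lemma qptD E m n : qpt E (m + n) = qpt E m + qpt E n.
Proof. by rewrite /qpt mulrDr. Qed.

Lemma qptN E n : qpt E (- n) = - qpt E n.
Proof. by rewrite /qpt mulrN. Qed.

Definition xterm E (Q : int * int) (n : int) : W := phi (up (Q + qpt E n)).
Definition zterm E (Q : int * int) (n : int) : W := sig (up (Q + qpt E n)) + (n < 0)%R%:R.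

(** The abscissa x of the point of parameter up Q on the Tate curve with q = t ^ E,
    and z such that x = z^2 + z. *)
Definition tx E (Q : int * int) : W := blim (xterm E Q).
Definition tz E (Q : int * int) : W := blim (zterm E Q).

(** The point up Q is not the origin of the curve. *)
Definition nontriv E (Q : int * int) : Prop := forall n, up (Q + qpt E n) != 1.

Lemma qpt_eta E Q n : Q + qpt E n = (Q.1, Q.2 + Posz E * n).
Proof. by case: Q => a b; rewrite /qpt /= -[LHS]/(a + 0, _) addr0. Qed.

Lemma mulz_bound E (n : int) : (0 < E)%N ->
  if n < 0 then Posz E * n <= n else n <= Posz E * n.
Proof.
case: E => // E _; rewrite -addn1 PoszD mulrDl mul1r.
case: (ltrP n 0) => Hn.
  by rewrite gerDr; apply: mulr_ge0_le0 => //; apply: ltW.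
by rewrite lerDr; apply: mulr_ge0.
Qed.

Lemma absz_shift (b n m : int) : (if n < 0 then m <= n else n <= m) ->
  (`|n| - `|b| <= `|(b + m)%R|)%N.
Proof. by case: ifP => H1 H2; lia. Qed.

Lemma absz_sign (b n m : int) : (if n < 0 then m <= n else n <= m) ->
  (n < 0) != (b + m < 0) -> (`|n| - `|b| <= 0)%N.
Proof. by case: ifP => H1 H2; lia. Qed.

Lemma xterm_decays E Q : (0 < E)%N -> decays (xterm E Q).
Proof.
move=> E0; exists `|Q.2|%N => n; rewrite /xterm qpt_eta.
apply: val_ge_le (phi_val k2 gam0 _ _).
exact: (absz_shift Q.2 (mulz_bound n E0)).
Qed.

Lemma zterm_decays E Q : (0 < E)%N -> decays (zterm E Q).
Proof.
move=> E0; exists `|Q.2|%N => n; rewrite /zterm qpt_eta.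
have := absz_shift Q.2 (mulz_bound n E0); have := absz_sign (mulz_bound n E0).
move/(_ Q.2); set N := (_ - _)%N.
have val1 : (N <= 0)%N -> val_ge N (1 : W).
  by move=> N0; apply: val_ge_le N0 _; rewrite -toW1; apply: val_ge_ps.
move: (Q.2 + Posz E * n) => [b|b].
  have H := sig_val_pos k2 gam Q.1 b; case: (n < 0) => /=; rewrite ?addr0 => Hs Hn.
    by apply: val_geD; [apply: val_ge_le Hn H | apply: val1 (Hs _)].
  exact: val_ge_le Hn H.
have H := sig_val_neg k2 gam0 Q.1 b; case: (n < 0) => /=; rewrite ?addr0 => Hs Hn.
  exact: val_ge_le Hn H.
rewrite -[sig _](addrK 1); apply: val_geB; first exact: val_ge_le Hn H.
exact: val1 (Hs _).
Qed.

Lemma bsum_sqr L (f : int -> W) : bsum L f ^+ 2 = bsum L (fun n => f n ^+ 2).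
Proof.
rewrite /bsum (char2_sqr_sum W2); apply: eq_bigr => n _.
by rewrite (char2_sqrD W2).
Qed.

Lemma tends_sqr (s : nat -> W) l : (forall L, val_ge 0 (s L)) -> tends s l ->
  tends (fun L => s L ^+ 2) (l ^+ 2).
Proof. by move=> V H; apply: tendsM. Qed.

Lemma blim_sqr (f : int -> W) : decays f -> blim (fun n => f n ^+ 2) = blim f ^+ 2.
Proof.
move=> Hf; apply: blim_eq; first exact: decays_sqr.
apply: (tends_eq (s := fun L => bsum L f ^+ 2)); first by move=> L; rewrite bsum_sqr.
apply: tends_sqr; last exact: blimP.
by move=> L; apply: bsum_val => n; apply: decays_val.
Qed.

Lemma tx_tz E Q : (0 < E)%N -> tx E Q = tz E Q ^+ 2 + tz E Q.
Proof.
move=> E0; have Hz := zterm_decays Q E0.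
rewrite /tx /tz -blim_sqr // -blimD //; last exact: decays_sqr.
apply: eq_blim => n; rewrite /xterm /zterm (phi_sig W2).
case: (n < 0); rewrite /= ?addr0 //; move: (sig _) => s.
by apply: (char2_eq W2 (w := - s - 1)); ring.
Qed.

Lemma nontriv_shift E Q m : nontriv E Q -> nontriv E (Q + qpt E m).
Proof. by move=> H n; rewrite -addrA -qptD; apply: H. Qed.

Lemma nontrivN E Q : nontriv E Q -> nontriv E (- Q).
Proof.
move=> H n; have -> : - Q + qpt E n = - (Q + qpt E (- n)).
  by rewrite qptN opprB addrC.
by rewrite (upN gam0) invr_eq1.
Qed.

Lemma tx_period E Q m : (0 < E)%N -> tx E (Q + qpt E m) = tx E Q.
Proof.
move=> E0; rewrite /tx -(blim_shift m (xterm_decays Q E0)).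
by apply: eq_blim => n; rewrite /xterm -addrA -qptD addrC [m + n]addrC addrC.
Qed.

Lemma txN E Q : (0 < E)%N -> tx E (- Q) = tx E Q.
Proof.
move=> E0; rewrite /tx -(blim_opp (xterm_decays Q E0)).
apply: eq_blim => n; rewrite /xterm.
have -> : - Q + qpt E n = - (Q + qpt E (- n)).
  by rewrite qptN opprB addrC.
by rewrite (upN gam0) (phiV W2) // up_neq0.
Qed.

Let delta0 (n : int) : W := (n == 0)%R%:R.

Let blim_delta0 : decays delta0 /\ blim delta0 = 1.
Proof.
have D : decays delta0.
  exists 0%N => n; rewrite /delta0; case: eqP => [->|_].
    by rewrite -toW1; apply: val_ge_ps.
  exact: val_ge0.
split=> //; apply: blim_eq => // M; exists 1%N => -[//|L _].
suff -> : bsum L.+1 delta0 = 1 by rewrite subrr; apply: val_ge0.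
elim: L => [|L IH]; first by rewrite bsumS /bsum big_ord0 add0r /delta0 /= addr0.
by rewrite bsumS IH /delta0 /= !addr0.
Qed.

(** Shifting the index moves one correcting term across 0, so z is a function on the
    universal cover only; its square plus itself is periodic. *)
Lemma tz_period E Q : (0 < E)%N -> tz E (Q + qpt E 1) = tz E Q + 1.
Proof.
move=> E0; have [D B1] := blim_delta0; have Hz := zterm_decays Q E0.
rewrite -B1 /tz -blimD // -(blim_shift 1 (decaysD Hz D)); apply: eq_blim => n.
rewrite /zterm -addrA -qptD [1 + n]addrC /delta0 -addrA; congr (_ + _).
have [lt|ge] := ltP n 0; have [lt'|ge'] := ltP (n + 1) 0;
  case: eqP => H; rewrite ?addr0 ?add0r //; lia.
Qed.

Lemma tzN E Q : (0 < E)%N -> nontriv E Q -> tz E (- Q) = tz E Q + 1.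
Proof.
move=> E0 HQ; have [D B1] := blim_delta0; have Hz := zterm_decays Q E0.
rewrite -B1 /tz -blimD // -(blim_opp (decaysD Hz D)); apply: eq_blim => n.
rewrite /zterm.
have -> : - Q + qpt E n = - (Q + qpt E (- n)).
  by rewrite qptN opprB addrC.
rewrite (upN gam0) (sigV W2 (up_neq0 gam0 _) (HQ _)) /delta0.
rewrite [1 + _]addrC -!addrA; congr (_ + _).
have [lt|ge] := ltP n 0; have [lt'|ge'] := ltP (- n) 0;
  case: eqP => H; rewrite ?addr0 ?add0r ?(addrr_pchar2 W2) //; lia.
Qed.

(** The value i is taken by n + m for i + 1 pairs (n, m), all in the square of side L
    when i < L; the other pairs contribute terms of large valuation. *)
Lemma double_sum (G : nat -> W) B L : (forall i, val_ge (i - B) (G i)) ->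
  val_ge (L - B) (\sum_(n < L) \sum_(m < L) G (n + m)%N - \sum_(i < L) G i *+ i.+1).
Proof.
move=> HG.
have E1 n : (n <= L)%N -> \sum_(m < L) G (n + m)%N =
    \sum_(n <= i < L) G i + \sum_(L <= i < n + L) G i.
  move=> le; rewrite -(big_cat_nat (n := L)) ?leq_addl //=.
  have := big_addn 0%N (n + L)%N n xpredT G => /(_ 0 +%R).
  rewrite add0n addKn big_mkord => ->.
  by apply: eq_bigr => m _; rewrite addnC.
have E2 : \sum_(n < L) \sum_(n <= i < L) G i = \sum_(i < L) G i *+ i.+1.
  elim: L {E1} => [|M IH]; first by rewrite !big_ord0.
  rewrite big_ord_recr /= big_ord_recr /= -IH big_nat1 mulrSr addrA; congr (_ + _).
  transitivity (\sum_(n < M) (\sum_(n <= i < M) G i + G M)).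
    by apply: eq_bigr => n _; rewrite big_nat_recr // ltnW.
  by rewrite big_split /= sumr_const card_ord.
under eq_bigr => n _ do rewrite E1 ?(ltnW (ltn_ord n)) //.
rewrite big_split /= E2 addrAC subrr add0r.
apply: val_ge_sum => n _; rewrite big_nat; apply: val_ge_sum => i /andP[le _].
by apply: val_ge_le (HG i); apply: leq_sub2r.
Qed.

Lemma odd_bsum E R L : bsum L (xterm (2 * E) (R + qpt E 1)) =
  \sum_(i < 2 * L | ~~ odd i) (xterm E R (Posz i.+1) + xterm E R (Negz i)).
Proof.
elim: L => [|L IH]; first by rewrite muln0 /bsum !big_ord0.
rewrite bsumS IH mulnS big_mkcond [in RHS]big_mkcond /= !big_ord_recr /=.
rewrite oddM /= addr0 -big_mkcond /=; congr (_ + (_ + _)).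
- by rewrite /xterm -addrA; congr (phi (up (R + _))); rewrite !qpt_eta /=; congr pair; lia.
- by rewrite /xterm -addrA; congr (phi (up (R + _))); rewrite !qpt_eta /=; congr pair; lia.
Qed.

(** By phi_mul, the product of the two series is a double sum of the terms of the
    series at Q - P, weighted by squares of sig. Up to the correcting terms, these
    weights sum to the z of P and Q; the correcting terms leave each term at the
    distance i of 0 with the multiplicity i, hence the terms of odd index, and these
    form the series at q (Q - P) for the parameter q^2. *)
Lemma tx_mul E P Q : (0 < E)%N ->
  nontriv E P -> nontriv E Q -> nontriv E (Q - P) ->
  tx E P * tx E Q = (tz E P ^+ 2 + tz E Q ^+ 2) * tx E (Q - P)
                    + tx (2 * E) (Q - P + qpt E 1).
Proof.
move=> E0 HP HQ HR; set R := Q - P.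
have xd S := xterm_decays S E0; have zd S := zterm_decays S E0.
have xv S L : val_ge 0 (bsum L (xterm E S)).
  by apply: bsum_val => n; apply: decays_val.
have E20 : (0 < 2 * E)%N by rewrite muln_gt0.
pose e (n : int) : W := (n < 0)%R%:R.
pose G i := xterm E R (Posz i.+1) + xterm E R (Negz i).
have zE S n : zterm E S n ^+ 2 = sig (up (S + qpt E n)) ^+ 2 + e n.
  rewrite /zterm (char2_sqrD W2) -/(e n); congr (_ + _).
  by rewrite /e; case: (n < 0); rewrite ?expr1n ?expr0n.
have GE L : bsum L (fun n => bsum L (fun m => xterm E R (m - n) * (e n + e m))) =
    \sum_(n < L) \sum_(m < L) G (n + m)%N.
  rewrite /bsum; apply: eq_bigr => n _; rewrite -big_split; apply: eq_bigr => m _.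
  rewrite /e /= !addr0 add0r (addrr_pchar2 W2) !mulr0 !mulr1 addr0 add0r addrC.
  by congr (xterm E R _ + xterm E R _); lia.
have prodE L : bsum L (xterm E P) * bsum L (xterm E Q) =
    bsum L (fun n => zterm E P n ^+ 2 * bsum L (fun m => xterm E R (m - n))) +
    bsum L (fun m => zterm E Q m ^+ 2 * bsum L (fun n => xterm E R (m - n))) +
    \sum_(n < L) \sum_(m < L) G (n + m)%N.
  rewrite -GE -bsum_mulr.
  have -> : bsum L (fun m => zterm E Q m ^+ 2 * bsum L (fun n => xterm E R (m - n)))
      = bsum L (fun n => bsum L (fun m => zterm E Q m ^+ 2 * xterm E R (m - n))).
    rewrite bsum_exchange; apply: eq_bsum => m; by rewrite bsum_mull.
  rewrite -!bsumD; apply: eq_bsum => n; rewrite -!bsum_mull -!bsumD.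
  apply: eq_bsum => m; rewrite /xterm.
  have EQ : up (Q + qpt E m) / up (P + qpt E n) = up (R + qpt E (m - n)).
    rewrite -(upN gam0) -(upD gam0) /R qptD qptN; congr up.
    by rewrite opprD addrACA.
  rewrite (phi_mul W2 (up_neq0 gam0 _) (HP n) (up_neq0 gam0 _) (HQ m));
    last by rewrite EQ; apply: HR.
  rewrite EQ !zE; move: (phi _) (sig _) (sig _) (e n) (e m) => f a b c d.
  by apply: (char2_eq W2 (w := - (f * c) - f * d)); ring.
pose r (L : nat) := (2 * L)%N.
have le_r L : (L <= r L)%N by rewrite /r; lia.
apply: (@tends_unique _ (fun L => bsum (r L) (xterm E P) * bsum (r L) (xterm E Q))).
  by apply: tendsM; rewrite // /r; apply: (tends_subseq le_r (blimP _)).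
pose s1 L := bsum L (fun n => zterm E P n ^+ 2 * bsum L (fun m => xterm E R (m - n))).
pose s2 L := bsum L (fun m => zterm E Q m ^+ 2 * bsum L (fun n => xterm E R (m - n))).
have t1 : tends s1 (tz E P ^+ 2 * tx E R).
  rewrite /tz -blim_sqr //; apply: bsum_dominated; first exact: decays_sqr.
    by move=> n L; apply: bsum_val => m; apply: decays_val.
  by move=> n; rewrite /tx -(blim_shift (- n) (xd R)); apply/blimP/decays_shift.
have t2 : tends s2 (tz E Q ^+ 2 * tx E R).
  rewrite /tz -blim_sqr //; apply: bsum_dominated; first exact: decays_sqr.
    by move=> n L; apply: bsum_val => m; apply: decays_val.
  move=> m; rewrite /tx -(blim_shift m (xd R)) -(blim_opp (decays_shift m (xd R))).
  apply: tends_eq (blimP (decays_opp (decays_shift m (xd R)))) => L.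
  by apply: eq_bsum => n; rewrite addrC.
apply: (@tends_eq _ (fun L => (s1 (r L) + s2 (r L)) +
    (bsum L (xterm (2 * E) (R + qpt E 1)) +
     (\sum_(n < r L) \sum_(m < r L) G (n + m)%N - \sum_(i < r L) G i *+ i.+1)))).
  move=> L; rewrite prodE -/(s1 _) -/(s2 _); congr (_ + _).
  rewrite odd_bsum -/(r L) [X in X + _](_ : _ = \sum_(i < r L) G i *+ i.+1).
    by rewrite addrC subrK.
  by rewrite big_mkcond; apply: eq_bigr => i _; rewrite (char2_mulrn W2) /=.
rewrite mulrDl; apply: tendsD.
  by apply: tendsD; apply: (tends_subseq le_r).
apply: tends_small; first exact/blimP/xterm_decays.
have [B HB] := xd R; move=> M; exists (M + B)%N => L le.
apply: (@val_ge_le _ _ (r L - B)); first by rewrite /r; lia.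
apply: double_sum => i; apply: val_geD.
  by apply: val_ge_le (HB i.+1); lia.
by apply: val_ge_le (HB (Negz i)); lia.
Qed.

End TateSeries.

(** * The addition law of the Tate curve *)

Section TateAddition.

Variable k : fieldType.
Hypothesis k2 : 2%N \in [pchar k].
Variable gam : k.
Hypothesis gam0 : gam != 0.

Local Notation W := (laurent k).
Local Notation tx := (tx gam).
Local Notation tz := (tz gam).
Local Notation xterm := (xterm gam).
Local Notation nontriv := (nontriv gam).
Let W2 := W2 k2.

Lemma qpt_mul m E n : qpt (m * E) n = qpt E (Posz m * n).
Proof. by rewrite /qpt PoszM mulrAC mulrC. Qed.

Lemma qpt_double E n : qpt (2 * E) n = qpt E (2 * n).
Proof. exact: qpt_mul. Qed.

(** The isogeny u -> u from the curve of parameter q^2 to that of parameter q. *)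
Lemma tx_split E Q : (0 < E)%N ->
  tx E Q = tx (2 * E) Q + tx (2 * E) (Q + qpt E 1).
Proof.
move=> E0; have E20 : (0 < 2 * E)%N by rewrite muln_gt0.
have xd F S F0 := @xterm_decays k k2 gam gam0 F S F0.
pose r (L : nat) := (2 * L)%N.
have le_r L : (L <= r L)%N by rewrite /r; lia.
apply: (tends_unique (tends_subseq le_r (blimP (xd E Q E0)))).
apply: tends_eq (tendsD (blimP (xd _ Q E20)) (blimP (xd _ (Q + qpt E 1) E20))) => L.
rewrite /= /r; elim: L => [|L IH]; first by rewrite muln0 /bsum !big_ord0 addr0.
rewrite mulnS !bsumS -IH -!addrA; congr (_ + _).
rewrite /xterm -[Q + qpt E 1 + _]addrA -[Q + qpt E 1 + _]addrA !qpt_double -!qptD.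
have -> : 2 * Posz L = Posz (2 * L) by lia.
have -> : 2 * Negz L = Negz (2 * L).+1 by lia.
have -> : 1 + Posz (2 * L) = Posz (2 * L).+1 by lia.
have -> : 1 + Negz (2 * L).+1 = Negz (2 * L) by lia.
ring.
Qed.

Lemma nontriv_double E Q : nontriv E Q -> nontriv (2 * E) Q.
Proof. by move=> H n; rewrite qpt_double. Qed.

(** The discriminant, which is also the abscissa of q on the curve of parameter
    q^4. *)
Definition tdisc E : W := tx (4 * E) (qpt E 1).

(** The two factors are the abscissas of the preimages of Q under the isogeny of
    tx_split. In tx_mul the difference of the two points is q, on the curve of parameter
    q^2; this is the point of order 2, of abscissa 0. *)
Lemma tx_half_mul E Q : (0 < E)%N -> nontriv E Q ->
  tx (2 * E) Q * tx (2 * E) (Q + qpt E 1) = tdisc E.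
Proof.
move=> E0 HQ; have E20 : (0 < 2 * E)%N by rewrite muln_gt0.
have R : Q + qpt E 1 - Q = qpt E 1 by rewrite addrAC subrr add0r.
rewrite tx_mul // ?R.
- have -> : tx (2 * E) (qpt E 1) = 0.
    apply: blim_eq; first exact: xterm_decays.
    apply: (tends_eq (s := fun=> 0)); last exact: tends_cst.
    move=> L; rewrite /bsum big1 // => n _; rewrite /xterm !qpt_double -!qptD.
    have -> : 1 + 2 * Negz n = - (1 + 2 * Posz n) by lia.
    by rewrite (qptN E) (upN gam0) (phiV W2) ?(addrr_pchar2 W2) // up_neq0.
  rewrite mulr0 add0r mulnA -/(4 * E)%N qpt_double -qptD.
  have -> : qpt E (1 + 2 * 1) = - qpt E 1 + qpt (4 * E) 1.
    by rewrite -qptN qpt_mul -qptD.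
  by rewrite (tx_period k2 gam0) ?muln_gt0 // (txN k2 gam0) ?muln_gt0.
- exact: nontriv_double.
- exact/nontriv_double/nontriv_shift.
- move=> n; rewrite qpt_double -qptD /qpt; apply/eqP => /(up_eq1 gam0)[_ /eqP].
  by rewrite mulf_eq0 => /orP[] /eqP; lia.
Qed.

(** The function z drops out of tx_mul on eliminating the abscissas of parameter q^2
    by means of tx_split and tx_half_mul. *)
Lemma tx_add E P Q : (0 < E)%N ->
  nontriv E P -> nontriv E Q -> nontriv E (Q - P) ->
  tx E P ^+ 2 * tx E Q ^+ 2 + (tx E P ^+ 2 + tx E Q ^+ 2) * tx E (Q - P) ^+ 2
    + tx E P * tx E Q * tx E (Q - P) = tdisc E.
Proof.
move=> E0 HP HQ HR.
have H1 := tx_mul k2 gam0 E0 HP HQ HR.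
have H2 := tx_half_mul E0 HR.
have H3 := tx_split (Q - P) E0.
have HzP := tx_tz k2 gam0 P E0; have HzQ := tx_tz k2 gam0 Q E0.
rewrite HzP HzQ in H1 *; rewrite -H2.
have -> : tx (2 * E) (Q - P) = tx E (Q - P) - tx (2 * E) (Q - P + qpt E 1).
  by rewrite H3 addrK.
move: (tx E _) (tx (2 * E) _) (tz E P) (tz E Q) H1 => x y z1 z2 H1.
have -> : y = (z1 ^+ 2 + z1) * (z2 ^+ 2 + z2) - (z1 ^+ 2 + z2 ^+ 2) * x.
  by rewrite H1 addrAC subrr add0r.
apply: (char2_eq W2 (w := ((z1 ^+ 2 + z1) * (z2 ^+ 2 + z2)) ^+ 2
  - (z1 ^+ 2 + z1) * (z2 ^+ 2 + z2) * (z1 ^+ 2 + z2 ^+ 2) * x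
  + (z1 ^+ 4 + z2 ^+ 4 + z1 ^+ 2 + z2 ^+ 2 + z1 ^+ 3 + z2 ^+ 3
     + z1 ^+ 2 * z2 ^+ 2) * x ^+ 2)).
ring.
Qed.

Lemma tx_double E Q : (0 < E)%N -> nontriv E Q -> nontriv E (Q *+ 2) ->
  tx E Q ^+ 4 + tx E Q ^+ 2 * tx E (Q *+ 2) = tdisc E.
Proof.
move=> E0 HQ HQ2; have E2 : Q - - Q = Q *+ 2 by rewrite opprK mulr2n.
have := @tx_add E (- Q) Q E0 (nontrivN gam0 HQ) HQ.
rewrite E2 (txN k2 gam0) // => <- //. move: (tx E Q) (tx E (Q *+ 2)) => x y.
by apply: (char2_eq W2 (w := - (x ^+ 2 * y ^+ 2))); ring.
Qed.

(** The abscissas of Q + P and Q - P are the two roots of the quadratic equation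
    tx_add, so that their sum is read off its coefficients. *)
Lemma tx_addsub E P Q : (0 < E)%N ->
  nontriv E P -> nontriv E Q -> nontriv E (Q - P) -> nontriv E (Q + P) ->
  tx E P != tx E Q -> tx E (Q + P) != tx E (Q - P) ->
  tx E (Q + P) = tx E (Q - P) + tx E P * tx E Q / (tx E P + tx E Q) ^+ 2.
Proof.
move=> E0 HP HQ Hm Hp ne; have A1 := tx_add E0 HP HQ Hm.
have := @tx_add E (- P) Q E0 (nontrivN gam0 HP) HQ; rewrite opprK (txN k2 gam0) //.
move=> /(_ Hp); rewrite -A1 {A1}.
move: (tx E P) (tx E Q) (tx E (Q - P)) (tx E (Q + P)) ne => x1 x2 y z ne A yz.
have n0 : x1 + x2 != 0 by rewrite (char2_add_eq0 W2).
have n1 : z + y != 0 by rewrite (char2_add_eq0 W2).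
have E1 : (z + y) * (x1 + x2) ^+ 2 = x1 * x2.
  apply: (mulfI n1); apply/eqP; rewrite -(char2_add_eq0 W2).
  move/eqP: A; rewrite -(char2_add_eq0 W2) => /eqP A; rewrite -A; apply/eqP.
  apply: (char2_eq W2 (w := y * z * (x1 + x2) ^+ 2 + x1 * x2 * (z ^+ 2 + y ^+ 2)
    - x1 ^+ 2 * x2 ^+ 2)); ring.
apply/eqP; rewrite -(char2_add_eq0 W2) addrA -E1 mulfK ?expf_neq0 //.
by rewrite (char2_add_eq0 W2).
Qed.

End TateAddition.

(** * Substitutions in series over F_2 *)

Lemma F2P (x : 'F_2) : x = 0 \/ x = 1.
Proof. by case: x => -[|[|//]] Hx; [left | right]; apply: val_inj. Qed.

Section Substitution.

Variable k : fieldType.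
Hypothesis k2 : 2%N \in [pchar k].

Definition f2k (x : 'F_2) : k := (x : nat)%:R.

Lemma f2kD x y : f2k (x + y) = f2k x + f2k y.
Proof.
have [-> | ->] := F2P x; have [-> | ->] := F2P y;
  by rewrite /f2k /= ?addr0 ?add0r // (addrr_pchar2 k2).
Qed.

Lemma f2kM x y : f2k (x * y) = f2k x * f2k y.
Proof.
by have [-> | ->] := F2P x; rewrite ?mul0r ?mul1r /f2k /= ?mul0r ?mul1r.
Qed.

Lemma f2k_eq0 x : (f2k x == 0) = (x == 0).
Proof. by have [-> | ->] := F2P x; rewrite /f2k /= ?eqxx // !oner_eq0. Qed.

(** Substitution of c t^d for the variable. *)
Definition psub (c : k) (d : nat) (f : pseries 'F_2) : pseries k :=
  fun n => if (d %| n)%N then c ^+ (n %/ d) * f2k (f (n %/ d)%N) else 0.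

Lemma psubE c d f n : (0 < d)%N -> psub c d f (d * n)%N = c ^+ n * f2k (f n).
Proof. by move=> d0; rewrite /psub dvdn_mulr // mulKn. Qed.

Lemma psubD c d f g : psub c d (f + g) = psub c d f + psub c d g.
Proof.
apply: funext => n; rewrite psD /psub; case: ifP => _; rewrite ?addr0 //.
by rewrite psD f2kD mulrDr.
Qed.

Lemma psub0 c d : psub c d 0 = 0.
Proof. by apply: funext => n; rewrite /psub ps0 mulr0 if_same. Qed.

Lemma psub_sum c d I (r : seq I) (P : pred I) (F : I -> pseries 'F_2) :
  psub c d (\sum_(i <- r | P i) F i) = \sum_(i <- r | P i) psub c d (F i).
Proof. by apply: (big_morph (psub c d)); [exact: psubD | exact: psub0]. Qed.

Lemma psub1 c d : (0 < d)%N -> psub c d 1 = 1.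
Proof.
move=> d0; apply: funext => n; rewrite /psub !ps1.
case: (posnP n) => [->|n0]; first by rewrite dvdn0 div0n expr0 mul1r.
case: ifP => // /dvdnP[m Em]; rewrite Em mulnK // (_ : m == 0%N = false) ?mulr0 //.
by apply/eqP => m0; rewrite Em m0 in n0.
Qed.

Lemma big_multiples (d m : nat) (F : nat -> k) : (0 < d)%N ->
  \sum_(i < (d * m).+1) (if (d %| i)%N then F (i %/ d)%N else 0) = \sum_(j < m.+1) F j.
Proof.
move=> d0; rewrite -big_mkcond /=.
have val_q (i : 'I_(d * m).+1) : (inord (i %/ d) : 'I_m.+1) = (i %/ d)%N :> nat.
  have le : (i <= d * m)%N by rewrite -ltnS.
  by rewrite inordK // ltnS; move/(leq_div2r d): le; rewrite mulKn.
rewrite (reindex_onto (fun j : 'I_m.+1 => inord (d * j) : 'I_(d * m).+1)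
                      (fun i => inord (i %/ d))) /=.
  apply: eq_big => [j|j _]; last by rewrite inordK ?mulKn // ltnS leq_mul2l -ltnS ltn_ord orbT.
  have E : (inord (d * j) : 'I_(d * m).+1) = (d * j)%N :> nat.
    by rewrite inordK // ltnS leq_mul2l -ltnS ltn_ord orbT.
  by rewrite E dvdn_mulr // mulKn // inord_val eqxx.
move=> i di; apply: val_inj; rewrite /= val_q inordK mulnC divnK //.
Qed.

Lemma f2k_sum I (r : seq I) (P : pred I) (F : I -> 'F_2) :
  f2k (\sum_(i <- r | P i) F i) = \sum_(i <- r | P i) f2k (F i).
Proof. exact: (big_morph f2k f2kD). Qed.

Lemma psubM c d f g : (0 < d)%N -> psub c d (f * g) = psub c d f * psub c d g.
Proof.
move=> d0; apply: funext => n; rewrite [RHS]psM.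
have [/dvdnP[m ->]|ndvd] := boolP (d %| n)%N; last first.
  rewrite /psub (negPf ndvd) big1 // => i _; case: ifP => di; last by rewrite mul0r.
  rewrite (_ : (d %| n - i)%N = false) ?mulr0 //.
  apply/negP => /(dvdn_add di); rewrite subnKC ?(negPf ndvd) //.
  by rewrite -ltnS.
rewrite mulnC psubE // psM f2k_sum big_distrr /=.
rewrite -(@big_multiples d m (fun j => c ^+ m * f2k (f j * g (m - j)%N))) //.
apply: eq_bigr => i _; rewrite [psub c d f _]/psub; case: ifP => [/dvdnP[j Ej]|_]; last first.
  by rewrite mul0r.
have le : (j <= m)%N by move: (ltn_ord i); rewrite Ej ltnS mulnC leq_pmul2l.
rewrite Ej mulnK // [(j * d)%N]mulnC -mulnBr psubE // f2kM.
by rewrite -{1}(subnKC le) exprD mulrACA.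
Qed.

Lemma psubX c d f n : (0 < d)%N -> psub c d (f ^+ n) = psub c d f ^+ n.
Proof.
by move=> d0; elim: n => [|n IH]; rewrite ?psub1 // !exprS psubM // IH.
Qed.

Lemma psub_inj c d : (0 < d)%N -> c != 0 -> injective (psub c d).
Proof.
move=> d0 c0 f g E; apply: funext => n; apply/eqP; rewrite -subr_eq0 -f2k_eq0.
have := congr1 (fun h : pseries k => h (d * n)%N) E; rewrite !psubE //.
move/(mulfI (expf_neq0 n c0)) => En.
have [Eg|Eg] := F2P (g n); rewrite Eg in En *; first by rewrite subr0 En f2k_eq0.
have -> : f n - 1 = f n + 1 by congr (_ + _); apply: val_inj.
by rewrite f2kD En (addrr_pchar2 k2).
Qed.

End Substitution.

(** * The expansion of the discriminant *)

Lemma F22 : 2%N \in [pchar 'F_2].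
Proof. exact: (pchar_Fp (p := 2)). Qed.

(** In characteristic 2 the pairs exchanged by an involution cancel. *)
Lemma sum_involution (T : finType) (F : fieldType) (F2 : 2%N \in [pchar F])
    (P : pred T) (i : T -> T) (f : T -> F) :
  (forall x, P x -> P (i x)) -> (forall x, P x -> i (i x) = x) ->
  (forall x, P x -> f (i x) = f x) ->
  \sum_(x | P x) f x = \sum_(x | P x && (i x == x)) f x.
Proof.
move=> Pi ii fi; rewrite (bigID (fun x => i x == x)) /= [X in _ + X](_ : _ = 0) ?addr0 //.
rewrite (bigID (fun x => enum_rank x < enum_rank (i x))%N) /=.
rewrite [X in X + _](reindex_onto i i) /=; last by move=> x /andP[/andP[Px _] _]; apply: ii.
set A := (X in X + _); set B := (X in _ + X).
suff -> : A = B by rewrite (addrr_pchar2 F2).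
apply: eq_big => x; last first.
  by case/andP=> /andP[/andP[Pix _] _] /eqP E; apply: fi; rewrite -E; apply: Pi.
apply/idP/idP.
  case/andP=> /andP[/andP[Pix nix] lt] /eqP E.
  have Px : P x by rewrite -E; apply: Pi.
  rewrite Px; rewrite E in nix lt *; rewrite eq_sym nix /= -leqNgt; exact: ltnW.
case/andP=> /andP[Px nix] ge; rewrite (Pi x Px) (ii x Px) eqxx andbT /= eq_sym nix /=.
rewrite ltn_neqAle leqNgt ge andbT; apply: contra nix => /eqP/val_inj/enum_rank_inj->.
by [].
Qed.

(** The expansions of phi (q), and of the sum of the phi (q ^ N) over N > 0. *)
Definition phiS : pseries 'F_2 := fun n => (odd n)%:R.
Definition GS : pseries 'F_2 := fun n =>
  \sum_(j < n.+1) [&& 0 < j, j %| n & odd (n %/ j)]%N%:R.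

(** Delta, as an element of the ring of power series. *)
Definition DeltaS : pseries 'F_2 := Delta.

(** Exchanging the two factors is an involution on the terms of a square. *)
Lemma sqr_ps (f : pseries 'F_2) n : (f ^+ 2) n = if odd n then 0 else f n./2.
Proof.
rewrite expr2 psM.
rewrite (@sum_involution _ _ F22 xpredT (@rev_ord n.+1)) //; first last.
- move=> i _; have le_in : (i <= n)%N by rewrite -ltnS.
  by rewrite /= subSS (subKn le_in) [LHS]mulrC.
- by move=> i _; apply: rev_ordK.
case: ifP => on.
  rewrite big1 // => i /eqP/(congr1 val) /= H.
  by exfalso; move: (ltn_ord i) H on; lia.
have lt : (n./2 < n.+1)%N by lia.
rewrite (big_pred1 (Ordinal lt)).
  rewrite /= (_ : n - n./2 = n./2)%N; last by lia.
  by have [->|->] := F2P (f n./2); rewrite ?mulr0 ?mulr1.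
move=> i; apply/eqP/eqP => [/(congr1 val) /= H|->]; apply: val_inj => /=.
  by move: (ltn_ord i); lia.
by lia.
Qed.

(** The coefficient of q^n in G counts the divisors j of n with n / j odd. For n even,
    j odd contributes nothing and j even matches a term of G^2; for n odd the
    involution j -> n / j leaves only the square root of n. *)
Lemma GS_Delta : GS + GS ^+ 2 = DeltaS.
Proof.
apply: funext => n; rewrite psD sqr_ps /DeltaS /Delta; case: ifP => on; last first.
  rewrite [RHS]big1; last first.
    move=> m _; rewrite (_ : _ == n = false) //; apply/eqP => En.
    by move: on; rewrite -En oddX /= odd_double.
  rewrite -[X in _ + X](@big_multiples 'F_2 2 n./2
    (fun j => [&& 0 < j, j %| n./2 & odd (n./2 %/ j)]%N%:R)) //.
  have En : n = (2 * n./2)%N by lia.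
  rewrite {1}/GS -En -big_split big1 // => i _ /=; case: ifP => [/dvdnP[j Ei]|].
    have key m : [&& 0 < j * 2, j * 2 %| 2 * m & odd (2 * m %/ (j * 2))]%N =
        [&& 0 < j, j %| m & odd (m %/ j)]%N.
      by rewrite [(j * 2)%N]mulnC muln_gt0 dvdn_pmul2l // divnMl.
    by rewrite Ei mulnK // -key -En (addrr_pchar2 F22).
  move=> odd_i; rewrite addr0; case: (boolP (i %| n)%N) => [/dvdnP[j Ej]|];
    last by rewrite andbF.
  have i0 : (0 < i)%N by case: (i : nat) odd_i.
  suff -> : odd (n %/ i) = false by rewrite !andbF.
  have -> : (n %/ i = j)%N by have := mulnK j i0; rewrite -Ej.
  have : odd (j * i) = false by rewrite -Ej.
  by move: odd_i; rewrite oddM dvdn2 => /negbFE->; rewrite andbT.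
have n0 : (0 < n)%N by case: n on.
rewrite addr0 /GS; under eq_bigr => j _ do rewrite mulrb.
rewrite -big_mkcond /=.
have val_inv (j : 'I_n.+1) : (inord (n %/ j) : 'I_n.+1) = (n %/ j)%N :> nat.
  by rewrite inordK // ltnS leq_div.
rewrite (@sum_involution _ _ F22 _ (fun j : 'I_n.+1 => inord (n %/ j))) //; first last.
- move=> j /and3P[j0 jn _]; apply: val_inj; rewrite /= !val_inv divnA //.
  by rewrite mulKn.
- move=> j /and3P[j0 jn oj]; rewrite val_inv divn_gt0 // dvdn_leq //=.
  rewrite dvdn_div // divnA // mulKn //.
  by apply: contraLR on; apply: contra => /(dvdn_odd jn).
have fixE (j : 'I_n.+1) : [&& 0 < j, j %| n & odd (n %/ j)]%N &&
    (inord (n %/ j) == j) = (j * j == n)%N.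
  apply/idP/eqP => [/andP[/and3P[j0 jn _] /eqP/(congr1 val)]|E].
    by rewrite /= val_inv => Ej; rewrite -{1}Ej divnK.
  have j0 : (0 < j)%N by case: (j : nat) E n0 => [<-|].
  have jn : (j %| n)%N by have := dvdn_mulr j (dvdnn j); rewrite E.
  have dv : (n %/ j = j)%N by have := mulnK j j0; rewrite E.
  have oj : odd j by have : odd (j * j) by [rewrite E]; rewrite oddM andbb.
  by rewrite j0 jn dv oj inord_val eqxx.
rewrite [LHS](eq_bigl (fun j : 'I_n.+1 => (j * j == n)%N)); last exact: fixE.
rewrite big_mkcond /=; case: (boolP [exists r : 'I_n.+1, (r * r == n)%N]); last first.
  rewrite negb_exists => /forallP nr; rewrite !big1 // => [m _|j _].
    rewrite (_ : _ == n = false) //; apply/negP => /eqP Em.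
    have lt : (m.*2.+1 <= m.*2.+1 ^ 2)%N by rewrite -mulnn leq_pmulr.
    rewrite Em -ltnS in lt.
    by have := nr (Ordinal lt); rewrite /= mulnn Em eqxx.
  by rewrite (negPf (nr j)).
case/existsP=> r /eqP Er; have or : odd r by have : odd (r * r) by [rewrite Er]; rewrite oddM andbb.
have inj_sq a : (a * a == n)%N = (a == r).
  by have := eqn_exp2r a r (isT : 0 < 2)%N; rewrite -!mulnn Er.
rewrite -big_mkcond (eq_bigl (pred1 r)) ?big_pred1_eq; last first.
  by move=> j; rewrite inj_sq.
have lt : (r./2 < n.+1)%N by move: (ltn_ord r); lia.
rewrite (bigD1 (Ordinal lt)) //= big1 ?addr0 => [|m ne].
  by rewrite -mulnn inj_sq (_ : _ == _ = true) //; apply/eqP; lia.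
rewrite -mulnn inj_sq (_ : _ == _ = false) //; apply: contraNF ne => /eqP E.
by apply/eqP/val_inj => /=; rewrite -E; lia.
Qed.

Section Expansions.

Variable k : fieldType.
Hypothesis k2 : 2%N \in [pchar k].

Local Notation W := (laurent k).
Local Notation "f %:W" := (toW k f) (at level 2, format "f %:W").
Let W2 := W2 k2.

Lemma psub_psmon (c : k) d : (0 < d)%N -> psub c d (psmon 1 1) = psmon c d.
Proof.
move=> d0; apply: funext => n; rewrite /psub /psmon.
case: ifP => [/dvdnP[m ->]|nd]; last first.
  by rewrite (_ : n == d = false) //; apply/eqP => E; rewrite E dvdnn in nd.
rewrite mulnK // -{2}[d]mul1n eqn_pmul2r //; case: eqP => [->|_].
  by rewrite expr1 mulr1n /f2k /= mulr1.
by rewrite mulr0n /f2k /= mulr0.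
Qed.

Lemma phiSE : (1 + psmon 1 1) ^+ 2 * phiS = psmon 1 1.
Proof.
have -> : (1 + psmon (1 : 'F_2) 1) ^+ 2 = 1 + psmon 1 2.
  rewrite sqrrD expr1n mul1r mulr2n psmonX expr1n.
  suff -> : psmon (1 : 'F_2) 1 + psmon 1 1 = 0 by rewrite addr0.
  by apply: funext => n; rewrite psD (addrr_pchar2 F22).
apply: funext => n; rewrite mulrDl mul1r psD psmonE mul1r /phiS /psmon.
case: n => [|[|n]]; rewrite ?addr0 //= subn2 /= negbK.
by rewrite (addrr_pchar2 F22).
Qed.

Lemma phi_psub (c : k) d : (0 < d)%N -> phi (psmon c d)%:W = (psub c d phiS)%:W.
Proof.
move=> d0.
have E : (1 + (psmon c d)%:W) ^+ 2 * (psub c d phiS)%:W = (psmon c d)%:W.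
  rewrite -toW1 -toWD -toWXn -toWM; congr (_%:W).
  rewrite -{2}(psub_psmon c d0) -phiSE psubM // psubX // psubD // psub1 //.
  by rewrite psub_psmon.
have n0 : 1 + (psmon c d)%:W != 0.
  rewrite -toW1 -toWD toW_eq0; apply/eqP => /(congr1 (fun f : pseries k => f 0%N)).
  rewrite psD ps1 /psmon (_ : 0%N == d = false) ?addr0 ?ps0; last by case: d d0 {E}.
  by move/eqP; rewrite oner_eq0.
by rewrite /phi -{1}E mulrAC mulfV ?mul1r // expf_neq0.
Qed.

Lemma phi1 : phi (1 : W) = 0.
Proof. by rewrite /phi (addrr_pchar2 W2) expr0n invr0 mulr0. Qed.

(** The term N = 0 of the sum is phi 1 = 0. *)
Lemma G_tends (c : k) d : (0 < d)%N -> c != 0 ->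
  tends (fun L => \sum_(N < L) phi ((psmon c d)%:W ^+ N)) (psub c d GS)%:W.
Proof.
move=> d0 c0 M; exists M => L le; apply: val_ge_le le _.
have -> : \sum_(N < L) phi ((psmon c d)%:W ^+ N) =
    (\sum_(N < L | (0 < N)%N) psub (c ^+ N) (N * d) phiS)%:W.
  rewrite rmorph_sum [RHS]big_mkcond; apply: eq_bigr => N _.
  case: posnP => [->|N0]; first by rewrite expr0 phi1.
  by rewrite -toWXn psmonX phi_psub // muln_gt0 N0.
rewrite -toWB; apply/val_ge_toW => n lt; rewrite psB ps_sum.
rewrite {2}/psub; case: ifP => [/dvdnP[m Em]|nd]; last first.
  rewrite subr0 big1 // => N _; rewrite /psub; case: ifP => // /(dvdn_trans _) H.
  by rewrite H ?dvdn_mull // in nd.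
have lt_m : (m < L)%N by apply: leq_trans lt; rewrite ltnS Em leq_pmulr.
rewrite Em mulnK //.
have termE N : (0 < N)%N -> psub (c ^+ N) (N * d) phiS (m * d)%N =
    c ^+ m * ((N %| m)%N && odd (m %/ N))%:R.
  move=> N0; rewrite /psub dvdn_pmul2r // divnMr //; case: ifP => [Nm|_]; last first.
    by rewrite mulr0.
  by rewrite -exprM [(N * _)%N]mulnC divnK // /phiS /f2k; case: (odd _).
have -> : \sum_(N < L | (0 < N)%N) psub (c ^+ N) (N * d) phiS (m * d)%N =
    \sum_(N < m.+1 | (0 < N)%N) c ^+ m * ((N %| m)%N && odd (m %/ N))%:R.
  rewrite -(subnKC lt_m) big_mkcond big_split_ord /= -big_mkcond [X in _ + X]big1.
    by rewrite addr0; apply: eq_bigr => N; apply: termE.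
  move=> i _; rewrite addSn termE // -addSn.
  by rewrite divn_small ?andbF ?mulr0 // addSn ltnS leq_addr.
rewrite /GS (f2k_sum k2) mulr_sumr big_mkcond -sumrB big1 // => N _.
case: posnP => [->|N0]; first by rewrite /f2k /= mulr0 subrr.
have -> : forall b : bool, f2k k b%:R = b%:R by case.
by rewrite subrr.
Qed.

(** The sum of the zeta ^ (i m) over i is p = 1 or 0, as p divides m or not. *)
Lemma psub_trace (zeta : k) p (f : pseries 'F_2) d : (0 < d)%N -> odd p ->
  p.-primitive_root zeta ->
  \sum_(i < p) psub (zeta ^+ i) d f = psub 1 (d * p) (fun n => f (p * n)%N).
Proof.
move=> d0 op prim; have p0 := prim_order_gt0 prim.
apply: funext => n; rewrite ps_sum {2}/psub.
have [/dvdnP[m ->]|nd] := boolP (d %| n)%N; last first.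
  rewrite (_ : (d * p %| n)%N = false) ?big1 // => [i _|].
    by rewrite /psub (negPf nd).
  by apply: contraNF nd; apply: dvdn_trans; apply: dvdn_mulr.
transitivity ((\sum_(i < p) (zeta ^+ m) ^+ i) * f2k k (f m)).
  rewrite big_distrl; apply: eq_bigr => i _.
  by rewrite mulnC psubE // exprAC.
rewrite [(d * p)%N]mulnC dvdn_pmul2r // divnMr // expr1n mul1r.
have [/dvdnP[j Ej]|nd] := boolP (p %| m)%N.
  have -> : (p * (m %/ p) = m)%N by rewrite Ej mulnK // mulnC.
  rewrite (eq_bigr (fun=> 1)) => [|i _]; last first.
    by rewrite Ej mulnC exprM (prim_expr_order prim) !expr1n.
  by rewrite sumr_const card_ord (char2_mulrn k2) op mul1r.
rewrite (_ : \sum_(i < p) _ = 0) ?mul0r //.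
have ne : zeta ^+ m - 1 != 0.
  by rewrite subr_eq0 -(prim_order_dvd prim).
apply: (mulfI ne); rewrite mulr0 -subrX1 -exprM mulnC exprM.
by rewrite (prim_expr_order prim) expr1n subrr.
Qed.

End Expansions.

(** * Velu formulas for the quotients of the Tate curve *)

Lemma half_sum (V : zmodType) h (g : nat -> V) :
  \sum_(r < h.*2.+1) g r = g 0%N + \sum_(i < h) (g i.+1 + g (h.*2 - i)%N).
Proof.
rewrite big_ord_recl /=; congr (_ + _); rewrite big_split /= -addnn big_split_ord /=.
congr (_ + _); rewrite [RHS](reindex_inj rev_ord_inj) /=; apply: eq_bigr => i _.
by congr g; rewrite /bump /=; move: (ltn_ord i); lia.
Qed.

Section Isogenies.

Variable k : fieldType.
Hypothesis k2 : 2%N \in [pchar k].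
Variable gam : k.
Hypothesis gam0 : gam != 0.

Local Notation W := (laurent k).
Local Notation up := (up gam).
Local Notation tx := (tx gam).
Local Notation xterm := (xterm gam).
Local Notation "f %:W" := (toW k f) (at level 2, format "f %:W").
Let W2 := W2 k2.

Lemma upX Q n : up (Q *+ n) = up Q ^+ n.
Proof.
by elim: n => [|n IH]; rewrite ?mulr0n ?(up0 gam) // mulrS (upD gam0) IH exprS.
Qed.

Lemma up_q E : up (qpt E 1) = (psmon 1 E)%:W.
Proof. by rewrite /qpt mulr1 up_pos expr0z. Qed.

Lemma qpt_nat E n : qpt E (Posz n) = qpt E 1 *+ n.
Proof.
elim: n => [|n IH]; first by rewrite /qpt mulr0 mulr0n.
by rewrite mulrS -IH -qptD; congr qpt; lia.
Qed.

Lemma up_qn E n : up (qpt E (Posz n)) = (psmon 1 E)%:W ^+ n.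
Proof. by rewrite qpt_nat upX up_q. Qed.

Lemma phi_sqr (u : W) : phi u ^+ 2 = phi (u ^+ 2).
Proof. by rewrite /phi expr_div_n -[in RHS](expr1n W 2) -(char2_sqrD W2). Qed.

Lemma sig_sqr (u : W) : sig u ^+ 2 = sig (u ^+ 2).
Proof. by rewrite /sig expr_div_n (char2_sqrD W2) expr1n. Qed.

(** Grouping the terms of opposite index, the abscissa of q on the curve of parameter
    q^4 is the sum of the phi (q ^ N) over N odd, that is, G + G^2. *)
Lemma tdiscE E : (0 < E)%N -> tdisc gam E = (psub 1 E DeltaS)%:W.
Proof.
move=> E0; rewrite -GS_Delta psubD // psubX // toWD toWXn.
set q := (psmon 1 E)%:W; pose r n L := (n.+1 * L)%N.
have le_r n L : (L <= r n L)%N by rewrite /r mulSn leq_addr.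
pose s L : W := \sum_(N < L) phi (q ^+ N).
have sT : tends s (psub 1 E GS)%:W by apply: G_tends; rewrite ?oner_neq0.
apply: blim_eq; first by apply: xterm_decays; rewrite ?muln_gt0.
apply: (tends_eq (s := fun L => s (r 3 L) + s (r 1 L) ^+ 2)).
  elim=> [|L IH]; first by rewrite /s /r !muln0 /bsum !big_ord0 expr0n addr0.
  rewrite bsumS -IH /s /r !mulnS !(addnC _ (_ * L)%N) !addnS !addn0 !big_ord_recr /=.
  rewrite /xterm !qpt_mul -!qptD.
  have -> : 1 + Posz 4 * Posz L = Posz (4 * L).+1 by lia.
  have -> : 1 + Posz 4 * Negz L = - Posz (4 * L).+3 by lia.
  rewrite qptN (upN gam0) (phiV W2) ?(up_neq0 gam0) // !up_qn -/q.
  rewrite !(char2_sqrD W2) !phi_sqr -!exprM.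
  have -> : (2 * L * 2 = 4 * L)%N by lia.
  have -> : ((2 * L).+1 * 2 = (4 * L).+2)%N by lia.
  move: (phi (q ^+ (4 * L).+1)) (phi (q ^+ (4 * L).+2)) (phi (q ^+ (4 * L).+3)).
  move: (phi (q ^+ (4 * L))) (\sum_(_ < _) _) (_ ^+ 2) => a b c d e f.
  by apply: (char2_eq W2 (w := a + e)); ring.
apply: tendsD; first exact: (tends_subseq (le_r 3)).
apply: tends_sqr; last exact: (tends_subseq (le_r 1)).
move=> L; apply: val_ge_sum => N _; rewrite -up_qn.
exact: val_ge_le (phi_val k2 gam0 _ _).
Qed.

(** With s the root of q, the abscissas involve every s^N, N > 0, with p not dividing N;
    the missing terms of G (s) are those of G (q), as s^p = q. *)
Lemma sum_tx_root E h a d : (0 < E)%N -> (0 < d)%N ->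
  up ((a, Posz d) *+ h.*2.+1) = up (qpt E 1) ->
  \sum_(i < h) tx E ((a, Posz d) *+ i.+1) =
  (psub (gam ^ a) d GS)%:W + (psub 1 E GS)%:W.
Proof.
move=> E0 d0; set s := (a, Posz d); set p := h.*2.+1 => Hs.
pose u := up s; pose q := up (qpt E 1).
have Eq : q = u ^+ p by rewrite /q -Hs upX.
pose r L := (p * L)%N.
have le_r L : (L <= r L)%N by rewrite /r mulSn leq_addr.
have T1 : tends (fun L => \sum_(N < L) phi (u ^+ N)) (psub (gam ^ a) d GS)%:W.
  by rewrite /u up_pos; apply: G_tends => //; apply: expfz_neq0.
have T2 : tends (fun L => \sum_(N < L) phi (q ^+ N)) (psub 1 E GS)%:W.
  by rewrite /q up_q; apply: G_tends; rewrite ?oner_neq0.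
apply: (@tends_unique _ (fun L => \sum_(i < h) bsum L (xterm E (s *+ i.+1)))).
  by apply: tends_sum => i; apply/blimP/xterm_decays.
apply: (tends_eq _ (tendsD (tends_subseq le_r T1) T2)) => L; rewrite /= /r.
elim: L => [|L IH].
  by rewrite muln0 !big_ord0 addr0 big1 // => i _; rewrite /bsum big_ord0.
rewrite [RHS](eq_bigr (fun i : 'I_h => bsum L (xterm E (s *+ i.+1)) +
    (phi (u ^+ (p * L + i.+1)) + phi (u ^+ (p * L + (h.*2 - i)))))); last first.
  move=> i _; rewrite bsumS; congr (_ + (phi _ + _)).
    by rewrite (upD gam0) upX up_qn -up_q -/q Eq -exprM exprD mulrC.
  rewrite /xterm (_ : Negz L = - Posz L.+1) // qptN (upD gam0) (upN gam0).
  rewrite upX up_qn -up_q -/q -/u Eq -(phiV W2); last first.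
    by rewrite mulf_neq0 ?invr_eq0 ?expf_neq0 ?up_neq0.
  congr phi; rewrite invf_div -exprM.
  have lt := ltn_ord i.
  have -> : (p * L.+1 = i.+1 + (p * L + (h.*2 - i)))%N by rewrite mulnS /p; lia.
  by rewrite exprD mulrAC mulfV ?mul1r // expf_neq0 // up_neq0.
rewrite big_split /= -IH mulnS [(p + _)%N]addnC big_split_ord /=.
rewrite [X in _ + X]big_ord_recr /= Eq -exprM.
have HS := half_sum h (fun r => phi (u ^+ (p * L + r))).
rewrite -/p addn0 in HS; rewrite HS.
set A := \sum_(_ < p * L) _; set B := \sum_(_ < L) _; set C := \sum_(_ < h) _.
by apply: (char2_eq W2 (w := phi (u ^+ (p * L)))); ring.
Qed.

(** Here Delta (s) = G (s) + G (s)^2, and the abscissas sum to G (s) + G (q). *)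
Lemma velu_root E h a d : (0 < E)%N -> (0 < d)%N ->
  up ((a, Posz d) *+ h.*2.+1) = up (qpt E 1) ->
  let t := \sum_(i < h) tx E ((a, Posz d) *+ i.+1) in
  (psub (gam ^ a) d DeltaS)%:W = tdisc gam E + t + t ^+ 2.
Proof.
move=> E0 d0 Hs t; rewrite /t (sum_tx_root E0 d0 Hs) tdiscE // -!GS_Delta.
rewrite !psubD // !psubX // !toWD !toWXn (char2_sqrD W2).
move: (psub (gam ^ a) d GS)%:W (psub 1 E GS)%:W => x y.
by apply: (char2_eq W2 (w := - y - y ^+ 2)); ring.
Qed.

(** The sum of phi (zeta q^N) over the p-th roots of unity zeta is phi (q^(p N)), so
    the abscissas sum to G (q^p) + G (q), up to a constant equal to its square. *)
Lemma velu_unity E h a : (0 < E)%N -> (h.*2.+1).-primitive_root (gam ^ a) ->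
  let t := \sum_(i < h) tx E ((a, 0) *+ i.+1) in
  (psub 1 (E * h.*2.+1) DeltaS)%:W = tdisc gam E + t + t ^+ 2.
Proof.
move=> E0; set p := h.*2.+1; set s := (a, 0) => prim t.
pose u := up s; pose q := up (qpt E 1).
have up1 : u ^+ p = 1.
  rewrite /u (up_pos gam a 0) -toWXn psmonX muln0 (prim_expr_order prim).
  by rewrite psmon10 toW1.
have u0 n : u ^+ n != 0 by rewrite expf_neq0 // up_neq0.
have ui i : (i < h)%N -> u ^+ (h.*2 - i) = (u ^+ i.+1)^-1.
  move=> lt; apply: (mulfI (u0 i.+1)); rewrite mulfV // -exprD.
  by have -> : (i.+1 + (h.*2 - i) = p)%N by rewrite /p; lia.
pose A n := \sum_(i < h) phi (u ^+ i.+1 * q ^+ n).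
pose B n := \sum_(i < h) phi (u ^+ (h.*2 - i) * q ^+ n).
have AB0 : A 0%N = B 0%N.
  by apply: eq_bigr => i _; rewrite !mulr1 ui // (phiV W2).
(* The constant term of t is invariant under squaring, as this permutes the p-th
   roots of unity. *)
have kap : A 0%N ^+ 2 = A 0%N.
  pose g n := sig (u ^+ n) * phi (u ^+ n).
  have Eg : A 0%N = \sum_(r < p) g r.
    rewrite (half_sum h g) {1}/g expr0 (phi1 k2) mulr0 add0r.
    apply: eq_bigr => i _; rewrite /g mulr1 ui // (phiV W2) //.
    have [E1|n1] := eqVneq (u ^+ i.+1) 1; first by rewrite E1 (phi1 k2) !mulr0 addr0.
    rewrite (sigV W2) //; move: (sig _) (phi _) => x y.
    by apply: (char2_eq W2 (w := - (x * y))); ring.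
  rewrite Eg (char2_sqr_sum W2).
  have gmod n : g (n %% p)%N = g n by rewrite /g expr_mod.
  have p0 : (0 < p)%N by [].
  rewrite [RHS](reindex_inj (h := fun i : 'I_p => Ordinal (ltn_pmod (2 * i) p0))) /=.
    apply: eq_bigr => i _; rewrite gmod /g exprMn phi_sqr sig_sqr -!exprM.
    by rewrite mulnC.
  move=> i j /(congr1 val) /= /eqP H; apply: val_inj.
  wlog le : i j H / (i <= j)%N.
    by move=> IH; case/orP: (leq_total i j) => le; [|symmetry]; apply: IH; rewrite // eq_sym.
  move: H; rewrite eq_sym eqn_mod_dvd ?leq_mul2l //= -mulnBr Gauss_dvdr; last first.
    by rewrite coprimen2 /p /= odd_double.
  move=> dv; apply/eqP; rewrite eqn_leq le /= -subn_eq0.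
  by case: posnP => // /dvdn_leq /(_ dv); move: (ltn_ord j); lia.
have Eu : u = (psmon (gam ^ a) 0)%:W by rewrite /u (up_pos gam a 0).
have AB n : A n + B n = phi ((q ^+ p) ^+ n) + phi (q ^+ n).
  have [->|n0] := posnP n; first by rewrite AB0 !expr0 !(addrr_pchar2 W2).
  have En0 : (0 < E * n)%N by rewrite muln_gt0 E0.
  have HS := half_sum h (fun j => phi (u ^+ j * q ^+ n)).
  rewrite expr0 mul1r big_split /= in HS.
  suff -> : phi ((q ^+ p) ^+ n) = phi (q ^+ n) + (A n + B n).
    by apply: (char2_eq W2 (w := - phi (q ^+ n))); ring.
  rewrite -HS -/p.
  transitivity (\sum_(j < p) psub ((gam ^ a) ^+ j) (E * n) phiS)%:W.
    rewrite (psub_trace k2) //; last by rewrite /= odd_double.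
    have -> : (fun m => phiS (p * m)%N) = phiS.
      by apply: funext => m; rewrite /phiS oddM /= odd_double.
    rewrite -phi_psub ?muln_gt0 ?E0 ?n0 // /q up_q -!toWXn !psmonX !expr1n.
    by congr (phi (psmon 1 _)%:W); rewrite mulnA mulnC mulnA.
  rewrite rmorph_sum; apply: eq_bigr => j _; rewrite -phi_psub //.
  by rewrite /q up_q Eu -!toWXn -toWM !psmonX psmonM muln0 expr1n mulr1 mulnC.
have tE : t = A 0%N + ((psub 1 (E * p) GS)%:W + (psub 1 E GS)%:W).
  apply: (@tends_unique _ (fun L => \sum_(i < h) bsum L (xterm E (s *+ i.+1)))).
    by apply: tends_sum => i; apply/blimP/xterm_decays.
  have T1 : tends (fun L => \sum_(N < L) phi ((q ^+ p) ^+ N)) (psub 1 (E * p) GS)%:W.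
    rewrite /q up_q -toWXn psmonX expr1n mulnC.
    by apply: G_tends; rewrite ?oner_neq0 ?muln_gt0 ?E0.
  have T2 : tends (fun L => \sum_(N < L) phi (q ^+ N)) (psub 1 E GS)%:W.
    by rewrite /q up_q; apply: G_tends; rewrite ?oner_neq0.
  apply: (tends_eq (s := fun L => A 0%N + (\sum_(N < L) phi ((q ^+ p) ^+ N) +
      \sum_(N < L) phi (q ^+ N)) + B L)); last first.
    apply: tends_small; first exact: tendsD (tends_cst _) (tendsD T1 T2).
    move=> M; exists M => L le; apply: val_ge_sum => i _.
    rewrite /q -upX -qpt_nat /u -upX -(upD gam0).
    have -> : s *+ (h.*2 - i) + qpt E L = (a *+ (h.*2 - i), Posz E * Posz L).
      by rewrite pairMnE mul0rn /qpt -[LHS]/(_ + 0, 0 + _) addr0 add0r.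
    apply: val_ge_le (phi_val k2 gam0 _ _).
    by rewrite -PoszM /=; apply: leq_trans le (leq_pmull _ E0).
  elim=> [|L IH].
    rewrite !big_ord0 !addr0 AB0 (addrr_pchar2 W2) big1 // => i _.
    by rewrite /bsum big_ord0.
  rewrite [RHS](eq_bigr (fun i : 'I_h => bsum L (xterm E (s *+ i.+1)) +
      (phi (u ^+ i.+1 * q ^+ L) + phi (u ^+ (h.*2 - i) * q ^+ L.+1)))); last first.
    move=> i _; rewrite bsumS; congr (_ + (phi _ + _)).
      by rewrite (upD gam0) upX up_qn -up_q.
    rewrite /xterm (_ : Negz L = - Posz L.+1) // qptN (upD gam0) (upN gam0).
    rewrite upX up_qn -up_q -/q -/u ui // -(phiV W2); last first.
      by rewrite mulf_neq0 ?invr_eq0 ?expf_neq0 ?up_neq0.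
    by rewrite invf_div mulrC.
  rewrite big_split /= -IH big_split /= -/(A L) -/(B L.+1) !big_ord_recr /=.
  have := AB L; move: (phi ((q ^+ p) ^+ L)) (phi (q ^+ L)) => x y AL.
  have -> : A L = x + y + B L.
    by rewrite -AL; apply: (char2_eq W2 (w := - B L)); ring.
  move: (A 0%N) (B L) (B L.+1) (\sum_(_ < L) _) (\sum_(_ < L) _) => a0 b b' c d.
  by apply: (char2_eq W2 (w := - b)); ring.
rewrite tE tdiscE // -!GS_Delta !psubD ?muln_gt0 ?E0 // !psubX ?muln_gt0 ?E0 //.
rewrite !toWD !toWXn !(char2_sqrD W2) kap.
move: (psub 1 (E * p) GS)%:W (psub 1 E GS)%:W (A 0%N) => x y z.
by apply: (char2_eq W2 (w := - y - y ^+ 2 - z)); ring.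
Qed.

End Isogenies.

(** * Separation of the points of the Tate curve *)

Section Injectivity.

Variable k : fieldType.
Hypothesis k2 : 2%N \in [pchar k].
Variable gam : k.
Hypothesis gam0 : gam != 0.

Local Notation W := (laurent k).
Local Notation up := (up gam).
Local Notation tx := (tx gam).
Local Notation xterm := (xterm gam).
Local Notation nontriv := (nontriv gam).
Local Notation "f %:W" := (toW k f) (at level 2, format "f %:W").

Lemma blim_head M (f : int -> W) : decays f ->
  (forall n, n != 0 -> val_ge M (f n)) -> val_ge M (blim f - f 0).
Proof.
move=> Hf H; apply: (@tends_val _ _ (fun L => bsum L.+1 f + (- f 0))).
  elim=> [|L IH].
    rewrite bsumS /bsum big_ord0 add0r -[f (Posz 0)]/(f 0) addrAC subrr add0r.
    exact: H.
  by rewrite bsumS addrAC; apply: val_geD => //; apply: val_geD; apply: H.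
apply: tendsD (tends_cst _) => M'.
by have [L0 HL] := blimP Hf M'; exists L0 => L le; apply: HL; apply: leq_trans le _.
Qed.

(** The leading coefficient of phi (gam ^ a * t ^ b). *)
Definition lead_phi (a : int) (b : nat) : k := if b is 0 then phi (gam ^ a) else gam ^ a.

Lemma phi_lead a (b : nat) : up (a, Posz b) != 1 -> exists F : pseries k,
  [/\ phi (up (a, Posz b)) = F%:W, F b = lead_phi a b & lead_phi a b != 0].
Proof.
rewrite up_pos; case: b => [|b] n1.
  have c1 : 1 + gam ^ a != 0.
    rewrite (char2_add_eq0 k2); apply: contraNneq n1 => <-.
    by rewrite psmon10 toW1.
  exists (psmon (phi (gam ^ a)) 0); rewrite /lead_phi /psmon eqxx mulr1n; split=> //.
    rewrite /phi -toW1 -psmon10 -toWD.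
    have -> : psmon 1 0 + psmon (gam ^ a) 0 = psmon (1 + gam ^ a) 0.
      by apply: funext => n; rewrite psD /psmon mulrnDl.
    rewrite -toWXn psmonX muln0.
    apply: (mulIf (_ : (psmon ((1 + gam ^ a) ^+ 2) 0)%:W != 0)).
      by rewrite toW_eq0 psmon_neq0 // expf_neq0.
    rewrite mulfVK ?toW_eq0 ?psmon_neq0 ?expf_neq0 // -toWM psmonM.
    by rewrite mulfVK // expf_neq0.
  by rewrite /phi mulf_neq0 ?invr_eq0 ?expf_neq0 // expfz_neq0.
exists (psub (gam ^ a) b.+1 phiS); split; first exact: phi_psub.
  by rewrite -{2}[b.+1]muln1 psubE // expr1 /f2k /= mulr1.
exact: expfz_neq0.
Qed.

(** Equality of points up to sign. *)
Definition same_x E (Q Q' : int * int) : Prop :=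
  exists n, up Q' = up (Q + qpt E n) \/ up Q' = up (- Q + qpt E n).

Lemma same_x_sym E Q Q' : same_x E Q Q' -> same_x E Q' Q.
Proof.
move=> [n H]; have q0 : up (qpt E n) != 0 by exact: up_neq0.
have Q0 := up_neq0 gam0 Q.
case: H; rewrite (upD gam0) => EQ.
  by exists (- n); left; rewrite qptN (upD gam0) EQ (upN gam0) mulfK.
exists n; right; rewrite (upD gam0) (upN gam0) EQ (upN gam0) invfM invrK.
by rewrite mulfVK.
Qed.

Lemma same_x_trans E Q Q' Q'' : same_x E Q Q' -> same_x E Q' Q'' -> same_x E Q Q''.
Proof.
move=> [n H] [m H'].
case: H => HQ; case: H' => HQ'; rewrite (upD gam0) ?(upN gam0) HQ in HQ'.
- by exists (n + m); left; rewrite HQ' -(upD gam0) -addrA -qptD.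
- exists (m - n); right; rewrite HQ' -(upN gam0) -(upD gam0) qptD qptN.
  by rewrite opprD -addrA [- qpt E n + _]addrC.
- by exists (n + m); right; rewrite HQ' -(upD gam0) -addrA -qptD.
- exists (m - n); left; rewrite HQ' -(upN gam0) -(upD gam0) qptD qptN.
  by rewrite opprD opprK -addrA [- qpt E n + _]addrC.
Qed.

(** Up to sign and powers of q, a parameter has valuation between 0 and that of the
    square root of q; as E is odd, the upper bound is strict. *)
Lemma reduce_pt E Q : odd E -> nontriv E Q -> exists a (b : nat),
  [/\ (2 * b < E)%N, same_x E Q (a, Posz b), nontriv E (a, Posz b)
    & tx E (a, Posz b) = tx E Q].
Proof.
move=> oE HQ; have E0 : (0 < E)%N by case: E oE {HQ}.
have Ez : Posz E != 0 by rewrite eqz_nat -lt0n.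
pose n := (Q.2 %/ Posz E)%Z; pose r := (Q.2 %% Posz E)%Z.
have r0 : 0 <= r by apply: modz_ge0.
have rE : r < Posz E by have := ltz_mod Q.2 Ez.
have En : Q.2 = n * Posz E + r by apply: divz_eq.
have [lt|ge] := ltP (2 * r) (Posz E).
  have Eb : (Q.1, Posz `|r|%N) = Q + qpt E (- n).
    by rewrite qpt_eta; congr pair; rewrite gez0_abs // En; lia.
  exists Q.1, `|r|%N; rewrite Eb; split; first by lia.
  - by exists (- n); left.
  - exact: nontriv_shift.
  - exact: tx_period.
have Eb : (- Q.1, Posz `|Posz E - r|%N) = - Q + qpt E (n + 1).
  rewrite qpt_eta; congr pair; rewrite gez0_abs /= ?En; last by lia.
  by ring.
exists (- Q.1), `|Posz E - r|%N; rewrite Eb; split; first by lia.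
- by exists (n + 1); right.
- exact/nontriv_shift/nontrivN.
- by rewrite tx_period // txN.
Qed.

(** For 2 b < E the term of index 0 dominates the series of the abscissa. *)
Lemma tx_lead E a (b : nat) : (2 * b < E)%N ->
  val_ge b.+1 (tx E (a, Posz b) - phi (up (a, Posz b))).
Proof.
move=> lt; have E0 : (0 < E)%N by lia.
have -> : phi (up (a, Posz b)) = xterm E (a, Posz b) 0.
  by rewrite /xterm qpt_eta mulr0 addr0.
apply: blim_head; first exact: xterm_decays.
move=> n n0; rewrite /xterm qpt_eta; apply: val_ge_le (phi_val k2 gam0 _ _).
rewrite /=; have := mulz_bound; case: n n0 => [[//|n]|n] _.
  by rewrite -PoszM -PoszD absz_nat mulnS; lia.
have -> : Posz E * Negz n = - Posz (E * n.+1) by rewrite NegzE mulrN.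
by rewrite mulnS; lia.
Qed.

(** For reduced parameters the leading term of the abscissa is that of phi; it
    determines the parameter, up to inversion when its valuation is 0. *)
Lemma tx_inj E Q Q' : odd E -> nontriv E Q -> nontriv E Q' ->
  tx E Q = tx E Q' -> same_x E Q Q'.
Proof.
move=> oE HQ HQ'.
have [a [b [lb sQ nb <-]]] := reduce_pt oE HQ.
have [a' [b' [lb' sQ' nb' <-]]] := reduce_pt oE HQ'.
move=> Ex; apply: same_x_trans sQ _; apply: same_x_sym; apply: same_x_trans sQ' _.
move: {Q Q' HQ HQ'} nb nb' Ex lb lb'.
have n1 x y : nontriv E (x, Posz y) -> up (x, Posz y) != 1.
  by move/(_ 0); rewrite qpt_eta mulr0 addr0.
wlog le : a b a' b' / (b <= b')%N.
  move=> IH; case/orP: (leq_total b b') => le nb nb' Ex lb lb'; first exact: IH.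
  by apply: same_x_sym; apply: IH.
move=> nb nb' Ex lb lb'.
have [F [EF Fb Fn0]] := phi_lead (n1 _ _ nb).
have [G [EG Gb Gn0]] := phi_lead (n1 _ _ nb').
have : val_ge b.+1 (phi (up (a, Posz b)) - phi (up (a', Posz b'))).
  have -> : phi (up (a, Posz b)) - phi (up (a', Posz b')) =
      (tx E (a', Posz b') - phi (up (a', Posz b')))
      - (tx E (a, Posz b) - phi (up (a, Posz b))) by rewrite Ex; ring.
  by apply: val_geB; [apply: val_ge_le (tx_lead _ lb') | apply: tx_lead].
rewrite EF EG -toWB => /val_ge_toW /(_ b (ltnSn b)) /eqP; rewrite psB subr_eq0 Fb.
have := phi_val k2 gam0 a' (Posz b'); rewrite EG absz_nat => /val_ge_toW HG.
case: (ltngtP b b') le => // [lt _|Eb _].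
  by rewrite HG // (negPf Fn0).
rewrite -Eb in nb' Gb Gn0 *; rewrite Gb => /eqP.
case: b {lb lb' Fb EF Gb Ex HG Eb EG n1} nb nb' Fn0 Gn0 => [|b] nb nb' Fn0 Gn0 /= Elead.
  move: Fn0 Gn0 Elead; rewrite /lead_phi; set c := gam ^ a; set c' := gam ^ a'.
  have c0 : c != 0 by apply: expfz_neq0.
  have c0' : c' != 0 by apply: expfz_neq0.
  rewrite /phi !mulf_eq0 !negb_or !invr_eq0 => /andP[_ d0] /andP[_ d0'] Ec.
  have : (c + c') * (1 + c * c') = 0.
    have : c * (1 + c') ^+ 2 = c' * (1 + c) ^+ 2.
      by move/(congr1 (fun z => z * (1 + c) ^+ 2 * (1 + c') ^+ 2)): Ec;
        rewrite mulfVK // mulrAC mulfVK.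
    move/eqP; rewrite -(char2_add_eq0 k2) => /eqP <-.
    by apply: (char2_eq k2 (w := - (2 * c * c'))); ring.
  move/eqP; rewrite mulf_eq0 !(char2_add_eq0 k2) => /orP[/eqP E1|/eqP E1].
    by exists 0; left; rewrite qpt_eta mulr0 addr0 !up_pos -/c -/c' E1.
  exists 0; right; rewrite (_ : qpt E 0 = 0) ?addr0; last by rewrite /qpt mulr0.
  have nz : up (a', Posz 0) != 0 by exact: up_neq0.
  rewrite (upN gam0); apply: (mulIf nz); rewrite (mulVf nz) !up_pos -toWM psmonM.
  by rewrite -/c -/c' -E1 psmon10 toW1.
by exists 0; left; rewrite qpt_eta mulr0 addr0 !up_pos Elead.
Qed.

End Injectivity.

(** * Torsion points of the Tate curve *)

Section TorsionPoints.

Variable k : fieldType.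
Hypothesis k2 : 2%N \in [pchar k].
Variables (gam : k) (e : nat).
Hypothesis prim : e.-primitive_root gam.
Hypothesis odd_e : odd e.

Local Notation W := (laurent k).
Local Notation up := (up gam).
Local Notation tx := (tx gam e).
Local Notation tz := (tz gam e).
Local Notation nontriv := (nontriv gam e).
Let W2 := W2 k2.

Let e0 : (0 < e)%N. Proof. exact: prim_order_gt0 prim. Qed.

Lemma prim_neq0 : gam != 0.
Proof.
apply/eqP => g0; have := prim_expr_order prim.
by rewrite g0 expr0n; case: (e) e0 => //= n _ /eqP; rewrite eq_sym oner_eq0.
Qed.
Let gam0 := prim_neq0.

(** As gam has order e, these are the pairs whose parameter is a power of q = t ^ e. *)
Definition origin (Q : int * int) : bool := (Posz e %| Q.1)%Z && (Posz e %| Q.2)%Z.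

Lemma originQ Q : origin Q = (Posz e %| Q.1)%Z && (Posz e %| Q.2)%Z.
Proof. by []. Qed.

Lemma gam_expz a : (gam ^ a == 1) = (Posz e %| a)%Z.
Proof.
case: a => n; first by rewrite -exprnP -(prim_order_dvd prim).
by rewrite NegzE rpredN -exprnN invr_eq1 -(prim_order_dvd prim).
Qed.

Lemma origin0 : origin 0. Proof. by rewrite /origin !dvdz0. Qed.

Lemma originD P Q : origin P -> origin (P + Q) = origin Q.
Proof. by case/andP=> H1 H2; rewrite /origin /= !rpredDl. Qed.

Lemma originN Q : origin (- Q) = origin Q.
Proof. by rewrite /origin /= !rpredN. Qed.

Lemma origin_double Q : origin (Q *+ 2) = origin Q.
Proof.
have H a : (Posz e %| a *+ 2)%Z = (Posz e %| a)%Z.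
  rewrite -mulr_natl Gauss_dvdzr // -[(2%:R : int)]/(Posz 2).
  by rewrite coprimezE /= coprimen2.
by rewrite /origin pairMnE /= !H.
Qed.

Lemma up_eq1_origin Q n : up (Q + qpt e n) = 1 -> origin Q.
Proof.
rewrite qpt_eta => /(up_eq1 gam0)[/eqP H1 H2].
by rewrite /origin -gam_expz H1 -(rpredDr _ (dvdz_mulr n (dvdzz (Posz e)))) H2 dvdz0.
Qed.

Lemma nontriv_origin Q : ~~ origin Q -> nontriv Q.
Proof. by move=> H n; apply: contra H => /eqP/up_eq1_origin. Qed.

Lemma origin_up Q : origin Q -> exists n, forall P, up (P + Q) = up (P + qpt e n).
Proof.
case: Q => a b /andP[/= Ha /dvdzP[n Eb]]; exists n => P.
rewrite !(upD gam0); congr (_ * _); move: Ha; rewrite -gam_expz !upE /qpt /= => /eqP->.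
by rewrite expr0z Eb [n * _]mulrC.
Qed.

Lemma tx_origin P Q : origin Q -> tx (P + Q) = tx P.
Proof.
move=> /origin_up[n H]; rewrite -(tx_period k2 gam0 P n e0).
by apply: eq_blim => j; rewrite /xterm addrAC H addrAC.
Qed.

Lemma same_x_origin Q Q' : same_x gam e Q Q' -> origin (Q' - Q) || origin (Q' + Q).
Proof.
case=> n [] E; apply/orP; [left|right]; apply: (@up_eq1_origin _ (- n)).
  rewrite qptN addrAC (upD gam0) !(upN gam0) (upD gam0) E (upN gam0) (upD gam0).
  by rewrite mulfK ?mulfV //; apply: up_neq0.
by rewrite qptN addrAC !(upD gam0) E !(upD gam0) !(upN gam0) mulfK ?mulVf ?up_neq0.
Qed.

Lemma tx_eq_origin Q Q' : ~~ origin Q -> ~~ origin Q' -> tx Q = tx Q' ->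
  origin (Q' - Q) || origin (Q' + Q).
Proof.
move=> HQ HQ' E; apply: same_x_origin.
by apply: tx_inj => //; apply: nontriv_origin.
Qed.

(** Replacing Q by Q + (0, e) adds 1 to tz, and changes the parity of Q.2 since e is
    odd: unlike tz, this Artin-Schreier root of tx only depends on the point. *)
Definition zz (Q : int * int) : W := tz Q + (odd `|Q.2|%N)%:R.

Lemma odd_abszD (a b : int) : odd `|(a + b)%R|%N = odd `|a|%N (+) odd `|b|%N.
Proof. lia. Qed.

Lemma zz_origin P Q : origin Q -> zz (P + Q) = zz P.
Proof.
move=> OQ; have [n Hn] := origin_up OQ; case/andP: (OQ) => _ /dvdzP[m Em].
have EQ2 : Q.2 = Posz e * n.
  have := Hn 0; rewrite !add0r => Eup.
  have : up (Q - qpt e n) = 1.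
    by rewrite (upD gam0) (upN gam0) Eup mulfV // up_neq0.
  by case: Q {OQ Hn Em Eup} => a b /(up_eq1 gam0)[_ /eqP]; rewrite subr_eq0 => /eqP.
have tzn j S : tz (S + qpt e (Posz j)) = tz S + (odd j)%:R.
  elim: j => [|j IH]; first by rewrite /qpt mulr0 !addr0.
  have -> : Posz j.+1 = Posz j + 1 by lia.
  rewrite qptD addrA (tz_period k2 gam0) // IH -addrA; congr (_ + _).
  by rewrite /=; case: odd; rewrite /= ?add0r // (addrr_pchar2 W2).
have tzz S : tz (S + qpt e n) = tz S + (odd `|n|%N)%:R.
  case: (n) => j; first exact: tzn.
  have := tzn j.+1 (S + qpt e (Negz j)); rewrite -addrA -qptD.
  have -> : Negz j + Posz j.+1 = 0 by lia.
  rewrite /qpt mulr0 addr0 => ->; rewrite -addrA -[odd `|Negz j|%N]/(odd j.+1).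
  by case: (odd j.+1); rewrite /= ?addr0 // (addrr_pchar2 W2) addr0.
have -> : zz (P + Q) = tz (P + qpt e n) + (odd `|(P + Q).2|)%:R.
  by congr (_ + _); apply: eq_blim => j; rewrite /zterm addrAC Hn addrAC.
rewrite tzz /zz -addrA; congr (_ + _); rewrite /= odd_abszD EQ2 abszM oddM odd_e /=.
by case: (odd _); case: (odd _); rewrite /= ?addr0 ?add0r // (addrr_pchar2 W2).
Qed.

Lemma zzN Q : ~~ origin Q -> zz (- Q) = zz Q + 1.
Proof.
move/nontriv_origin => HQ; rewrite /zz (tzN k2 gam0) // addrAC; congr (_ + _ + _).
by rewrite /= abszN.
Qed.

Lemma tx_zz Q : tx Q = zz Q ^+ 2 + zz Q.
Proof.
rewrite (tx_tz k2 gam0) // /zz; case: odd; rewrite ?addr0 //=.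
by apply: (char2_eq W2 (w := - tz Q - 1)); ring.
Qed.

(** The abscissa determines the point up to sign, and zz the sign. *)
Lemma zz_inj Q Q' : ~~ origin Q -> ~~ origin Q' -> zz Q = zz Q' -> origin (Q' - Q).
Proof.
move=> HQ HQ' E; have : tx Q = tx Q' by rewrite !tx_zz E.
case/(tx_eq_origin HQ HQ')/orP => // O.
have : zz (- Q) = zz Q'.
  by rewrite -[in RHS](addKr Q Q') [Q + Q']addrC zz_origin.
rewrite zzN // -E => /eqP; rewrite -subr_eq0 addrAC subrr add0r.
by rewrite oner_eq0.
Qed.

End TorsionPoints.

(** * Multiples of a torsion point *)

Lemma Delta1 : DeltaS 1 = 1.
Proof. by rewrite /DeltaS /Delta !big_ord_recl big_ord0 /= !addr0. Qed.

(** The abscissas of the multiples n + 1 and n + 2 of a point of abscissa x, on the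
    curve of discriminant D. *)
Fixpoint multx (F : fieldType) (x D : F) (n : nat) : F * F :=
  if n is m.+1 then
    let s := multx x D m in (s.2, s.1 + x * s.2 / (x + s.2) ^+ 2)
  else (x, x ^+ 2 + D / x ^+ 2).

(** The indicator of x != 0 as a field expression, with the convention 0^-1 = 0: it
    remains a rational function of the point when x is one. *)
Definition nz (F : fieldType) (x : F) : F := x * x^-1.

Lemma nzE (F : fieldType) (x : F) : nz x = (x != 0)%:R.
Proof. by rewrite /nz; case: eqVneq => [->|n0]; rewrite ?mul0r // divff. Qed.

(** The indicator of the points of order p = 2 h + 1, p prime: h is the first i > 0
    such that the multiples i and i + 1 have the same abscissa. *)
Definition tors_ind (F : fieldType) (h : nat) (x D : F) : F :=
  (\prod_(i < h.-1) nz ((multx x D i).1 + (multx x D i).2)) *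
  (1 + nz ((multx x D h.-1).1 + (multx x D h.-1).2)).

Section Multiples.

Variable k : fieldType.
Hypothesis k2 : 2%N \in [pchar k].
Variables (gam : k) (e : nat).
Hypothesis prim : e.-primitive_root gam.
Hypothesis odd_e : odd e.

Local Notation tx := (tx gam e).
Local Notation D := (tdisc gam e).
Local Notation origin := (origin e).
Let W2 := W2 k2.
Let e0 : (0 < e)%N. Proof. exact: prim_order_gt0 prim. Qed.
Let gam0 := prim_neq0 prim.

Lemma tdisc_neq0 : D != 0.
Proof.
rewrite (tdiscE k2 gam0) // toW_eq0; apply/eqP => /(congr1 (fun f : pseries k => f (e * 1)%N)).
rewrite psubE // Delta1 expr1n ps0 mul1r /f2k /= => /eqP.
by rewrite oner_eq0.
Qed.

Lemma tx_neq0 Q : ~~ origin Q -> tx Q != 0.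
Proof.
move=> HQ; have := tdisc_neq0.
rewrite -(tx_double k2 gam0 e0 (nontriv_origin prim HQ)); last first.
  by apply: (nontriv_origin prim); rewrite origin_double.
by apply: contraNneq => ->; rewrite !expr0n mul0r addr0.
Qed.

Lemma tx_double_eq Q : ~~ origin Q -> tx (Q *+ 2) = tx Q ^+ 2 + D / tx Q ^+ 2.
Proof.
move=> HQ; have x0 := tx_neq0 HQ.
rewrite -(tx_double k2 gam0 e0 (nontriv_origin prim HQ)); last first.
  by apply: (nontriv_origin prim); rewrite origin_double.
move: (tx Q) (tx (Q *+ 2)) x0 => x y x0.
apply: (char2_eq W2 (w := - x ^+ 2)); field; exact: x0.
Qed.

Lemma multx_tx Q n : (forall j, (0 < j <= n.+2)%N -> ~~ origin (Q *+ j)) ->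
  multx (tx Q) D n = (tx (Q *+ n.+1), tx (Q *+ n.+2)).
Proof.
elim: n => [|n IH] H; first by rewrite /= tx_double_eq //; apply: (H 1%N).
have {}IH := IH _; rewrite /= IH; last first.
  by move=> j /andP[j0 le]; apply: H; rewrite j0 ltnW.
congr pair => /=.
have Hn j : (0 < j <= n.+3)%N -> nontriv gam e (Q *+ j).
  by move=> /H; apply: nontriv_origin.
have Em : Q *+ n.+2 - Q = Q *+ n.+1 by rewrite mulrSr addrK.
have Ep : Q *+ n.+2 + Q = Q *+ n.+3 by rewrite -mulrSr.
have O1 := H 1%N isT; have On := H n.+2 (leqnSn _).
rewrite -Ep -Em (tx_addsub k2 gam0 e0 (Hn 1%N isT) (Hn n.+2 (leqnSn _))) ?Em ?Ep //.
- by apply: Hn; lia.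
- by apply: Hn; lia.
- apply/eqP => /(tx_eq_origin k2 prim odd_e O1 On) /orP[].
    by rewrite Em; apply/negP/H; lia.
  by rewrite Ep; apply/negP/H; lia.
- apply/eqP => E; have O1' : ~~ origin (Q *+ n.+1) by apply: H; lia.
  have O3' : ~~ origin (Q *+ n.+3) by apply: H; lia.
  have := tx_eq_origin k2 prim odd_e O3' O1' E.
  have E1 : Q *+ n.+1 - Q *+ n.+3 = - (Q *+ 2).
    have -> : (n.+3 = n.+1 + 2)%N by rewrite addn2.
    by rewrite mulrnDr opprD addrA subrr add0r.
  have E2 : Q *+ n.+1 + Q *+ n.+3 = (Q *+ n.+2) *+ 2.
    by rewrite -mulrnDr -mulrnA; congr (_ *+ _); lia.
  by rewrite E1 E2 originN !origin_double // -[Q in origin Q](mulr1n Q) (negPf O1) (negPf On).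
Qed.

Lemma origin_mul Q n : origin Q -> origin (Q *+ n).
Proof.
by move=> O; elim: n => [|n IH]; rewrite ?mulr0n ?origin0 // mulrS originD.
Qed.

Lemma origin_coprime Q a b : coprime a b -> origin (Q *+ a) -> origin (Q *+ b) ->
  origin Q.
Proof.
case: a => [|a]; first by rewrite /coprime gcd0n => /eqP-> _; rewrite mulr1n.
move=> cop Oa Ob; have [u v Euv _] := egcdnP b (isT : (0 < a.+1)%N).
move: cop; rewrite /coprime => /eqP cop; rewrite cop in Euv.
have : origin (Q *+ (u * a.+1)) by rewrite mulnC mulrnA origin_mul.
by rewrite Euv mulrnDr originD ?mulr1n // mulnC mulrnA origin_mul.
Qed.

(** The multiples i and i + 1 of Q have the same abscissa exactly when 2 i + 1 kills Q.
    With d the order of Q, which is odd, this first happens for i = (d - 1) / 2; before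
    that multx computes the abscissas of the multiples of Q. If d < p, one factor of the
    product vanishes; if d > p, the last factor does. *)
Lemma tors_indE Q h : (0 < h)%N -> prime h.*2.+1 -> ~~ origin Q ->
  tors_ind h (tx Q) D = (origin (Q *+ h.*2.+1))%:R.
Proof.
set p := h.*2.+1 => h0 pp OQ.
have pair_eq a b : ~~ origin (Q *+ a) -> ~~ origin (Q *+ b) ->
    nz (tx (Q *+ a) + tx (Q *+ b)) = (tx (Q *+ a) != tx (Q *+ b))%:R.
  by move=> _ _; rewrite nzE (char2_add_eq0 W2).
have tx_consec i : ~~ origin (Q *+ i.+1) -> ~~ origin (Q *+ i.+2) ->
    (tx (Q *+ i.+1) == tx (Q *+ i.+2)) = origin (Q *+ (i.*2).+3).
  move=> O1 O2; apply/eqP/idP => [E|O].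
    have := tx_eq_origin k2 prim odd_e O1 O2 E.
    rewrite [Q *+ i.+2 - _](_ : _ = Q); last by rewrite mulrSr addrAC subrr add0r.
    rewrite (negPf OQ) /= -mulrnDr; congr (origin (_ *+ _)); lia.
  have -> : Q *+ i.+2 = - (Q *+ i.+1) + Q *+ i.*2.+3.
    rewrite (_ : i.*2.+3 = i.+1 + i.+2)%N; last by lia.
    by rewrite mulrnDr addKr.
  by rewrite (tx_origin k2 prim) // (txN k2 gam0).
have [d dP dmin] : exists2 d, (0 < d)%N && origin (Q *+ d) &
    forall j, (0 < j)%N && origin (Q *+ j) -> (d <= j)%N.
  have ex : exists d, (0 < d)%N && origin (Q *+ d).
    have H (a : int) : (Posz e %| a *+ e)%Z by rewrite -mulr_natr natz dvdz_mull.
    by exists e; apply/andP; split; [exact: e0 | rewrite /origin pairMnE /= !H].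
  by case: (ex_minnP ex) => d Hd Hmin; exists d.
have not_O j : (0 < j < d)%N -> ~~ origin (Q *+ j).
  by case/andP=> j0 lt; apply: contraL lt => O; rewrite -leqNgt dmin ?j0 ?O.
case/andP: dP => d0 Od.
have d1 : (1 < d)%N.
  by rewrite ltn_neqAle d0 andbT; apply: contraTneq Od => <-; rewrite mulr1n.
have odd_d : odd d.
  apply/negPn/negP => ev; have Ed : d = (d./2 * 2)%N by lia.
  have : origin (Q *+ d./2) by rewrite -origin_double // -mulrnA -Ed.
  by apply/negP/not_O; lia.
have Ed : d = (d./2).*2.+1 by lia.
have [Op|nOp] := boolP (origin (Q *+ p)).
  have Edp : d = p.
    have le : (d <= p)%N by apply: dmin; rewrite Op.
    apply/eqP; rewrite eqn_leq le /= leqNgt; apply/negP => lt.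
    have cop : coprime d p.
      by rewrite coprime_sym prime_coprime // gtnNdvd.
    by move: OQ; rewrite (origin_coprime cop Od Op).
  have not_O' j : (0 < j < p)%N -> ~~ origin (Q *+ j) by rewrite -Edp; apply: not_O.
  rewrite /tors_ind big1 => [|i _]; last first.
    have lt := ltn_ord i.
    rewrite multx_tx /= ?nzE ?(char2_add_eq0 W2) ?tx_consec.
    - rewrite not_O' //; rewrite /p; lia.
    - by apply: not_O'; rewrite /p; lia.
    - by apply: not_O'; rewrite /p; lia.
    - by move=> j le; apply: not_O'; rewrite /p; lia.
  rewrite mul1r multx_tx /= ?nzE ?(char2_add_eq0 W2) ?tx_consec.
  - by rewrite (_ : (h.-1).*2.+3 = p) ?Op ?addr0 // /p; lia.
  - by apply: not_O'; rewrite /p; lia.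
  - by apply: not_O'; rewrite /p; lia.
  - by move=> j le; apply: not_O'; rewrite /p; lia.
have [lt|ge] := ltnP d p.
  have l1 : (d./2.-1 < h.-1)%N by move: lt; rewrite /p; lia.
  rewrite /tors_ind (bigD1 (Ordinal l1)) //= multx_tx /= ?nzE ?(char2_add_eq0 W2) ?tx_consec.
  - by rewrite (_ : (d./2.-1).*2.+3 = d) ?Od ?mul0r //; lia.
  - by apply: not_O; lia.
  - by apply: not_O; lia.
  - by move=> j le; apply: not_O; lia.
have ne : d != p by apply: contraNneq nOp => <-.
rewrite /tors_ind multx_tx /= ?nzE ?(char2_add_eq0 W2) ?tx_consec.
- rewrite (_ : (h.-1).*2.+3 = p) ?(negPf nOp) ?(addrr_pchar2 W2) ?mulr0 // /p; lia.
- by apply: not_O; rewrite /p in ge; lia.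
- by apply: not_O; rewrite /p in ge; lia.
- by move=> j le; apply: not_O; rewrite /p in ge; lia.
Qed.

End Multiples.

(** * Symmetric sums over the roots of a polynomial *)

Section RootSums.

Variables (F : fieldType) (I : finType) (z : I -> F).
Hypothesis z_inj : injective z.
Let g : {poly F} := \prod_i ('X - (z i)%:P).

Let others i : {poly F} := \prod_(j | j != i) ('X - (z j)%:P).

Let gE i : g = ('X - (z i)%:P) * others i.
Proof. by rewrite /g (bigD1 i). Qed.

Let size_g : size g = #|I|.+1.
Proof. by rewrite size_prod_XsubC -[index_enum I]enumT cardE. Qed.

Let size_others i : size (others i) = #|I|.
Proof.
have := size_g; rewrite (gE i) size_mul ?polyXsubC_eq0 ?size_XsubC //.
  by rewrite add2n /= => -[].
exact/monic_neq0/monic_prod_XsubC.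
Qed.

Let others_eq i j : j != i -> (others i).[z j] = 0.
Proof.
move=> ne; rewrite horner_prod (bigD1 j) //= hornerXsubC subrr mul0r //.
Qed.

Let others_neq i : (others i).[z i] != 0.
Proof.
rewrite horner_prod; apply/prodf_neq0 => j ne.
by rewrite hornerXsubC subr_eq0; apply: contra ne => /eqP/z_inj->.
Qed.

Let deriv_g i : g^`().[z i] = (others i).[z i].
Proof.
by rewrite (gE i) derivM derivXsubC mul1r hornerD hornerM hornerXsubC subrr mul0r addr0.
Qed.

Let root_g i : root g (z i).
Proof. by rewrite (gE i) rootM root_XsubC eqxx. Qed.

Lemma root_simple i (p q : {poly F}) : g = p * q -> root p (z i) -> ~~ root q (z i).
Proof.
move=> Eg /rootP p0; have := others_neq i; rewrite -deriv_g Eg derivM hornerD.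
by rewrite !hornerM p0 mul0r addr0 mulf_eq0 negb_or => /andP[].
Qed.

Lemma root_dvd_g (p : {poly F}) : p %| g -> size p != 1%N -> exists i, root p (z i).
Proof.
move=> /dvdp_prod_XsubC[m Em] ne; rewrite (eqp_size Em) in ne.
case E : (mask m (index_enum I)) => [|i s].
  by rewrite E big_nil size_poly1 in ne.
by exists i; rewrite (eqp_root Em) E big_cons rootM root_XsubC eqxx.
Qed.

(** By Lagrange interpolation, the remainder of h g' modulo g is the sum of the
    polynomials h (z i) prod_(j != i) (X - z j), which are of degree #|I| - 1. *)
Lemma sum_roots (h : {poly F}) :
  \sum_i h.[z i] = ((h * g^`()) %% g)`_(#|I|.-1).
Proof.
set r := _ %% g.
have -> : r = \sum_i h.[z i] *: others i.
  apply/eqP; rewrite -subr_eq0; apply/eqP.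
  apply: (@roots_geq_poly_eq0 _ _ [seq z i | i <- enum I]).
  - apply/allP => _ /mapP[i _ ->]; rewrite /root hornerD hornerN horner_sum.
    rewrite horner_mod // hornerM deriv_g (bigD1 i) //= hornerZ.
    rewrite [X in _ - (_ + X)]big1 ?addr0 ?subrr // => j ne.
    by rewrite hornerZ others_eq ?mulr0 // eq_sym.
  - by rewrite map_inj_uniq ?enum_uniq.
  - rewrite size_map -cardE; apply: leq_trans (size_polyD _ _) _.
    rewrite geq_max size_polyN; apply/andP; split.
      by rewrite -ltnS -size_g ltn_modp -size_poly_eq0 size_g.
    apply: leq_trans (size_sum _ _ _) _; apply/bigmax_leqP => i _.
    by rewrite -(size_others i) size_scale_leq.
rewrite coef_sum; apply: eq_bigr => i _; rewrite coefZ.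
have -> : (others i)`_(#|I|.-1) = 1; last by rewrite mulr1.
have /monicP := monic_prod_XsubC (index_enum I) (fun j => j != i) z.
by rewrite lead_coefE -/(others i) size_others.
Qed.

End RootSums.

Section RationalFunctions.

Variables (K F : fieldType) (iota : {rmorphism K -> F}).
Variables (I : finType) (z : I -> F) (g : {poly K}).
Hypothesis z_inj : injective z.
Hypothesis gE : map_poly iota g = \prod_i ('X - (z i)%:P).

Local Notation "p ^i" := (map_poly iota p) (at level 2, format "p ^i").

(** Polynomials suffice to express all the rational functions on the roots, by
    rationalV. *)
Definition rational (f : I -> F) : Prop := exists h : {poly K}, forall i, f i = h^i.[z i].

Lemma rational_eq f f' : f =1 f' -> rational f -> rational f'.
Proof. by move=> E [h H]; exists h => i; rewrite -E. Qed.

Lemma rational_cst c : rational (fun _ => iota c).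
Proof. by exists c%:P => i; rewrite map_polyC hornerC. Qed.

Lemma rational_z : rational z.
Proof. by exists 'X => i; rewrite map_polyX hornerX. Qed.

Lemma rationalD f f' : rational f -> rational f' -> rational (fun i => f i + f' i).
Proof.
by case=> h H [h' H']; exists (h + h') => i; rewrite rmorphD hornerD H H'.
Qed.

Lemma rationalM f f' : rational f -> rational f' -> rational (fun i => f i * f' i).
Proof.
by case=> h H [h' H']; exists (h * h') => i; rewrite rmorphM hornerM H H'.
Qed.

Lemma rationalX f n : rational f -> rational (fun i => f i ^+ n).
Proof.
move=> Hf; elim: n => [|n IH].
  by apply: rational_eq (rational_cst 1) => i; rewrite rmorph1 expr0.
by apply: rational_eq (rationalM Hf IH) => i; rewrite exprS.
Qed.

Lemma rational_sumf J (r : seq J) (P : pred J) (f : J -> I -> F) :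
  (forall j, P j -> rational (f j)) -> rational (fun i => \sum_(j <- r | P j) f j i).
Proof.
move=> H; elim: r => [|j r IH].
  by apply: rational_eq (rational_cst 0) => i; rewrite big_nil rmorph0.
case Pj : (P j); last by apply: rational_eq IH => i; rewrite big_cons Pj.
by apply: rational_eq (rationalD (H j Pj) IH) => i; rewrite big_cons Pj.
Qed.

(** With the convention 0^-1 = 0, pointwise inversion preserves rational functions:
    h is invertible modulo the cofactor of gcd (h, g) in g. *)
Lemma rationalV f : rational f -> rational (fun i => (f i)^-1).
Proof.
case=> h H; pose d := gcdp h g; pose g1 := g %/ d.
have Eg : g = g1 * d by rewrite divpK // dvdp_gcdr.
have Eg' : \prod_i ('X - (z i)%:P) = d^i * g1^i by rewrite -gE {1}Eg rmorphM mulrC.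
have rootd i : root d^i (z i) = (f i == 0).
  rewrite /d gcdp_map root_gcd gE (bigD1 i) //= rootM root_XsubC eqxx andbT.
  by rewrite H.
have cop : coprimep h g1.
  rewrite -(coprimep_map iota) /coprimep; apply: contraT => ne.
  have dv : gcdp h^i g1^i %| \prod_i ('X - (z i)%:P).
    by rewrite Eg'; apply: dvdp_mull; apply: dvdp_gcdr.
  have [i] := root_dvd_g dv ne; rewrite root_gcd => /andP[rh rg1].
  suff /(root_simple z_inj Eg') : root d^i (z i) by rewrite rg1.
  by rewrite rootd H; apply: rh.
have [[a b] /= Eab] := Bezout_eq1_coprimepP _ _ cop.
exists (a ^+ 2 * h) => i; rewrite rmorphM rmorphXn hornerM horner_exp -H.
have [->|fi0] := eqVneq (f i) 0; first by rewrite invr0 mulr0.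
have rg1 : root g1^i (z i).
  have : root (\prod_i ('X - (z i)%:P)) (z i).
    by rewrite (bigD1 i) //= rootM root_XsubC eqxx.
  by rewrite Eg' rootM rootd (negPf fi0).
have : (a * h + b * g1)^i.[z i] = 1 by rewrite Eab rmorph1 hornerC.
rewrite rmorphD !rmorphM hornerD !hornerM (rootP rg1) mulr0 addr0 -H => E1.
by apply: (mulIf fi0); rewrite mulVf // expr2 -!mulrA [_ * (f i * _)]mulrA E1 mul1r E1.
Qed.

(** The sum of the values at the roots of g is symmetric, hence it lies in K. *)
Lemma rational_sum f : rational f -> exists c, \sum_i f i = iota c.
Proof.
case=> h H; exists ((h * g^`()) %% g)`_(#|I|.-1).
under eq_bigr do rewrite H.
by rewrite sum_roots // -gE deriv_map -rmorphM -map_modp coef_map.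
Qed.

End RationalFunctions.

(** * Polynomials inside a field of fractions *)

Local Notation "x %:F" := (tofrac x).

(** The unlocked definition of tofrac exposes the quotient that represents c. *)
Lemma repr_frac (R : idomainType) (c : {fraction R}) :
  c = (\n_(repr c))%:F / (\d_(repr c))%:F.
Proof.
have d0 : (\d_(repr c))%:F != 0 by rewrite tofrac_eq0 denom_ratioP.
apply: (mulIf d0); rewrite mulfVK //.
unlock tofrac; rewrite -{1}[c]reprK -[LHS]FracField.pi_mul; apply/eqmodP => /=.
rewrite FracField.equivfE /FracField.mulf.
rewrite !numden_Ratio ?mulr1 ?oner_eq0 ?denom_ratioP //.
by rewrite mulrC.
Qed.

Lemma frac_numden (R : idomainType) (c : {fraction R}) :
  exists a b : R, b != 0 /\ c = a%:F / b%:F.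
Proof.
exists \n_(repr c), \d_(repr c); split; first exact: denom_ratioP.
exact: repr_frac.
Qed.

Lemma frac_lift (R : idomainType) (F : fieldType) (f : {rmorphism R -> F}) :
  injective f -> exists i : {rmorphism {fraction R} -> F}, forall r, i r%:F = f r.
Proof.
move=> f_inj; have f_neq0 r : r != 0 -> f r != 0.
  by move=> r0; rewrite -(rmorph0 f) (inj_eq f_inj).
pose i (c : {fraction R}) : F := f \n_(repr c) / f \d_(repr c).
have iE a b : b != 0 -> i (a%:F / b%:F) = f a / f b.
  move=> b0; rewrite /i; set c := a%:F / b%:F; set n := \n_(_); set d := \d_(_).
  have d0 : d != 0 by apply: denom_ratioP.
  have Ec : c = n%:F / d%:F by apply: repr_frac.
  apply/eqP; rewrite eqr_div ?f_neq0 // -!rmorphM (inj_eq f_inj) -tofrac_eq !tofracM.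
  by rewrite -eqr_div ?tofrac_eq0 // -Ec.
have i_add : zmod_morphism i.
  move=> x y; have [a [b [b0 ->]]] := frac_numden x; have [c [d [d0 ->]]] := frac_numden y.
  have b0' : b%:F != 0 by rewrite tofrac_eq0.
  have d0' : d%:F != 0 by rewrite tofrac_eq0.
  rewrite -mulNr addf_div // -tofracN -!tofracM -tofracD !iE ?mulf_neq0 //.
  by rewrite rmorphD !rmorphM rmorphN -mulNr addf_div ?f_neq0.
have i_mul : monoid_morphism i.
  split=> [|x y]; first by rewrite -[1]divr1 -tofrac1 iE ?oner_neq0 // rmorph1 divr1.
  have [a [b [b0 ->]]] := frac_numden x; have [c [d [d0 ->]]] := frac_numden y.
  rewrite mulf_div -!tofracM !iE ?mulf_neq0 // !rmorphM mulf_div //.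
pose i' : {rmorphism {fraction R} -> F} := HB.pack i
  (GRing.isZmodMorphism.Build _ _ i i_add) (GRing.isMonoidMorphism.Build _ _ i i_mul).
exists i' => r; rewrite -[r%:F]divr1 -tofrac1 [LHS]iE ?oner_neq0 //.
by rewrite rmorph1 divr1.
Qed.

Lemma expf_subn (F : fieldType) (x : F) i n : x != 0 -> (i <= n)%N ->
  x ^+ (n - i) = x ^- i * x ^+ n.
Proof.
by move=> x0 le; rewrite -{2}(subnKC le) exprD mulKf // expf_neq0.
Qed.

(** Polynomials over a field are integrally closed: in a reduced fraction a / b that
    is integral, b divides a power of a. *)
Lemma frac_integral (F : fieldType) (c : {fraction {poly F}}) :
  integralOver (@tofrac _) c -> exists a : {poly F}, c = a%:F.
Proof.
case=> p p_monic /rootP pc.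
have [a0 [b0 [b0n Ec0]]] := frac_numden c.
pose d := gcdp a0 b0; have dn : d != 0 by rewrite gcdp_eq0 (negPf b0n) andbF.
pose a := a0 %/ d; pose b := b0 %/ d.
have Ea : a0 = a * d by rewrite divpK // dvdp_gcdl.
have Eb : b0 = b * d by rewrite divpK // dvdp_gcdr.
have bn : b != 0 by apply: contraNneq b0n => b0E; rewrite Eb b0E mul0r.
have bF : b%:F != 0 by rewrite tofrac_eq0.
have dF : d%:F != 0 by rewrite tofrac_eq0.
have Ec : c = a%:F / b%:F.
  by rewrite Ec0 Ea Eb !tofracM invfM mulrACA mulfV // mulr1.
have cop : coprimep b a by rewrite coprimep_sym coprimep_div_gcd // b0n orbT.
pose n := (size p).-1; have Sp : size p = n.+1.
  by rewrite /n prednK // lt0n size_poly_eq0 monic_neq0.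
have Es : \sum_(i < n.+1) p`_i * a ^+ i * b ^+ (n - i) = 0.
  apply/eqP; rewrite -tofrac_eq0 rmorph_sum; apply/eqP.
  move: pc; rewrite horner_coef size_map_poly_id0; last first.
    by rewrite tofrac_eq0 lead_coef_eq0 monic_neq0.
  rewrite Sp => E; have := congr1 (fun y => y * b%:F ^+ n) E.
  rewrite /= mul0r mulr_suml; apply: etrans; apply: eq_bigr => i _.
  rewrite coef_map !tofracM !tofracXn Ec expr_div_n -!mulrA.
  by have le : (i <= n)%N by [rewrite -ltnS]; rewrite (expf_subn bF le).
have bd : b %| a ^+ n.
  move: Es; rewrite big_ord_recr /= subnn mulr1.
  have -> : p`_n = 1 by move/monicP: p_monic; rewrite lead_coefE.
  rewrite mul1r addrC => /eqP; rewrite addr_eq0 => /eqP ->.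
  rewrite dvdpNr; apply: (big_ind (fun x => b %| x)) => [|x y|i _].
  - exact: dvdp0.
  - exact: dvdp_add.
  - apply: dvdp_mull; have -> : (n - i = (n - i).-1.+1)%N by move: (ltn_ord i); lia.
    by rewrite exprS dvdp_mulIl.
have : size b == 1%N.
  by have := coprimep_expr n cop; rewrite /coprimep (eqp_size (dvdp_gcd_idl bd)).
move/size_poly1P=> [u u0 Eu].
exists (u^-1 *: a); rewrite Ec Eu.
apply: (mulIf (_ : u%:P%:F != 0)); first by rewrite tofrac_eq0 polyC_eq0.
rewrite mulfVK ?tofrac_eq0 ?polyC_eq0 // -tofracM -[_ * u%:P]mulrC mul_polyC scalerA.
by rewrite mulfV // scale1r.
Qed.

(** * Polynomials in Delta *)

Lemma qexpE (f : pseries 'F_2) n : qexp f n = f ^+ n.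
Proof. by elim: n => [|n IH] //=; rewrite exprS -IH. Qed.

(** Evaluation at Delta, packaged as a morphism of rings. *)
Lemma evS_exists : {ev : {rmorphism {poly 'F_2} -> pseries 'F_2} |
  forall P, ev P = poly_Delta P}.
Proof.
pose c (a : 'F_2) : pseries 'F_2 := psmon a 0.
have c_add : zmod_morphism c.
  by move=> a b; apply: funext => n; rewrite psB /c /psmon mulrnBl.
have c_mul : monoid_morphism c by split=> [|a b]; rewrite // /c psmonM.
pose c' : {rmorphism 'F_2 -> pseries 'F_2} := HB.pack c
  (GRing.isZmodMorphism.Build _ _ c c_add) (GRing.isMonoidMorphism.Build _ _ c c_mul).
have com : commr_rmorph c' DeltaS by move=> x; apply: mulrC.
exists (horner_morph com) => P.
rewrite -[LHS]/((map_poly c' P).[DeltaS]); apply: funext => n.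
rewrite horner_coef /poly_Delta size_map_poly ps_sum.
by apply: eq_bigr => i _; rewrite coef_map /= psmonE subn0 -qexpE.
Qed.

Definition evS : {rmorphism {poly 'F_2} -> pseries 'F_2} := sval evS_exists.

Lemma evSE P : evS P = poly_Delta P.
Proof. exact: svalP evS_exists P. Qed.

Lemma qexp_Delta0 i : qexp Delta i 0 = (i == 0%N)%:R.
Proof.
case: i => [|i] //; rewrite -[qexp _ _]/(qmul Delta (qexp Delta i)) /qmul big_ord1.
by rewrite /Delta big_ord1 /= mul0r.
Qed.

Lemma evS_X : evS 'X = DeltaS.
Proof.
rewrite evSE; apply: funext => n; rewrite /poly_Delta size_polyX !big_ord_recl big_ord0.
rewrite !coefX /= mul0r add0r addr0 mul1r.
by rewrite -[qmul _ _]/(DeltaS * 1) mulr1.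
Qed.

(** Delta is transcendental, as its expansion starts with q. *)
Lemma evS_inj : injective evS.
Proof.
suff ker P : evS P = 0 -> P = 0.
  by move=> P Q E; apply/eqP; rewrite -subr_eq0; apply/eqP/ker; rewrite rmorphB E subrr.
have [n] := ubnP (size P); elim: n P => // n IH P le EP.
have P0 : root P 0.
  have := congr1 (fun f : pseries 'F_2 => f 0%N) EP; rewrite evSE ps0 /poly_Delta.
  rewrite /root horner_coef0; case: (posnP (size P)) => [/eqP|s0].
    by rewrite size_poly_eq0 => /eqP->; rewrite coef0.
  rewrite (bigD1 (Ordinal s0)) // qexp_Delta0 mulr1 big1 => [E|i ne].
    by rewrite -[P`_0]addr0; apply/eqP.
  by rewrite qexp_Delta0 (_ : i == 0%N :> nat = false) ?mulr0 //; apply: negPf.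
have [Q EQ] := factor_theorem _ _ P0; rewrite subr0 in EQ.
have [Q0|Qn] := eqVneq Q 0; first by rewrite EQ Q0 mul0r.
move: EP; rewrite EQ rmorphM evS_X => /eqP; rewrite mulf_eq0 => /orP[/eqP /IH ->|].
- by rewrite mul0r.
- by move: le; rewrite EQ size_mulX.
- move/eqP/(congr1 (fun f : pseries 'F_2 => f 1%N)); rewrite Delta1 ps0 => /eqP.
  by rewrite oner_eq0.
Qed.

(** * The points with x(2^m Q) = x(Q) *)

(** Numerator and denominator of x(2^m Q) as a fraction in x(Q): the inner variable
    stands for the discriminant, the outer one for x(Q). *)
Fixpoint dup_poly (m : nat) : {poly {poly 'F_2}} * {poly {poly 'F_2}} :=
  if m is n.+1 then
    let s := dup_poly n in (s.1 ^+ 4 + 'X%:P * s.2 ^+ 4, s.1 ^+ 2 * s.2 ^+ 2)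
  else ('X, 1).

Lemma dup_poly_size m : [/\ (dup_poly m).1 \is monic, size (dup_poly m).1 = (4 ^ m).+1,
  (size (dup_poly m).2 <= 4 ^ m)%N & (0 < m)%N -> (size (dup_poly m).2 < 4 ^ m)%N].
Proof.
elim: m => [|m [Pm Ps Rs _]]; first by rewrite /= monicX size_polyX size_poly1.
rewrite /=; move: (dup_poly m).1 (dup_poly m).2 Pm Ps Rs => P R Pm Ps Rs.
have s4 : (0 < 4 ^ m)%N by rewrite expn_gt0.
have sP n : size (P ^+ n) = (4 ^ m * n).+1.
  have := size_exp P n; rewrite Ps /= => <-.
  by rewrite prednK // lt0n size_poly_eq0 expf_neq0 // monic_neq0.
have sR n : (size (R ^+ n) <= ((4 ^ m).-1 * n).+1)%N.
  apply: leq_trans (leqSpred _) _; rewrite ltnS size_exp leq_mul2r.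
  by rewrite -!subn1 leq_sub2r // orbT.
have sXR : (size ('X%:P * R ^+ 4)%R < size (P ^+ 4)%R)%N.
  rewrite mul_polyC sP; apply: leq_ltn_trans (size_scale_leq _ _) _.
  apply: leq_ltn_trans (sR 4%N) _; rewrite ltnS ltn_mul2r /=.
  by case: (4 ^ m)%N s4.
have sPR : (size (P ^+ 2 * R ^+ 2)%R < 4 ^ m.+1)%N.
  apply: leq_ltn_trans (size_polyMleq _ _) _; rewrite sP expnS.
  have := sR 2%N; move: (size _) => r; case: (4 ^ m)%N s4 => // q _ /=; lia.
split; last by [].
- by rewrite monicE lead_coefDl // -monicE monic_exp.
- by rewrite size_polyDl // sP expnS mulnC.
- exact: ltnW.
Qed.

(** The equation x(2^m Q) = x(Q), in terms of z with x(Q) = z^2 + z. *)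
Definition cycle_poly m : {poly {poly 'F_2}} :=
  ((dup_poly m).1 + 'X * (dup_poly m).2) \Po ('X^2 + 'X).

Lemma cycle_poly_size m : (0 < m)%N ->
  cycle_poly m \is monic /\ size (cycle_poly m) = (2 * 4 ^ m).+1.
Proof.
move=> m0; have [Pm Ps _ /(_ m0) Rs] := dup_poly_size m.
set P := _.1 in Pm Ps *; set R := _.2 in Rs *.
have sXR : (size ('X * R)%R < size P)%N.
  by rewrite Ps ltnS; apply: leq_trans (size_polyMleq _ _) _; rewrite size_polyX.
have gm : P + 'X * R \is monic by rewrite monicE lead_coefDl // -monicE.
have gs : size (P + 'X * R) = (4 ^ m).+1 by rewrite size_polyDl.
have s2 : (size ('X : {poly {poly 'F_2}}) < size ('X^2 : {poly {poly 'F_2}}))%N.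
  by rewrite size_polyX size_polyXn.
have qs : size ('X^2 + 'X : {poly {poly 'F_2}}) = 3%N.
  by rewrite size_polyDl // size_polyXn.
have qm : 'X^2 + 'X \is @monic {poly 'F_2}.
  by rewrite monicE lead_coefDl // -monicE monicXn.
split.
  rewrite monicE lead_coef_comp ?qs // (eqP qm) expr1n mulr1.
  exact: gm.
have := size_comp_poly (P + 'X * R) ('X^2 + 'X).
rewrite gs qs /= => E; rewrite /cycle_poly -/P -/R mulnC -E prednK //.
rewrite lt0n size_poly_eq0; apply/eqP => E0.
by move: E; rewrite E0 size_poly0 /=; have := expn_gt0 4 m; lia.
Qed.

(** * Torsion points as the roots of a polynomial over F_2[Delta] *)

Section Evaluation.

Variable k : fieldType.
Hypothesis k2 : 2%N \in [pchar k].
Variable e : nat.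
Hypothesis e0 : (0 < e)%N.

(** Evaluation at Delta (t ^ e). *)
Lemma ev_exists : {ev : {rmorphism {poly 'F_2} -> laurent k} |
  forall P, ev P = toW k (psub (1 : k) e (evS P))}.
Proof.
pose f (P : {poly 'F_2}) : laurent k := toW k (psub (1 : k) e (evS P)).
have f_add : zmod_morphism f.
  move=> P Q; rewrite /f -toWB; congr (toW k _); apply: (addIr (psub (1 : k) e (evS Q))).
  by rewrite subrK -psubD // -rmorphD subrK.
have f_mul : monoid_morphism f.
  split=> [|P Q]; first by rewrite /f rmorph1 psub1 // toW1.
  by rewrite /f rmorphM psubM // toWM.
pose f' : {rmorphism {poly 'F_2} -> laurent k} := HB.pack f
  (GRing.isZmodMorphism.Build _ _ f f_add) (GRing.isMonoidMorphism.Build _ _ f f_mul).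
by exists f'.
Qed.

Definition ev : {rmorphism {poly 'F_2} -> laurent k} := sval ev_exists.

Lemma evE P : ev P = toW k (psub (1 : k) e (evS P)).
Proof. exact: svalP ev_exists P. Qed.

Lemma ev_inj : injective ev.
Proof.
move=> P Q; rewrite !evE => /eqP; rewrite toW_eq => /eqP.
by move/(psub_inj k2 e0 (oner_neq0 k))/evS_inj.
Qed.

End Evaluation.

Section TorsionSet.

Variable k : fieldType.
Hypothesis k2 : 2%N \in [pchar k].
Variables (gam : k) (m : nat).
Hypothesis m0 : (0 < m)%N.
Let N1 := (2 ^ m).-1.
Let N2 := (2 ^ m).+1.
Let e := (N1 * N2)%N.
Hypothesis prim : e.-primitive_root gam.

Local Notation W := (laurent k).
Local Notation tx := (tx gam e).
Local Notation zz := (zz gam e).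
Local Notation D := (tdisc gam e).
Local Notation origin := (origin e).
Local Notation ev := (ev k2 (prim_order_gt0 prim)).
Let W2 := W2 k2.
Let e0 : (0 < e)%N. Proof. exact: prim_order_gt0 prim. Qed.
Let gam0 := prim_neq0 prim.

Let pow2 : (2 ^ m = 2 * 2 ^ m.-1)%N.
Proof. by rewrite -expnS prednK. Qed.

Let pow2_gt0 : (0 < 2 ^ m.-1)%N. Proof. by rewrite expn_gt0. Qed.

Lemma odd_level : odd e.
Proof. by rewrite /e /N1 /N2 oddM pow2; apply/andP; split; lia. Qed.

Lemma coprime_levels : coprime N1 N2.
Proof.
have -> : N2 = (2 + N1)%N by rewrite /N2 /N1 pow2; lia.
by rewrite /coprime gcdnDr -/(coprime _ 2) coprimen2 /N1 pow2; lia.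
Qed.

Let nonzero n (x : 'I_n * 'I_n) : bool := (0 < x.1 + x.2)%N.

(** The nonzero points killed by N1 or by N2. As N1 and N2 are coprime, there are
    N1^2 - 1 + N2^2 - 1 = 2 * 4^m of them, the degree of cycle_poly. *)
Definition tors : finType :=
  ({x : 'I_N1 * 'I_N1 | nonzero x} + {x : 'I_N2 * 'I_N2 | nonzero x})%type.

Definition tpt (i : tors) : int * int :=
  match i with
  | inl x => (Posz (N2 * (val x).1), Posz (N2 * (val x).2))
  | inr x => (Posz (N1 * (val x).1), Posz (N1 * (val x).2))
  end.

Let N1_gt0 : (0 < N1)%N. Proof. by rewrite /N1 pow2; lia. Qed.

Let card_nonzero n : (0 < n)%N -> #|{: {x : 'I_n * 'I_n | nonzero x}}| = (n * n).-1.
Proof.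
move=> n0; rewrite card_sig; pose o := Ordinal n0.
have := cardC (pred1 (o, o)); rewrite card1 card_prod card_ord => <-.
rewrite add1n /=; apply: eq_card => -[x y]; rewrite !inE /nonzero /= addn_gt0 !lt0n.
by rewrite -negb_and.
Qed.

Lemma card_tors : #|tors| = (2 * 4 ^ m)%N.
Proof.
rewrite card_sum !card_nonzero // /N1 /N2.
rewrite (_ : (4 ^ m = 2 ^ m * 2 ^ m)%N); last by rewrite -expnMn.
by rewrite pow2; move: (2 ^ m.-1)%N pow2_gt0 => q; nia.
Qed.

Lemma originE a b : origin (Posz a, Posz b) = (e %| a)%N && (e %| b)%N.
Proof. by rewrite !originQ !dvdzE. Qed.

Let dvd1 (x : nat) : (e %| N2 * x)%N = (N1 %| x)%N.
Proof. by rewrite /e mulnC dvdn_pmul2l. Qed.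

Let dvd2 (x : nat) : (e %| N1 * x)%N = (N2 %| x)%N.
Proof. by rewrite /e dvdn_pmul2l. Qed.

Let ord_dvd n (x : 'I_n) : (n %| x)%N = (x == 0 :> nat)%N.
Proof.
have [->|x0] := posnP x; first by rewrite dvdn0.
by rewrite gtnNdvd.
Qed.

Lemma tpt_nontriv i : ~~ origin (tpt i).
Proof.
case: i => -[[x y] /= H]; rewrite originE ?dvd1 ?dvd2 !ord_dvd.
  by rewrite negb_and -!lt0n -addn_gt0.
by rewrite negb_and -!lt0n -addn_gt0.
Qed.

Lemma tpt_cycle i : origin (tpt i *+ 2 ^ m - tpt i) || origin (tpt i *+ 2 ^ m + tpt i).
Proof.
have EN1 : (2 ^ m = N1.+1)%N by rewrite /N1 prednK // expn_gt0.
have key a b c : (e %| a * b)%N ->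
    (Posz e %| Posz (a * c) *+ b)%Z.
  by move=> H; rewrite -mulr_natr natz -PoszM dvdzE /= mulnAC dvdn_mulr.
case: i => x; apply/orP; [left|right].
  by rewrite EN1 mulrSr addrK pairMnE !originQ /= !key // mulnC.
by rewrite -mulrSr pairMnE !originQ /= !key.
Qed.

Let tpt_inj_aux (a b c d : nat) : origin (Posz a - Posz b, Posz c - Posz d) ->
  (a < e)%N -> (b < e)%N -> (c < e)%N -> (d < e)%N -> a = b /\ c = d.
Proof.
have H x y : (Posz e %| Posz x - Posz y)%Z -> (x < e)%N -> (y < e)%N -> x = y.
  move=> /dvdzP[q Eq] lx ly.
  have [Eq0|nq] := eqVneq q 0; first by move: Eq; rewrite Eq0 mul0r; lia.
  by exfalso; move: nq Eq lx ly; case: q => [[|q]|q] //; nia.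
by case/andP=> /= H1 H2 la lb lc ld; split; apply: H.
Qed.

Lemma tpt_lt i : exists a b, [/\ tpt i = (Posz a, Posz b), (a < e)%N & (b < e)%N].
Proof.
case: i => -[[x y] H]; have lx := ltn_ord x; have ly := ltn_ord y.
  exists (N2 * x)%N, (N2 * y)%N; split; first by [].
    by rewrite /e mulnC ltn_pmul2r.
  by rewrite /e mulnC ltn_pmul2r.
exists (N1 * x)%N, (N1 * y)%N; split; first by [].
  by rewrite /e ltn_pmul2l.
by rewrite /e ltn_pmul2l.
Qed.

Lemma tpt_inj i j : origin (tpt i - tpt j) -> i = j.
Proof.
have [a [b [Ei la lb]]] := tpt_lt i; have [c [d [Ej lc ld]]] := tpt_lt j.
rewrite Ei Ej => O; have [Eac Ebd] := tpt_inj_aux O la lc lb ld.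
have {O} Eij : tpt i = tpt j by rewrite Ei Ej Eac Ebd.
clear a b c d Ei la lb Ej lc ld Eac Ebd.
have no_mix (x : 'I_N1) (y : 'I_N2) : (N2 * x = N1 * y)%N -> x = 0%N :> nat.
  move=> E; apply/eqP; rewrite -ord_dvd -(Gauss_dvdr _ coprime_levels).
  by rewrite E dvdn_mulr.
case: i j Eij => [[[x y] H]|[[x y] H]] [[[x' y'] H']|[[x' y'] H']] /= [] /eqP E1 /eqP E2.
- rewrite !eqn_pmul2l // in E1 E2; congr inl; apply: val_inj => /=.
  by congr pair; apply: val_inj; apply/eqP.
- by exfalso; move: H; rewrite /nonzero /= (no_mix _ _ (eqP E1)) (no_mix _ _ (eqP E2)).
- exfalso; move: H'; rewrite /nonzero /=.
  by rewrite (no_mix _ _ (esym (eqP E1))) (no_mix _ _ (esym (eqP E2))).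
- rewrite !eqn_pmul2l // in E1 E2; congr inr; apply: val_inj => /=.
  by congr pair; apply: val_inj; apply/eqP.
Qed.

Definition tz_root (i : tors) : W := zz (tpt i).

Lemma tz_root_inj : injective tz_root.
Proof.
move=> i j /(zz_inj k2 prim odd_level (tpt_nontriv i) (tpt_nontriv j)) O.
by apply/esym/tpt_inj.
Qed.

Lemma ev_X : ev 'X = D.
Proof. by rewrite evE evS_X (tdiscE k2 gam0 e0). Qed.

Lemma dup_polyE Q n : ~~ origin Q ->
  (map_poly ev (dup_poly n).2).[tx Q] != 0 /\
  (map_poly ev (dup_poly n).1).[tx Q] =
    tx (Q *+ 2 ^ n) * (map_poly ev (dup_poly n).2).[tx Q].
Proof.
move=> OQ; elim: n => [|n [IH0 IH]].
  by rewrite /= map_polyX hornerX rmorph1 hornerC oner_neq0 mulr1.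
have On : ~~ origin (Q *+ 2 ^ n).
  elim: n {IH IH0} => // n IH; rewrite expnS mulnC mulrnA (origin_double odd_level) //.
have x0 := tx_neq0 k2 prim odd_level On.
rewrite /= rmorphD (rmorphM _ 'X%:P) (rmorphM _ (_ ^+ 2)) !rmorphXn /= map_polyC /= ev_X.
rewrite hornerD (hornerM (_ ^+ 2)) (hornerM D%:P) !horner_exp hornerC IH.
move: (_.[tx Q]) IH0 => r r0; split.
  by rewrite mulf_neq0 ?expf_neq0 // mulf_neq0.
rewrite expnS mulnC mulrnA (tx_double_eq k2 prim odd_level On).
move: (tx (Q *+ 2 ^ n)) x0 => x x0.
by field.
Qed.

(** If 2^m Q = Q or 2^m Q = - Q, both sides of the equation agree. *)
Lemma cycle_poly_root Q : ~~ origin Q ->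
  origin (Q *+ 2 ^ m - Q) || origin (Q *+ 2 ^ m + Q) ->
  root (map_poly ev (cycle_poly m)) (zz Q).
Proof.
move=> OQ cyc; rewrite /root /cycle_poly map_comp_poly horner_comp.
have -> : map_poly ev ('X^2 + 'X) = 'X^2 + 'X by rewrite rmorphD /= map_polyXn map_polyX.
rewrite hornerD hornerXn hornerX rmorphD rmorphM /= map_polyX.
rewrite -(tx_zz k2 prim) hornerD hornerM hornerX.
have [n0 ->] := dup_polyE m OQ.
rewrite -mulrDl mulf_eq0 (negPf n0) orbF (char2_add_eq0 W2).
have Om : ~~ origin (Q *+ 2 ^ m).
  elim: (m) => [|n IH]; first exact: OQ.
  by rewrite expnS mulnC mulrnA (origin_double odd_level).
case/orP: cyc => O.
  by rewrite -[Q *+ 2 ^ m](subrK Q) addrC (tx_origin k2 prim).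
have -> : Q *+ 2 ^ m = - Q + (Q *+ 2 ^ m + Q) by rewrite addrC addrK.
by rewrite (tx_origin k2 prim) // (txN k2 gam0).
Qed.

(** All the roots are found, as their number is the degree. *)
Lemma cycle_poly_split : map_poly ev (cycle_poly m) = \prod_i ('X - (tz_root i)%:P).
Proof.
have [cm cs] := cycle_poly_size m0.
have ms : size (map_poly ev (cycle_poly m)) = (2 * 4 ^ m).+1.
  by rewrite size_map_inj_poly // ?rmorph0 //; apply: ev_inj.
rewrite [LHS](all_roots_prod_XsubC (p := map_poly ev (cycle_poly m))
  (rs := [seq tz_root i | i <- enum tors])).
- have -> : lead_coef (map_poly ev (cycle_poly m)) = 1.
    by apply/monicP/monic_map.
  by rewrite scale1r big_map big_enum.
- by rewrite ms size_map -cardE card_tors.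
- by apply/allP => _ /mapP[i _ ->]; apply: cycle_poly_root (tpt_nontriv i) (tpt_cycle i).
- by rewrite uniq_rootsE map_inj_uniq ?enum_uniq //; apply: tz_root_inj.
Qed.

End TorsionSet.

(** * Sums over the subgroups of order p *)

Lemma mod_mul_inj p b : prime p -> (0 < b < p)%N ->
  forall p0 : (0 < p)%N, injective (fun i : 'I_p => Ordinal (ltn_pmod (b * i) p0)).
Proof.
move=> pp /andP[b0 lt] p0 i j /(congr1 val) /= /eqP H; apply: val_inj.
wlog le : i j H / (i <= j)%N.
  by move=> IH; case/orP: (leq_total i j) => le; [|symmetry]; apply: IH; rewrite // eq_sym.
move: H; rewrite eq_sym eqn_mod_dvd ?leq_mul2l ?le ?orbT //= -mulnBr Gauss_dvdr; last first.
  by rewrite prime_coprime // gtnNdvd.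
move=> dv; apply/eqP; rewrite eqn_leq le /= -subn_eq0.
by case: posnP => // /dvdn_leq /(_ dv); move: (ltn_ord j); lia.
Qed.

Section Subgroups.

Variable k : fieldType.
Hypothesis k2 : 2%N \in [pchar k].
Variables (gam : k) (e : nat).
Hypothesis prim : e.-primitive_root gam.
Hypothesis odd_e : odd e.
Variable h : nat.
Hypothesis h0 : (0 < h)%N.
Let p := h.*2.+1.
Hypothesis pp : prime p.

Local Notation W := (laurent k).
Local Notation tx := (tx gam e).
Local Notation zz := (zz gam e).
Local Notation D := (tdisc gam e).
Local Notation origin := (origin e).
Let W2 := W2 k2.
Let e0 : (0 < e)%N. Proof. exact: prim_order_gt0 prim. Qed.
Let gam0 := prim_neq0 prim.
Let p0 : (0 < p)%N. Proof. by []. Qed.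

Lemma origin_prime Q j : origin (Q *+ p) -> ~~ origin Q -> (0 < j < p)%N ->
  ~~ origin (Q *+ j).
Proof.
move=> Op OQ /andP[j0 lt]; apply: contra OQ => Oj.
by apply: (origin_coprime _ Op Oj); rewrite prime_coprime // gtnNdvd.
Qed.

(** The t_C and the Y_C of the subgroup C generated by Q. *)
Definition tval (Q : int * int) : W := \sum_(i < h) tx (Q *+ i.+1).
Definition Yval (Q : int * int) : W := D + tval Q + tval Q ^+ 2.

Let g Q n := zz (Q *+ n) * tx (Q *+ n).

Let g_mod Q n : origin (Q *+ p) -> g Q (n %% p) = g Q n.
Proof.
move=> Op; rewrite /g [in RHS](divn_eq n p) addnC mulrnDr [(_ * p)%N]mulnC mulrnA.
have On : origin (Q *+ p *+ (n %/ p)) by apply: origin_mul.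
by rewrite (zz_origin k2 prim odd_e _ On) (tx_origin k2 prim _ On).
Qed.

(** Opposite points have the same abscissa x and values of zz that differ by 1, so the
    products zz * x of the two points sum to x. *)
Lemma tvalE Q : origin (Q *+ p) -> ~~ origin Q ->
  tval Q = \sum_(j < p | j != 0%N :> nat) g Q j.
Proof.
move=> Op OQ; have := half_sum h (g Q).
rewrite -/p (bigD1 (Ordinal p0)) //= => /addrI.
rewrite (eq_bigl (fun j : 'I_p => j != 0%N :> nat)) => [->|j]; last by rewrite -val_eqE.
apply: eq_bigr => i _; have lt := ltn_ord i.
have E : Q *+ (h.*2 - i) = - (Q *+ i.+1) + Q *+ p.
  rewrite (_ : p = i.+1 + (h.*2 - i))%N; last by rewrite /p; lia.
  by rewrite mulrnDr addKr.
have Oi : ~~ origin (Q *+ i.+1) by apply: origin_prime => //; rewrite /p; lia.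
rewrite /g E (zz_origin k2 prim odd_e _ Op) (tx_origin k2 prim _ Op).
rewrite (txN k2 gam0) // (zzN k2 prim) //; move: (zz _) (tx _) => z x.
by apply: (char2_eq W2 (w := - (z * x))); ring.
Qed.

Lemma tval_mul Q j : origin (Q *+ p) -> ~~ origin Q -> (0 < j < p)%N ->
  tval (Q *+ j) = tval Q.
Proof.
move=> Op OQ jp; have Oj := origin_prime Op OQ jp.
have Opj : origin (Q *+ j *+ p) by rewrite -mulrnA mulnC mulrnA origin_mul.
rewrite !tvalE // [RHS](reindex_inj (@mod_mul_inj p j pp jp p0)) /=.
apply: eq_big => [i|i _].
  rewrite -/(dvdn p (j * i)) Gauss_dvdr; last first.
    by case/andP: jp => j0 lt; rewrite prime_coprime // gtnNdvd.
  by rewrite /dvdn modn_small.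
by rewrite g_mod // /g -!mulrnA.
Qed.

Variable n : nat.

(** A function of the point Q, rational in zz Q, whose sum over the generators of C is
    Y_C ^ n + D ^ n. As 0^-1 = 0, it vanishes when t_C does, and so does that sum. *)
Definition Sval Q : W := zz Q * tx Q * (tval Q)^-1 * (Yval Q ^+ n + D ^+ n).

Lemma sum_Sval Q : origin (Q *+ p) -> ~~ origin Q ->
  \sum_(j < p | j != 0%N :> nat) Sval (Q *+ j) = Yval Q ^+ n + D ^+ n.
Proof.
move=> Op OQ.
rewrite (eq_bigr (fun j : 'I_p => g Q j * ((tval Q)^-1 * (Yval Q ^+ n + D ^+ n)))).
  rewrite -mulr_suml -tvalE // mulrA.
  have [t0|tn] := eqVneq (tval Q) 0; last by rewrite divff // mul1r.
  rewrite t0 mul0r mul0r /Yval t0 expr0n addr0 addr0.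
  by rewrite (addrr_pchar2 W2).
move=> j j0; have jp : (0 < j < p)%N by rewrite lt0n j0 ltn_ord.
by rewrite /Sval /Yval (tval_mul Op OQ jp) /g !mulrA.
Qed.

Lemma Sval_origin Q R : origin R -> Sval (Q + R) = Sval Q.
Proof.
move=> OR; have tv : tval (Q + R) = tval Q.
  apply: eq_bigr => i _; rewrite mulrnDl (tx_origin k2 prim) //.
  exact: origin_mul.
by rewrite /Sval /Yval tv (zz_origin k2 prim odd_e) // (tx_origin k2 prim).
Qed.

(** Generators of the p + 1 subgroups of order p: a p-th root of unity, and the p-th
    roots of q. *)
Variable d : nat.
Hypothesis Ed : e = (d * p)%N.

Definition Coo : int * int := (Posz d, 0).
Definition Cpt (a : nat) : int * int := (Posz (a * d), Posz d).

Let d0 : (0 < d)%N.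
Proof. by case: (posnP d) => // d0; move: e0; rewrite Ed d0. Qed.

Let dvd_ed (x : nat) : (Posz e %| Posz (x * d))%Z = (p %| x)%N.
Proof. by rewrite dvdzE /= Ed mulnC dvdn_pmul2r. Qed.

Let mulzE (x y : nat) : Posz x *+ y = Posz (x * y).
Proof. by rewrite -mulr_natr natz. Qed.

Lemma Coo_order : origin (Coo *+ p) /\ ~~ origin Coo.
Proof.
rewrite !originQ pairMnE /= mul0rn !dvdz0 !andbT mulzE mulnC dvd_ed dvdnn.
split=> //; rewrite -[d]mul1n dvd_ed dvdn1; apply/eqP => p1.
by move: pp; rewrite p1.
Qed.

Lemma Cpt_order a : origin (Cpt a *+ p) /\ ~~ origin (Cpt a).
Proof.
rewrite !originQ pairMnE /= !mulzE mulnAC [(d * p)%N]mulnC !dvd_ed dvdnn dvdn_mull //.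
split=> //; rewrite negb_and; apply/orP; right.
by rewrite -[d]mul1n dvd_ed dvdn1; apply/eqP => p1; move: pp; rewrite p1.
Qed.

(** Every nonzero (x1, x2) modulo p is a multiple of exactly one of (1, 0) and the
    (a, 1). *)
Lemma sum_points : \sum_(x : 'I_p * 'I_p | (0 < x.1 + x.2)%N)
    Sval (Posz (x.1 * d), Posz (x.2 * d)) =
  (Yval Coo ^+ n + D ^+ n) + \sum_(a < p) (Yval (Cpt a) ^+ n + D ^+ n).
Proof.
rewrite -(pair_big_dep xpredT (fun a b : 'I_p => (0 < a + b)%N)
  (fun a b : 'I_p => Sval (Posz (a * d), Posz (b * d)))) /=.
rewrite (exchange_big_dep xpredT) //=; rewrite (bigD1 (Ordinal p0)) //=; congr (_ + _).
  have [O1 O2] := Coo_order; rewrite -(sum_Sval O1 O2).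
  apply: eq_big => [a|a _]; first by rewrite addn0 lt0n.
  by congr Sval; rewrite pairMnE /= mul0rn mulzE mulnC.
have -> : \sum_(a < p) (Yval (Cpt a) ^+ n + D ^+ n) =
    \sum_(a < p) \sum_(j < p | j != 0%N :> nat) Sval (Cpt a *+ j).
  by apply: eq_bigr => a _; have [O1 O2] := Cpt_order a; rewrite sum_Sval.
rewrite exchange_big /=; apply: eq_big => [b|b b0]; first by rewrite -val_eqE.
have bp : (0 < b < p)%N by rewrite lt0n ltn_ord andbT; move: b0; rewrite -val_eqE.
rewrite (reindex_inj (@mod_mul_inj p b pp bp p0)) /=.
apply: eq_big => [a|a _]; first by rewrite addn_gt0; case/andP: bp => -> _; rewrite orbT.
pose R : int * int := (Posz (((b * a) %/ p * p) * d), 0).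
have OR : origin R by rewrite !originQ /= dvd_ed dvdn_mull // dvdz0.
rewrite -(Sval_origin _ OR); congr Sval.
rewrite pairMnE /= !mulzE /R -[LHS]/(_ + _, _ + 0) addr0; congr pair; last by rewrite /= mulnC.
by rewrite /= -PoszD -mulnDl addnC -divn_eq; congr Posz; rewrite -mulnA mulnC.
Qed.

End Subgroups.

Section HeckeSum.

Variable k : fieldType.
Hypothesis k2 : 2%N \in [pchar k].
Variables (gam : k) (e : nat).
Hypothesis prim : e.-primitive_root gam.
Hypothesis odd_e : odd e.
Variable h : nat.
Let p := h.*2.+1.
Variable d : nat.
Hypothesis Ed : e = (d * p)%N.

Local Notation Yval := (Yval gam e h).
Let e0 : (0 < e)%N. Proof. exact: prim_order_gt0 prim. Qed.
Let gam0 := prim_neq0 prim.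
Let d0 : (0 < d)%N.
Proof. by case: (posnP d) => // d0; move: e0; rewrite Ed d0. Qed.

Let prim_d : p.-primitive_root (gam ^+ d).
Proof.
have dv : (p %| e)%N by rewrite Ed dvdn_mull.
by have := dvdn_prim_root prim dv; rewrite Ed mulnK.
Qed.

Lemma Yval_Coo : toW k (psub 1 (e * p) DeltaS) = Yval (Coo d).
Proof. by rewrite (@velu_unity _ k2 _ gam0 e h d). Qed.

Lemma Yval_Cpt a : toW k (psub (gam ^+ d ^+ a) d DeltaS) = Yval (Cpt d a).
Proof.
rewrite -exprM mulnC -[gam ^+ (a * d)]/(gam ^ Posz (a * d)).
rewrite (@velu_root _ k2 _ gam0 e h _ d) //.
have mulzE (x y : nat) : Posz x *+ y = Posz (x * y) by rewrite -mulr_natr natz.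
rewrite pairMnE /= !mulzE -/p -mulnA -Ed /qpt mulr1 /up /= .
congr (_ * _); rewrite expr0z -[gam ^ _]/(gam ^+ (a * e)) mulnC exprM.
by rewrite (prim_expr_order prim) expr1n.
Qed.

(** T_p = V_p + U_p, where U_p is an average over the p-th roots of unity. *)
Lemma hecke_psub (f : pseries 'F_2) :
  psub (1 : k) e (hecke p f : pseries 'F_2) =
  psub 1 (e * p) f + \sum_(a < p) psub (gam ^+ d ^+ a) d f.
Proof.
rewrite (psub_trace k2) //; last by rewrite /= odd_double.
have -> : (hecke p f : pseries 'F_2) = ((fun n => f (p * n)%N) : pseries 'F_2) +
    ((fun n => if (p %| n)%N then f (n %/ p)%N else 0) : pseries 'F_2).
  by apply: funext => n; rewrite psD.
rewrite (psubD k2) addrC -Ed; congr (_ + _); apply: funext => n; rewrite /psub.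
rewrite !expr1n !mul1r.
have [/dvdnP[j ->]|nd] := boolP (e %| n)%N; last first.
  by rewrite ifN //; apply: contra nd; apply: dvdn_trans; rewrite dvdn_mulr.
rewrite mulnK // [(e * p)%N]mulnC dvdn_pmul2r // divnMr //.
by case: ifP => _ //; rewrite /f2k eqxx.
Qed.

Lemma hecke_sum n : toW k (psub 1 e (hecke p (DeltaS ^+ n) : pseries 'F_2)) =
  Yval (Coo d) ^+ n + \sum_(a < p) Yval (Cpt d a) ^+ n.
Proof.
rewrite hecke_psub toWD psubX ?muln_gt0 ?e0 // toWXn Yval_Coo; congr (_ + _).
rewrite rmorph_sum; apply: eq_bigr => a _.
by rewrite psubX // -Yval_Cpt -toWXn.
Qed.

End HeckeSum.

(** * T_p preserves the polynomials in Delta *)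

Section Trace.

Variable k : fieldType.
Hypothesis k2 : 2%N \in [pchar k].
Variables (gam : k) (m : nat).
Hypothesis m0 : (0 < m)%N.
Let N1 := (2 ^ m).-1.
Let N2 := (2 ^ m).+1.
Let e := (N1 * N2)%N.
Hypothesis prim : e.-primitive_root gam.
Variable h : nat.
Hypothesis h0 : (0 < h)%N.
Let p := h.*2.+1.
Hypothesis pp : prime p.
Hypothesis p_dvd : (p %| N1)%N.
Let c := (N1 %/ p)%N.
Let d := (c * N2)%N.

Local Notation W := (laurent k).
Local Notation tx := (tx gam e).
Local Notation zz := (zz gam e).
Local Notation D := (tdisc gam e).
Local Notation origin := (origin e).
Local Notation ev := (ev k2 (prim_order_gt0 prim)).
Let W2 := W2 k2.
Let e0 : (0 < e)%N. Proof. exact: prim_order_gt0 prim. Qed.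
Let odd_e := odd_level k2 m0 prim.

Let Ed : e = (d * p)%N.
Proof. by rewrite /d mulnAC divnK. Qed.

Let d0 : (0 < d)%N.
Proof. by case: (posnP d) => // d0; move: e0; rewrite Ed d0. Qed.

Let p_tors_point (x : 'I_p * 'I_p) : (0 < x.1 + x.2)%N ->
  exists i : tors m, tpt i = (Posz (x.1 * d), Posz (x.2 * d)).
Proof.
case: x => a b /= ab.
have c0 : (0 < c)%N by move: d0; rewrite /d muln_gt0 => /andP[].
have lt (y : 'I_p) : (c * y < N1)%N.
  by rewrite -[X in (_ < X)%N](divnK p_dvd) ltn_pmul2l.
have H : (0 < (Ordinal (lt a), Ordinal (lt b)).1 + (Ordinal (lt a), Ordinal (lt b)).2)%N.
  by rewrite /= -mulnDr muln_gt0 c0.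
exists (inl (exist _ (Ordinal (lt a), Ordinal (lt b)) H)).
by rewrite /= /d -/N2; congr (Posz _, Posz _); rewrite mulnCA mulnA [LHS]mulnC mulnA.
Qed.

Let mulzE (x y : nat) : Posz x *+ y = Posz (x * y).
Proof. by rewrite -mulr_natr natz. Qed.

Let coord (i : tors m) : 'I_p * 'I_p :=
  (inord (`|(tpt i).1|%N %/ d), inord (`|(tpt i).2|%N %/ d)).

Let coord_tpt i (x : 'I_p * 'I_p) : tpt i = (Posz (x.1 * d), Posz (x.2 * d)) -> coord i = x.
Proof.
move=> E; rewrite /coord E /= !mulnK //; case: x {E} => a b.
by congr pair; apply: val_inj; rewrite /= inordK.
Qed.

Let tpt_coord i : origin (tpt i *+ p) ->
  tpt i = (Posz ((coord i).1 * d), Posz ((coord i).2 * d)).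
Proof.
have [a [b [E la lb]]] := tpt_lt k2 m0 prim i; rewrite /coord E pairMnE /= !mulzE originE => /andP[].
rewrite -/N1 -/N2 -/e Ed !dvdn_pmul2r // => da db.
by rewrite /= !inordK ?divnK // ltn_divLR // mulnC -Ed.
Qed.

(** As p divides N1, all the points of order p are among the points of tors. *)
Lemma sum_p_torsion (F : int * int -> W) :
  \sum_(i : tors m | origin (tpt i *+ p)) F (tpt i) =
  \sum_(x : 'I_p * 'I_p | (0 < x.1 + x.2)%N) F (Posz (x.1 * d), Posz (x.2 * d)).
Proof.
have h1 : (1 < p)%N by rewrite prime_gt1.
have [i0 _] := @p_tors_point (ord0, Ordinal h1) isT.
pose pt (x : 'I_p * 'I_p) : tors m :=
  odflt i0 [pick i | tpt i == (Posz (x.1 * d), Posz (x.2 * d))].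
have ptE (x : 'I_p * 'I_p) : (0 < x.1 + x.2)%N -> tpt (pt x) = (Posz (x.1 * d), Posz (x.2 * d)).
  move=> /p_tors_point[i Ei]; rewrite /pt; case: pickP => [j /eqP //|/(_ i)].
  by rewrite Ei eqxx.
have coord_gt0 i : origin (tpt i *+ p) -> (0 < (coord i).1 + (coord i).2)%N.
  move=> /tpt_coord Ei; rewrite lt0n; apply/negP; rewrite addn_eq0.
  move=> /andP[/eqP E1 /eqP E2].
  by have := tpt_nontriv k2 m0 prim i; rewrite Ei E1 E2 (origin0 e).
rewrite (reindex_onto pt coord) /=; last first.
  move=> i Oi; apply: (tpt_inj k2 m0 prim).
  by rewrite (ptE _ (coord_gt0 _ Oi)) -(tpt_coord Oi) subrr origin0.
apply: eq_big => [x|x /andP[Ox /eqP Ex]]; last first.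
  by rewrite ptE // -Ex coord_gt0.
apply/andP/idP => [[Ox /eqP <-]|x0]; first exact: coord_gt0.
split; last by rewrite (coord_tpt (ptE x x0)).
rewrite (ptE _ x0) pairMnE /= !mulzE originE -(mulnA x.1 d p) -(mulnA x.2 d p) -Ed.
by apply/andP; split; apply: dvdn_mull.
Qed.

Let N1_mul Q : origin (Q *+ p) -> origin (Q *+ 2 ^ m - Q).
Proof.
move=> Op; have -> : (2 ^ m = p * c + 1)%N.
  by rewrite mulnC divnK // /N1 addn1 prednK // expn_gt0.
by rewrite mulrnDr mulr1n addrK mulrnA origin_mul.
Qed.

Lemma integral_tx Q : origin (Q *+ p) -> ~~ origin Q -> integralOver ev (tx Q).
Proof.
move=> Op OQ; have iz : integralOver ev (zz Q).
  exists (cycle_poly m); first by case: (cycle_poly_size m0).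
  by apply: (cycle_poly_root k2 m0) => //; rewrite N1_mul.
by rewrite (tx_zz k2 prim); apply: integral_add => //; apply: integral_mul.
Qed.

Lemma integral_exp Q n : integralOver ev Q -> integralOver ev (Q ^+ n).
Proof.
move=> iQ; elim: n => [|n IH]; first exact: integral1.
by rewrite exprS; apply: integral_mul.
Qed.

Lemma integral_D : integralOver ev D.
Proof. by rewrite -(ev_X k2 prim); apply: integral_id. Qed.

Lemma integral_Yval Q : origin (Q *+ p) -> ~~ origin Q -> integralOver ev (Yval gam e h Q).
Proof.
move=> Op OQ; have it : integralOver ev (tval gam e h Q).
  apply: (big_ind (integralOver ev)) => [||i _]; first exact: integral0.
    by move=> x y; apply: integral_add.
  have Oj : ~~ origin (Q *+ i.+1).
    by apply: (origin_prime pp Op OQ); move: (ltn_ord i); lia.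
  by apply: integral_tx => //; rewrite -mulrnA mulnC mulrnA origin_mul.
apply: integral_add; last exact: integral_exp.
by apply: integral_add => //; apply: integral_D.
Qed.

Section Descent.

Variable iota : {rmorphism {fraction {poly 'F_2}} -> W}.
Hypothesis iotaE : forall P, iota (tofrac P) = ev P.

Lemma descent w a : integralOver ev w -> w = iota a -> exists P, w = ev P.
Proof.
move=> [q qm qw] Ew; suff [P EP] : exists P, a = tofrac P.
  by exists P; rewrite Ew EP iotaE.
apply: frac_integral; exists q => //; move: qw.
rewrite (_ : map_poly ev q = map_poly iota (map_poly (@tofrac _) q)).
  by rewrite Ew fmorph_root.
by rewrite -map_poly_comp; apply: eq_map_poly => P /=; rewrite iotaE.
Qed.

Let gfrac : {poly {fraction {poly 'F_2}}} := map_poly (@tofrac _) (cycle_poly m).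

Let gfracE : map_poly iota gfrac = \prod_i ('X - (tz_root (m := m) gam i)%:P).
Proof.
rewrite -(cycle_poly_split k2 m0 prim) /gfrac -map_poly_comp.
by apply: eq_map_poly => P /=; rewrite iotaE.
Qed.

Local Notation rat := (rational iota (tz_root (m := m) gam)).

Let rat_D : rat (fun _ => D).
Proof.
by apply: rational_eq (rational_cst iota _ (tofrac 'X)) => i; rewrite iotaE ev_X.
Qed.

Let rat_tx : rat (fun i => tx (tpt i)).
Proof.
apply: rational_eq (rationalD (rationalX 2 (rational_z _ _)) (rational_z _ _)) => i.
by rewrite /= (tx_zz k2 prim).
Qed.

Let ratV f : rat f -> rat (fun i => (f i)^-1).
Proof. exact: (rationalV (tz_root_inj k2 m0 prim) gfracE). Qed.

Let rat_multx n : rat (fun i => (multx (tx (tpt i)) D n).1) /\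
  rat (fun i => (multx (tx (tpt i)) D n).2).
Proof.
elim: n => [|n [IH1 IH2]] /=.
  split=> //; apply: rationalD; first exact: rationalX.
  by apply: rationalM => //; apply/ratV/rationalX.
split=> //; apply: rationalD => //; apply: rationalM; first exact: rationalM.
by apply/ratV/rationalX/rationalD.
Qed.

Let rat_prod J (r : seq J) (P : pred J) (f : J -> tors m -> W) :
  (forall j, P j -> rat (f j)) -> rat (fun i => \prod_(j <- r | P j) f j i).
Proof.
move=> H; elim: r => [|j r IH].
  by apply: rational_eq (rational_cst iota _ 1) => i; rewrite big_nil rmorph1.
case Pj : (P j); last by apply: rational_eq IH => i; rewrite big_cons Pj.
by apply: rational_eq (rationalM (H j Pj) IH) => i; rewrite big_cons Pj.
Qed.

Let rat1 : rat (fun _ => 1).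
Proof. by apply: rational_eq (rational_cst iota _ 1) => i; rewrite rmorph1. Qed.

Let rat_nz f : rat f -> rat (fun i => nz (f i)).
Proof. by move=> H; apply: rationalM => //; apply: ratV. Qed.

Let rat_ind : rat (fun i => tors_ind h (tx (tpt i)) D).
Proof.
have H j : rat (fun i => nz ((multx (tx (tpt i)) D j).1 + (multx (tx (tpt i)) D j).2)).
  by have [H1 H2] := rat_multx j; apply/rat_nz/rationalD.
apply: rationalM; last exact: rationalD.
by apply: rat_prod => j _.
Qed.

Variable n : nat.

(** The indicator tors_ind turns the sum over the points of order p into a sum over all
    the roots of cycle_poly. *)
Lemma rational_trace : exists a,
  \sum_(i : tors m | origin (tpt i *+ p)) Sval gam e h n (tpt i) = iota a.
Proof.
pose t (i : tors m) : W := \sum_(j < h) (multx (tx (tpt i)) D j).1.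
pose f (i : tors m) : W := tors_ind h (tx (tpt i)) D *
  (zz (tpt i) * tx (tpt i) * (t i)^-1 * ((D + t i + t i ^+ 2) ^+ n + D ^+ n)).
have rat_t : rat t by apply: rational_sumf => j _; case: (rat_multx j).
have rat_f : rat f.
  apply: rationalM => //; apply: rationalM.
    apply: rationalM; last exact: ratV.
    by apply: rationalM => //; apply: rational_z.
  apply: rationalD; last exact: rationalX.
  by apply/rationalX/rationalD; [apply: rationalD | apply: rationalX].
have [a Ea] := rational_sum (tz_root_inj k2 m0 prim) gfracE rat_f.
exists a; rewrite -Ea big_mkcond; apply: eq_bigr => i _; rewrite /f.
have Oi := tpt_nontriv k2 m0 prim i.
rewrite (tors_indE k2 prim odd_e h0 pp Oi) -/p.
case: ifP => Op; last by rewrite mul0r.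
rewrite mul1r (_ : t i = tval gam e h (tpt i)) //.
apply: eq_bigr => j _; rewrite (multx_tx k2 prim odd_e) // => l /andP[l0 ll].
apply: (origin_prime pp Op Oi); rewrite l0 /=.
by apply: leq_ltn_trans ll _; have := ltn_ord j; lia.
Qed.

End Descent.

(** The p + 1 terms D ^ n of sum_points cancel, as p + 1 is even. *)
Lemma hecke_power n : exists P : {poly 'F_2}, hecke p (qexp Delta n) = poly_Delta P.
Proof.
have [iota iotaE] := frac_lift (@ev_inj _ k2 _ (prim_order_gt0 prim)).
have [a Ea] := rational_trace iotaE n.
have HS := hecke_sum k2 prim Ed n.
set w := toW k _ in HS.
suff [P EP] : exists P, w = ev P.
  exists P; rewrite qexpE -evSE; apply: (psub_inj k2 e0 (oner_neq0 k)).
  by apply/eqP; rewrite -toW_eq -/w EP evE.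
apply: (descent iotaE (a := a)).
  rewrite HS; have [O1 O2] := Coo_order prim pp Ed.
  apply: integral_add; first exact/integral_exp/integral_Yval.
  apply: (big_ind (integralOver ev)) => [||i _]; first exact: integral0.
    by move=> x y; apply: integral_add.
  by have [] := Cpt_order prim pp Ed i => *; exact/integral_exp/integral_Yval.
rewrite -Ea sum_p_torsion (sum_points k2 prim odd_e h0 pp n Ed) HS.
rewrite big_split /= sumr_const card_ord addrACA -mulrS.
by rewrite (char2_mulrn W2) /= odd_double addr0.
Qed.

End Trace.

(** The product is 4^m - 1, the order of the multiplicative group of the field with
    4^m elements. *)
Lemma level_field m : (0 < m)%N -> exists (k : fieldType) (gam : k),
  2%N \in [pchar k] /\ ((2 ^ m).-1 * (2 ^ m).+1).-primitive_root gam.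
Proof.
move=> m0; have m20 : (0 < 2 * m)%N by rewrite muln_gt0.
have [F F2 cF] := pPrimePowerField (isT : prime 2) m20.
set e := (_ * _)%N; have q2 : (1 < 2 ^ m)%N by rewrite -(expn0 2) ltn_exp2l.
have Ee : #|F| = e.+1.
  rewrite cF mulnC expnM /e; case: (2 ^ m)%N q2 => // q _.
  by rewrite -mulnn /=; lia.
have e0 : (0 < e)%N by rewrite /e muln_gt0 andbT -subn1 subn_gt0.
pose rs := rem 0 (enum F).
have s_rs : size rs = e by rewrite size_rem ?mem_enum // -cardE Ee.
have u_rs : uniq rs by rewrite rem_uniq // enum_uniq.
have /hasP[gam _ prim] : has e.-primitive_root rs.
  apply: has_prim_root => //; last by rewrite s_rs.
  apply/allP => x; rewrite mem_rem_uniq ?enum_uniq // !inE => /andP[x0 _].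
  rewrite unity_rootE; apply/eqP/(mulfI x0).
  by rewrite -exprS -Ee expf_card mulr1.
by exists F, gam.
Qed.

(** The prime p divides 2^m - 1 for m = p - 1. *)
Lemma hecke_Delta_power p n : odd_prime p ->
  exists P : {poly 'F_2}, hecke p (qexp Delta n) = poly_Delta P.
Proof.
case/andP=> pp op; have p1 := prime_gt1 pp.
have Ep : p = (p./2).*2.+1 by rewrite -[LHS]odd_double_half op.
have m0 : (0 < p.-1)%N by rewrite -subn1 subn_gt0.
have [k [gam [k2 prim]]] := level_field m0.
have dv : ((p./2).*2.+1 %| (2 ^ p.-1).-1)%N.
  rewrite -Ep -subn1 -eqn_mod_dvd ?expn_gt0 // -totient_prime //.
  by apply/eqP/Euler_exp_totient; rewrite coprime2n.
rewrite [p in hecke p]Ep; apply: (hecke_power k2 m0 prim _ _ dv).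
  by rewrite lt0n; apply/eqP => h0; rewrite h0 in Ep; rewrite Ep in p1.
by rewrite -Ep.
Qed.

(** * Modular equations for p = 3 and p = 5 *)

(** For n < #|I|, the remainder of X^n g' modulo g is D X^n itself in sum_roots. *)
Lemma power_sums (F : fieldType) (I : finType) (z : I -> F) (g : {poly F}) D n :
  injective z -> g \is monic -> size g = #|I|.+1 -> g^`() = D%:P ->
  (forall i, root g (z i)) -> (n < #|I|)%N ->
  \sum_i z i ^+ n = D *+ (n == #|I|.-1).
Proof.
move=> z_inj gm gs dg gz ln.
have Eg : g = \prod_i ('X - (z i)%:P).
  rewrite (all_roots_prod_XsubC (p := g) (rs := [seq z i | i <- enum I])).
  - by rewrite (monicP gm) scale1r big_map big_enum.
  - by rewrite gs size_map -cardE.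
  - by apply/allP => _ /mapP[i _ ->].
  - by rewrite uniq_rootsE map_inj_uniq ?enum_uniq.
have := sum_roots z_inj 'X^n.
rewrite (eq_bigr (fun i => z i ^+ n)) => [->|i _]; last by rewrite hornerXn.
rewrite -Eg dg modp_small; last first.
  rewrite mulrC mul_polyC (leq_ltn_trans (size_scale_leq _ _)) // size_polyXn gs ltnS //.
by rewrite mulrC mul_polyC coefZ coefXn eq_sym mulr_natr.
Qed.

Section SmallPrimes.

Variable k : fieldType.
Hypothesis k2 : 2%N \in [pchar k].
Variables (gam : k) (e : nat).
Hypothesis prim : e.-primitive_root gam.
Hypothesis odd_e : odd e.

Local Notation W := (laurent k).
Local Notation tx := (tx gam e).
Local Notation D := (tdisc gam e).
Local Notation origin := (origin e).
Let W2 := W2 k2.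
Let e0 : (0 < e)%N. Proof. exact: prim_order_gt0 prim. Qed.
Let gam0 := prim_neq0 prim.

Let dbl Q : ~~ origin Q -> D = tx (Q *+ 2) * tx Q ^+ 2 + tx Q ^+ 4.
Proof.
move=> OQ; have x0 := tx_neq0 k2 prim odd_e OQ; rewrite (tx_double_eq k2 prim) //.
by apply: (char2_eq W2 (w := - tx Q ^+ 4)); field.
Qed.

Let exprD1_8 (b : W) : (b + 1) ^+ 8 = b ^+ 8 + 1.
Proof. by rewrite -[8%N]/(2 * 2 * 2)%N !exprM !(char2_sqrD W2) !expr1n. Qed.

(** As 2 Q = - Q, duplication gives D = x^3 (x + 1) for the abscissa x of Q, and then
    Y = x (x + 1)^3. *)
Lemma Yval3 Q : origin (Q *+ 3) -> ~~ origin Q ->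
  Yval gam e 1 Q ^+ 4 + D * Yval gam e 1 Q + D ^+ 4 = 0.
Proof.
move=> O3 OQ; have E2 : tx (Q *+ 2) = tx Q.
  have -> : Q *+ 2 = - Q + Q *+ 3 by rewrite [Q *+ 3]mulrS addKr.
  by rewrite (tx_origin k2 prim) // (txN k2 gam0).
have := dbl OQ; rewrite E2 /Yval /tval big_ord1 mulr1n.
move: (tx Q) => x ->.
have -> : x * x ^+ 2 + x ^+ 4 + x + x ^+ 2 = x * (x + 1) ^+ 3.
  by apply: (char2_eq W2 (w := - (x ^+ 2 + x ^+ 3))); ring.
have -> : x * x ^+ 2 + x ^+ 4 = x ^+ 3 * (x + 1) by ring.
have -> : (x * (x + 1) ^+ 3) ^+ 4 + x ^+ 3 * (x + 1) * (x * (x + 1) ^+ 3) +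
    (x ^+ 3 * (x + 1)) ^+ 4 = x ^+ 4 * (x + 1) ^+ 4 * ((x + 1) ^+ 8 + 1 + x ^+ 8) by ring.
rewrite exprD1_8; apply: (char2_eq W2 (w := x ^+ 4 * (x + 1) ^+ 4 * (x ^+ 8 + 1))); ring.
Qed.

(** Let x, y be the abscissas of Q and 2 Q, and t = x + y. As 4 Q = - Q, duplication
    gives D = x y^2 + y^4 = y x^2 + x^4; it follows that x y = t^3, D = t^5 (t + 1) and
    Y = t (t + 1)^5. *)
Lemma Yval5 Q : origin (Q *+ 5) -> ~~ origin Q ->
  Yval gam e 2 Q ^+ 6 + D ^+ 2 * Yval gam e 2 Q ^+ 4 + D ^+ 4 * Yval gam e 2 Q ^+ 2 +
    D * Yval gam e 2 Q + D ^+ 6 = 0.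
Proof.
move=> O5 OQ; have O2 : ~~ origin (Q *+ 2) by rewrite (origin_double odd_e).
have E4 : tx (Q *+ 2 *+ 2) = tx Q.
  have -> : Q *+ 2 *+ 2 = - Q + Q *+ 5 by rewrite -mulrnA [Q *+ 5]mulrS addKr.
  by rewrite (tx_origin k2 prim) // (txN k2 gam0).
have := dbl OQ; have := dbl O2; rewrite E4 /Yval /tval !big_ord_recl big_ord0 /= addr0 mulr1n.
have t0 : tx Q + tx (Q *+ 2) != 0.
  rewrite (char2_add_eq0 W2); apply/eqP => /(tx_eq_origin k2 prim odd_e OQ O2).
  rewrite [Q *+ 2 - Q](_ : _ = Q); last by rewrite mulr2n addrK.
  rewrite (negPf OQ) /= -mulrSr => O3.
  by move: OQ; rewrite (origin_coprime (isT : coprime 3 5) O3 O5).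
move: t0; move: (tx (Q *+ 2)) (tx Q) => y x t0 ED1 ED2.
pose t := x + y; have Exy : x * y = t ^+ 3.
  apply: (mulfI t0); have : x * y ^+ 2 + y ^+ 4 = y * x ^+ 2 + x ^+ 4 by rewrite -ED1 -ED2.
  rewrite -/t => E.
  have {}E : x * y ^+ 2 + y ^+ 4 + (y * x ^+ 2 + x ^+ 4) = 0 by rewrite E (addrr_pchar2 W2).
  apply/eqP; rewrite -(char2_add_eq0 W2) -E; apply/eqP; rewrite /t.
  by apply: (char2_eq W2 (w := 2 * x ^+ 3 * y + 3 * x ^+ 2 * y ^+ 2 + 2 * x * y ^+ 3)); ring.
have ED : D = t ^+ 5 * (t + 1).
  have Ey : y ^+ 2 = t * y + t ^+ 3.
    by rewrite -Exy /t; apply: (char2_eq W2 (w := - x * y)); ring.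
  have -> : D = x * y * y + (y ^+ 2) ^+ 2 by rewrite ED1; ring.
  have -> : (y ^+ 2) ^+ 2 = t ^+ 2 * y ^+ 2 + t ^+ 6.
    by rewrite {1}Ey (char2_sqrD W2); ring.
  rewrite Exy Ey; apply: (char2_eq W2 (w := t ^+ 3 * y)); ring.
have -> : D + (x + y) + (x + y) ^+ 2 = t * (t + 1) ^+ 5.
  rewrite -/t ED.
  by apply: (char2_eq W2 (w := - (2 * t ^+ 2 + 5 * t ^+ 3 + 5 * t ^+ 4 + 2 * t ^+ 5))); ring.
rewrite ED.
set Y := t * _; set D' := t ^+ 5 * _.
have -> : Y ^+ 6 + D' ^+ 2 * Y ^+ 4 + D' ^+ 4 * Y ^+ 2 + D' * Y + D' ^+ 6 =
    t ^+ 6 * (t + 1) ^+ 6 * (((t + 1) ^+ 8) ^+ 3 + t ^+ 8 * ((t + 1) ^+ 8) ^+ 2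
     + t ^+ 16 * (t + 1) ^+ 8 + 1 + t ^+ 24) by rewrite /Y /D'; ring.
rewrite exprD1_8 (_ : _ + t ^+ 24 = 2 * (2 * t ^+ 24 + 3 * t ^+ 16 + 2 * t ^+ 8 + 1)).
  by rewrite (pcharf0 W2) mul0r mulr0.
ring.
Qed.

End SmallPrimes.

Section ConjugateDiscriminants.

Variable k : fieldType.
Hypothesis k2 : 2%N \in [pchar k].
Variables (gam : k) (e : nat).
Hypothesis prim : e.-primitive_root gam.
Variable h : nat.
Hypothesis h0 : (0 < h)%N.
Let p := h.*2.+1.
Hypothesis pp : prime p.
Variable d : nat.
Hypothesis Ed : e = (d * p)%N.

Local Notation W := (laurent k).
Local Notation Yval := (Yval gam e h).
Local Notation D := (tdisc gam e).
Let e0 : (0 < e)%N. Proof. exact: prim_order_gt0 prim. Qed.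
Let d0 : (0 < d)%N.
Proof. by case: (posnP d) => // d0; move: e0; rewrite Ed d0. Qed.
Let prim_d : p.-primitive_root (gam ^+ d).
Proof.
have dv : (p %| e)%N by rewrite Ed dvdn_mull.
by have := dvdn_prim_root prim dv; rewrite Ed mulnK.
Qed.

(** The index 0 is the subgroup of the roots of unity, and a + 1 the one generated by
    zeta^a q^(1/p). *)
Definition conj_disc (i : 'I_p.+1) : W :=
  if nat_of_ord i is a.+1 then Yval (Cpt d a) else Yval (Coo d).

Let coef_root a : psub (gam ^+ d ^+ a) d DeltaS d = gam ^+ d ^+ a.
Proof. have := psubE (gam ^+ d ^+ a) DeltaS 1 d0.
by rewrite muln1 Delta1 expr1 /f2k /= mulr1. Qed.

Let coef_unity : psub (1 : k) (e * p) DeltaS d = 0.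
Proof.
rewrite /psub ifN // gtnNdvd // Ed -mulnA -[X in (X < _)%N]muln1 ltn_pmul2l //.
by rewrite -[1%N]/(1 * 1)%N ltn_mul // prime_gt1.
Qed.

Let root_unity a : toW k (psub (1 : k) (e * p) DeltaS) != toW k (psub (gam ^+ d ^+ a) d DeltaS).
Proof.
rewrite toW_eq; apply/eqP => /(congr1 (fun f : pseries k => f d)).
rewrite coef_unity coef_root => /esym/eqP; apply/negP; rewrite expf_neq0 //.
by rewrite expf_neq0 // (prim_neq0 prim).
Qed.

(** The coefficient of t^d = q^(1/p) separates the conjugates: it is zeta^a for
    Delta (zeta^a q^(1/p)), and 0 for Delta (q^p). *)
Lemma conj_disc_inj : injective conj_disc.
Proof.
have YC := Yval_Coo k2 prim Ed; have YP := Yval_Cpt k2 prim Ed.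
case=> [[|a] la] [[|b] lb]; rewrite /conj_disc /= => E; apply: val_inj => //=.
- by move: E (root_unity b); rewrite YC YP => ->; rewrite eqxx.
- by move: E (root_unity a); rewrite YC YP => ->; rewrite eqxx.
congr _.+1; move: E; rewrite -!YP => /eqP; rewrite toW_eq => /eqP.
move=> /(congr1 (fun f : pseries k => f d)); rewrite !coef_root => /eqP.
by rewrite (eq_prim_root_expr prim_d) /eqn !modn_small // => /eqP.
Qed.

Lemma hecke_conj_disc n : toW k (psub 1 e (hecke p (DeltaS ^+ n) : pseries 'F_2)) =
  \sum_i conj_disc i ^+ n.
Proof.
rewrite (hecke_sum k2 prim Ed) [RHS]big_ord_recl; congr (_ + _).
Qed.

Lemma conj_disc_point i : exists2 Q, origin e (Q *+ p) /\ ~~ origin e Q &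
  conj_disc i = Yval Q.
Proof.
case: i => [[|a] la]; first by exists (Coo d); first exact: (Coo_order prim pp Ed).
by exists (Cpt d a); first exact: (Cpt_order prim pp Ed).
Qed.

Let emb (f : pseries 'F_2) : W := toW k (psub 1 e f).

Let emb_inj : injective emb.
Proof.
by move=> f g /eqP; rewrite /emb toW_eq => /eqP; apply: (psub_inj k2 e0 (oner_neq0 k)).
Qed.

Let embX n : emb (DeltaS ^+ n) = D ^+ n.
Proof. by rewrite /emb psubX // toWXn (tdiscE k2 (prim_neq0 prim)). Qed.

Lemma hecke_low (g : {poly W}) n : g \is monic -> size g = p.+2 -> g^`() = D%:P ->
  (forall i, root g (conj_disc i)) -> (n <= p)%N ->
  (hecke p (DeltaS ^+ n) : pseries 'F_2) = DeltaS *+ (n == p).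
Proof.
move=> gm gs dg gr le; apply: emb_inj; rewrite /emb hecke_conj_disc.
rewrite (power_sums conj_disc_inj gm _ dg gr) ?card_ord //=.
case: (n == p); rewrite ?mulr1n ?mulr0n ?psub0 ?toW0 //.
by rewrite -[DeltaS]expr1 -/(emb _) embX expr1.
Qed.

(** The list r holds the pairs (a, b) of exponents of the monomials D^a Y^b of the
    equation of the conjugates. *)
Lemma hecke_recurrence (r : seq (nat * nat)) n :
  (forall i, conj_disc i ^+ p.+1 = \sum_(c <- r) D ^+ c.1 * conj_disc i ^+ c.2) ->
  (hecke p (DeltaS ^+ (n + p.+1)) : pseries 'F_2) =
    \sum_(c <- r) DeltaS ^+ c.1 * (hecke p (DeltaS ^+ (n + c.2)) : pseries 'F_2).
Proof.
move=> H; apply: emb_inj; rewrite /emb hecke_conj_disc psub_sum // rmorph_sum /=.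
rewrite (eq_bigr (fun i => \sum_(c <- r) D ^+ c.1 * conj_disc i ^+ (n + c.2))).
  rewrite exchange_big; apply: eq_bigr => c _.
  by rewrite psubM // toWM -/(emb _) embX hecke_conj_disc mulr_sumr.
move=> i _; rewrite exprD H mulr_sumr; apply: eq_bigr => c _.
by rewrite exprD mulrCA.
Qed.

End ConjugateDiscriminants.

Lemma monic_lower (F : fieldType) (r : {poly F}) n : (size r <= n)%N ->
  'X^n + r \is monic /\ size ('X^n + r) = n.+1.
Proof.
move=> le; have lt : (size r < size ('X^n : {poly F}))%N by rewrite size_polyXn.
by rewrite monicE lead_coefDl // -monicE monicXn size_polyDl // size_polyXn.
Qed.

Lemma size_polyD_le (F : fieldType) (q r : {poly F}) n :
  (size q <= n)%N -> (size r <= n)%N -> (size (q + r)%R <= n)%N.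
Proof. by move=> lq lr; rewrite (leq_trans (size_polyD _ _)) // geq_max lq. Qed.

Lemma poly_char2_mulrn (F : fieldType) (q : {poly F}) n :
  2%N \in [pchar F] -> q *+ n.*2 = 0.
Proof.
move=> F2; have P2 : 2%N \in [pchar {poly F}] by rewrite pchar_poly.
by rewrite -mul2n mulrnA (mulrn_pchar P2) mul0rn.
Qed.

(** The level 15 serves both p = 3 and p = 5. *)
Lemma hecke3_facts :
  (forall n, (n <= 3)%N -> (hecke 3 (DeltaS ^+ n) : pseries 'F_2) = DeltaS *+ (n == 3)) /\
  (forall n, (hecke 3 (DeltaS ^+ (n + 4)) : pseries 'F_2) =
    DeltaS * (hecke 3 (DeltaS ^+ (n + 1)) : pseries 'F_2) +
    DeltaS ^+ 4 * (hecke 3 (DeltaS ^+ (n + 0)) : pseries 'F_2)).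
Proof.
have [k [gam [k2 prim]]] := level_field (isT : 0 < 2)%N.
set e := (_ * _)%N in prim.
have Ed : e = (5 * 3)%N by [].
have W2 := W2 k2; set D := tdisc gam e.
have rel (i : 'I_(1.*2.+2)) : conj_disc gam e 5 i ^+ 4 + D * conj_disc gam e 5 i + D ^+ 4 = 0.
  have [Q [O3 OQ] ->] := conj_disc_point prim (isT : prime 1.*2.+1) Ed i.
  exact: (Yval3 k2 prim (isT : odd e)).
split=> n.
  pose r : {poly laurent k} := D *: 'X + (D ^+ 4)%:P.
  have sr : (size r <= 4)%N.
    apply: size_polyD_le; last by rewrite (leq_trans (size_polyC_leq1 _)).
    by rewrite (leq_trans (size_scale_leq _ _)) ?size_polyX.
  have [gm gs] := monic_lower sr.
  apply: (hecke_low k2 prim (isT : prime 1.*2.+1) Ed gm gs).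
    rewrite derivD derivXn derivD derivZ derivX derivC addr0 (poly_char2_mulrn _ 2 W2).
    by rewrite add0r alg_polyC.
  move=> i; rewrite /root !hornerD hornerXn hornerZ hornerX hornerC addrA.
  by rewrite rel.
rewrite (@hecke_recurrence _ k2 _ _ prim 1 5 Ed [:: (1, 1); (4, 0)]%N).
  by rewrite !big_cons big_nil /= addr0 expr1.
move=> i; rewrite !big_cons big_nil /= !expr1 expr0 mulr1 addr0.
by apply/eqP; rewrite -(char2_add_eq0 W2) addrA; apply/eqP/rel.
Qed.

Lemma hecke5_facts :
  (forall n, (n <= 5)%N -> (hecke 5 (DeltaS ^+ n) : pseries 'F_2) = DeltaS *+ (n == 5)) /\
  (forall n, (hecke 5 (DeltaS ^+ (n + 6)) : pseries 'F_2) =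
    DeltaS ^+ 2 * (hecke 5 (DeltaS ^+ (n + 4)) : pseries 'F_2) +
    (DeltaS ^+ 4 * (hecke 5 (DeltaS ^+ (n + 2)) : pseries 'F_2) +
    (DeltaS * (hecke 5 (DeltaS ^+ (n + 1)) : pseries 'F_2) +
    DeltaS ^+ 6 * (hecke 5 (DeltaS ^+ (n + 0)) : pseries 'F_2)))).
Proof.
have [k [gam [k2 prim]]] := level_field (isT : 0 < 2)%N.
set e := (_ * _)%N in prim.
have Ed : e = (3 * 5)%N by [].
have W2 := W2 k2; set D := tdisc gam e.
have rel (i : 'I_(2.*2.+2)) : conj_disc gam e 3 i ^+ 6 + (D ^+ 2 * conj_disc gam e 3 i ^+ 4 +
    (D ^+ 4 * conj_disc gam e 3 i ^+ 2 + (D * conj_disc gam e 3 i + D ^+ 6))) = 0.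
  have [Q [O5 OQ] ->] := conj_disc_point prim (isT : prime 2.*2.+1) Ed i.
  by rewrite !addrA; apply: (Yval5 k2 prim (isT : odd e)).
split=> n.
  pose r : {poly laurent k} :=
    D ^+ 2 *: 'X^4 + (D ^+ 4 *: 'X^2 + (D *: 'X + (D ^+ 6)%:P)).
  have sr : (size r <= 6)%N.
    rewrite !size_polyD_le ?(leq_trans (size_polyC_leq1 _)) //;
      by rewrite (leq_trans (size_scale_leq _ _)) ?size_polyXn ?size_polyX.
  have [gm gs] := monic_lower sr.
  apply: (hecke_low k2 prim (isT : prime 2.*2.+1) Ed gm gs).
    rewrite !derivD !derivZ !derivXn derivX derivC 
      (poly_char2_mulrn _ 1 W2) (poly_char2_mulrn _ 2 W2) (poly_char2_mulrn _ 3 W2).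
    by rewrite !scaler0 !add0r addr0 alg_polyC.
  move=> i; rewrite /root !hornerD !hornerZ !hornerXn hornerX hornerC.
  by rewrite rel.
rewrite (@hecke_recurrence _ k2 _ _ prim 2 3 Ed [:: (2, 4); (4, 2); (1, 1); (6, 0)]%N).
  by rewrite !big_cons big_nil /= addr0 expr1.
move=> i; rewrite !big_cons big_nil /= !expr1 expr0 mulr1 addr0.
by apply/eqP; rewrite -(char2_add_eq0 W2); apply/eqP/rel.
Qed.

(** * Binary digits *)

Local Open Scope nat_scope.

Lemma base4_ind (P : nat -> Prop) :
  P 0 -> (forall x r, r < 4 -> 0 < 4 * x + r -> P x -> P (4 * x + r)) ->
  forall n, P n.
Proof.
move=> P0 IH; elim/ltn_ind=> -[//|n] IHn.
have E : n.+1 = 4 * (n.+1 %/ 4) + n.+1 %% 4 by lia.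
by rewrite E; apply: IH; [lia | lia | apply: IHn; lia].
Qed.

(** The relation disj i j holds when i and j have no common binary digit, that is, when
    C(i + j, j) is odd. The first argument bounds the number of digits read. *)
Fixpoint disj_rec (fuel i j : nat) : bool :=
  if fuel is s.+1 then ~~ (odd i && odd j) && disj_rec s i./2 j./2 else true.

Definition disj (i j : nat) : bool := disj_rec i i j.

Lemma disj_rec0 s j : disj_rec s 0 j.
Proof. by elim: s j => //= s IH j. Qed.

Lemma disj_recE s i j : i <= s -> disj_rec s i j = disj i j.
Proof.
suff H s' s'' a b : a <= s' -> a <= s'' ->
    disj_rec s' a b = disj_rec s'' a b by move=> le_is; exact: H.
elim: s' s'' a b => [|s' IH] [|s''] a b //=.
- by rewrite leqn0 => /eqP-> _; rewrite disj_rec0.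
- by rewrite leqn0 => _ /eqP->; rewrite disj_rec0.
- move=> H1 H2; congr (_ && _); apply: IH; lia.
Qed.

Lemma disjE i j : disj i j = ~~ (odd i && odd j) && disj i./2 j./2.
Proof. by rewrite -(@disj_recE i.+1) //= disj_recE //; lia. Qed.

Lemma disj0 i : disj i 0.
Proof.
elim/ltn_ind: i => -[|i] IH //; rewrite disjE andbF /=.
by apply: IH; lia.
Qed.

Lemma disj0l j : disj 0 j.
Proof. exact: disj_rec0. Qed.

Lemma disj2 i j a b : a < 2 -> b < 2 ->
  disj (2 * i + a) (2 * j + b) = (a * b == 0) && disj i j.
Proof.
move=> Ha Hb; rewrite disjE.
have -> : (2 * i + a)./2 = i by lia.
have -> : (2 * j + b)./2 = j by lia.
by congr (_ && _); case: a Ha => [|[]] //; case: b Hb => [|[]] //; lia.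
Qed.

Lemma disj4 i j a b : a < 4 -> b < 4 ->
  disj (4 * i + a) (4 * j + b) = disj a b && disj i j.
Proof.
move=> Ha Hb.
have -> : 4 * i + a = 2 * (2 * i + a %/ 2) + a %% 2 by lia.
have -> : 4 * j + b = 2 * (2 * j + b %/ 2) + b %% 2 by lia.
rewrite disj2 ?disj2; try lia.
rewrite andbA; congr (_ && _).
rewrite [in RHS](_ : a = 2 * (2 * 0 + a %/ 2) + a %% 2); last by lia.
rewrite [in RHS](_ : b = 2 * (2 * 0 + b %/ 2) + b %% 2); last by lia.
by rewrite disj2 ?disj2 ?disj0 ?andbT; lia.
Qed.

(** Pascal's rule for the parity of C(i + j, j). *)
Lemma disj_pascal i j : disj i.+1 j.+1 = disj i j.+1 (+) disj i.+1 j.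
Proof.
elim/ltn_ind: i j => i IH j.
have [a [x [Hx Ei]]] : exists a x, x < 2 /\ i = 2 * a + x
  by exists (i %/ 2), (i %% 2); lia.
have [b [y [Hy Ej]]] : exists b y, y < 2 /\ j = 2 * b + y
  by exists (j %/ 2), (j %% 2); lia.
have S0 c : (2 * c + 0).+1 = 2 * c + 1 by lia.
have S1 c : (2 * c + 1).+1 = 2 * c.+1 + 0 by lia.
subst i j; case: x Hx IH => [|[|//]] _ IH; case: y Hy => [|[|//]] _;
  rewrite ?S0 ?S1 !disj2 //= ?addbb ?addbF //.
by apply: IH; lia.
Qed.

(** * The coordinates n3 and n5 of an odd exponent *)

(** The exponent 2 x + 1 has n_3 and n_5 read off the base 4 digits of x: the lower bits
    of the digits form n_3, the upper ones n_5. *)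
Definition a3 (x : nat) : nat := n3 x.*2.+1.
Definition a5 (x : nat) : nat := n5 x.*2.+1.

Lemma base4_sum (F : nat -> nat) x B : x < 4 ^ B ->
  (F 0 = 0) ->
  \sum_(i < B) F (x %/ 4 ^ i) * 2 ^ i =
  \sum_(i < (x.*2.+1).+1) F (x %/ 4 ^ i) * 2 ^ i.
Proof.
move=> Hx F0.
have vanish c : x < 4 ^ c -> forall d, c <= d ->
    \sum_(i < d) F (x %/ 4 ^ i) * 2 ^ i = \sum_(i < c) F (x %/ 4 ^ i) * 2 ^ i.
  move=> Hc d /subnKC <-; elim: (d - c) => [|n IH]; first by rewrite addn0.
  rewrite addnS big_ord_recr /= IH divn_small ?F0 ?mul0n ?addn0 //.
  by rewrite (leq_trans Hc) // leq_exp2l // leq_addr.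
have Hx' : x < 4 ^ (x.*2.+1).+1.
  by apply: (@leq_trans (4 ^ x)); [apply: ltn_expl | rewrite leq_exp2l //; lia].
have [le|lt] := leqP B (x.*2.+1).+1.
  by rewrite (vanish B Hx).
by rewrite (vanish _ Hx' B (ltnW lt)).
Qed.

Lemma a3E x B : x < 4 ^ B -> a3 x = \sum_(i < B) odd (x %/ 4 ^ i) * 2 ^ i.
Proof.
move=> Hx; rewrite (base4_sum (F := fun y => odd y)) // /a3 /n3.
apply: eq_bigr => i _; congr (nat_of_bool (odd _) * _).
have Ex : x.*2.+1 %/ 2 = x by lia.
by rewrite expnS divnMA Ex -mul2n expnM.
Qed.

Lemma a5E x B : x < 4 ^ B -> a5 x = \sum_(i < B) odd (x %/ 4 ^ i)./2 * 2 ^ i.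
Proof.
move=> Hx; rewrite (base4_sum (F := fun y => odd y./2)) // /a5 /n5.
apply: eq_bigr => i _; congr (nat_of_bool (odd _) * _).
have Ex : x.*2.+1 %/ 2 = x by lia.
by rewrite !expnS !divnMA Ex -mul2n expnM -divn2 -!divnMA mulnC.
Qed.

Lemma a3_digit x r : r < 4 -> a3 (4 * x + r) = 2 * a3 x + odd r.
Proof.
move=> Hr; have Hx : x < 4 ^ x by apply: ltn_expl.
rewrite (@a3E _ x.+1) ?(@a3E x x) ?expnS; try lia.
rewrite big_ord_recl expn0 divn1 muln1 addnC big_distrr /=; congr (_ + _).
  apply: eq_bigr => i _; rewrite /bump /= !expnS divnMA.
  have -> : (4 * x + r) %/ 4 = x by lia.
  lia.
by rewrite oddD oddM.
Qed.

Lemma a5_digit x r : r < 4 -> a5 (4 * x + r) = 2 * a5 x + (1 < r).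
Proof.
move=> Hr; have Hx : x < 4 ^ x by apply: ltn_expl.
rewrite (@a5E _ x.+1) ?(@a5E x x) ?expnS; try lia.
rewrite big_ord_recl expn0 divn1 muln1 addnC big_distrr /=; congr (_ + _).
  apply: eq_bigr => i _; rewrite /bump /= !expnS divnMA.
  have -> : (4 * x + r) %/ 4 = x by lia.
  lia.
lia.
Qed.

Lemma a3_0 : a3 0 = 0.
Proof. by rewrite (@a3E 0 0) // big_ord0. Qed.

Lemma a5_0 : a5 0 = 0.
Proof. by rewrite (@a5E 0 0) // big_ord0. Qed.

Lemma a35_inj x y : a3 x = a3 y -> a5 x = a5 y -> x = y.
Proof.
elim/base4_ind: x y => [|x r Hr Hx IH] y.
  rewrite a3_0 a5_0; elim/base4_ind: y => // y s Hs Hy IHy.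
  rewrite a3_digit // a5_digit // => H1 H2.
  have E : 0 = y by apply: IHy; lia.
  by move: H1 H2; rewrite -E; case: s Hs Hy => [|[|[|[|]]]] //=; lia.
have -> : y = 4 * (y %/ 4) + y %% 4 by lia.
have Hs : y %% 4 < 4 by lia.
rewrite !a3_digit // !a5_digit // => H1 H2.
by rewrite (IH (y %/ 4)); lia.
Qed.

(** * How the exponents move under T_3 and T_5 *)

Section Automaton.

Variables (w alpha beta gamma : nat).

Let f x := a3 x + w * a5 x.
(* The contribution of one base 4 digit to f. *)
Let fdig r := odd r + w * (1 < r).

Let f_digit x r : r < 4 -> f (4 * x + r) = 2 * f x + fdig r.
Proof. by move=> Hr; rewrite /f a3_digit // a5_digit // /fdig; lia. Qed.

(** A state (b, c, d, v) of the automaton asserts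
      f (n + gamma j + d) + v <= f (beta n + gamma j + c)
    for all n, j with alpha n + b and j disjoint. Splitting off the last base 4 digits
    of n and j moves the carries b, c, d to the state t, and the difference v is paid by
    the last digits of both arguments, the assertion for t counting twice. *)
Definition state_step (T : seq (nat * nat * nat * nat)) (s : nat * nat * nat * nat)
    (n j : nat) : bool :=
  let: (b, c, d, v) := s in
  let B := alpha * n + b in
  let C := beta * n + gamma * j + c in
  let D := n + gamma * j + d in
  disj (B %% 4) j ==>
  has (fun t => [&& t.1.1.1 == B %/ 4, t.1.1.2 == C %/ 4, t.1.2 == D %/ 4
                  & fdig (D %% 4) + v <= fdig (C %% 4) + 2 * t.2]) T.

(** The list T is closed under the transitions, and its assertions hold at n = j = 0,
    where c < 16 has two digits and d < 4 only one. *)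
Definition valid_potential (T : seq (nat * nat * nat * nat)) : bool :=
  ((0, 0, 0, 0) \in T) &&
  all (fun s => all (fun n => all (state_step T s n) (iota 0 4)) (iota 0 4)) T
  && all (fun s => [&& s.1.1.2 < 16, s.1.2 < 4 &
     fdig s.1.2 + s.2 <= 2 * fdig (s.1.1.2 %/ 4) + fdig (s.1.1.2 %% 4)]) T.

Lemma potential_bound T : valid_potential T ->
  forall n j b c d v, (b, c, d, v) \in T -> disj (alpha * n + b) j ->
    f (n + gamma * j + d) + v <= f (beta * n + gamma * j + c).
Proof.
case/andP=> /andP[T0 /allP Tstep] /allP Tbase n j.
have [s] := ubnP (n + j); elim: s n j => // s IH n j Hs b c d v Hin Hdisj.
have [/eqP|Hpos] := posnP (n + j).
  rewrite addn_eq0 => /andP[/eqP-> /eqP->]; rewrite !muln0 !add0n.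
  have /= /and3P[Hc Hd Hle] := Tbase _ Hin.
  have fd r : r < 4 -> f r = fdig r.
    by move/(f_digit 0); rewrite /f a3_0 a5_0 !muln0 !add0n.
  suff -> : f c = 2 * fdig (c %/ 4) + fdig (c %% 4) by rewrite fd.
  have := f_digit (c %/ 4) (ltn_pmod c (isT : 0 < 4)).
  by rewrite (fd (c %/ 4)); [move<-; congr f; lia | lia].
have En : n = 4 * (n %/ 4) + n %% 4 by lia.
have Ej : j = 4 * (j %/ 4) + j %% 4 by lia.
move: (n %/ 4) (n %% 4) (j %/ 4) (j %% 4) (ltn_pmod n (isT : 0 < 4))
  (ltn_pmod j (isT : 0 < 4)) En Ej => n' n0 j' j0 Hn0 Hj0 En Ej.
have /allP/(_ n0)/(_ _)/allP/(_ j0) := Tstep _ Hin.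
rewrite !mem_iota /= => /(_ Hn0 Hj0).
set B := alpha * n0 + b; set C := beta * n0 + gamma * j0 + c.
set D := n0 + gamma * j0 + d.
have EB : alpha * n + b = 4 * (alpha * n' + B %/ 4) + B %% 4.
  by rewrite En /B mulnDr mulnCA; lia.
have EC : beta * n + gamma * j + c
    = 4 * (beta * n' + gamma * j' + C %/ 4) + C %% 4.
  by rewrite En Ej /C 2!mulnDr (mulnCA beta) (mulnCA gamma); lia.
have ED : n + gamma * j + d = 4 * (n' + gamma * j' + D %/ 4) + D %% 4.
  by rewrite En Ej /D mulnDr (mulnCA gamma); lia.
move: Hdisj; rewrite EB Ej disj4 ?ltn_pmod // => /andP[-> Hdisj] /=.
case/hasP=> -[[[b' c'] d'] v'] Hin' /= /and4P[/eqP Eb /eqP Ec /eqP Ed Hle].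
rewrite -Ej EC ED !f_digit ?ltn_pmod // -Ec -Ed.
have Hlt : n' + j' < s by lia.
have := IH n' j' Hlt b' c' d' v' Hin'; rewrite Eb => /(_ Hdisj).
by lia.
Qed.

End Automaton.

(** For odd exponents, T_3 sends Delta^(3 N + 4 j) to terms Delta^(N + 4 j) with
    N = 2 n + 1 and C(N - 1 + j, j) odd. The two weights measure h and h + n_5. The lists
    are the reachable carries, with the best constants v. *)
Lemma T3_bound n j : disj (2 * n) j ->
  a3 (n + 2 * j) + a5 (n + 2 * j) < a3 (3 * n + 2 * j + 1) + a5 (3 * n + 2 * j + 1) /\
  a3 (n + 2 * j) + 2 * a5 (n + 2 * j) <
    a3 (3 * n + 2 * j + 1) + 2 * a5 (3 * n + 2 * j + 1).
Proof.
move=> Hd; split.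
  have /potential_bound/(_ n j 0 1 0 1) : valid_potential 1 2 3 2
    [:: (0, 0, 0, 0); (0, 1, 0, 1); (0, 1, 1, 0); (1, 1, 0, 1); (1, 2, 0, 1);
        (1, 2, 1, 0); (1, 3, 1, 1); (1, 3, 2, 1)] by vm_compute.
  by rewrite !addn0 !mul1n addn1; apply.
have /potential_bound/(_ n j 0 1 0 1) : valid_potential 2 2 3 2
  [:: (0, 0, 0, 0); (0, 1, 0, 1); (0, 1, 1, 0); (1, 1, 0, 1); (1, 2, 0, 2);
      (1, 2, 1, 1); (1, 3, 1, 2); (1, 3, 2, 1)] by vm_compute.
by rewrite !addn0 addn1; apply.
Qed.

(** Here the exponents are 5 N + 2 j and N + 2 j, with N = 2 n + 1 and
    C(3 N - 1 + j, j) odd. *)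
Lemma T5_bound n j : disj (6 * n + 2) j ->
  a3 (n + j) + a5 (n + j) < a3 (5 * n + j + 2) + a5 (5 * n + j + 2) /\
  a3 (n + j) + 2 * a5 (n + j) + 2 <= a3 (5 * n + j + 2) + 2 * a5 (5 * n + j + 2).
Proof.
move=> Hd; split.
  have /potential_bound/(_ n j 2 2 0 1) : valid_potential 1 6 5 1
    [:: (0, 0, 0, 0); (1, 0, 0, 0); (1, 1, 0, 1); (1, 1, 1, 0); (2, 1, 0, 0);
        (2, 2, 0, 1); (2, 2, 1, 0); (3, 2, 0, 1); (3, 3, 0, 1); (3, 3, 1, 1);
        (4, 3, 0, 1); (4, 3, 1, 1); (4, 4, 0, 2); (4, 4, 1, 1); (5, 4, 0, 2);
        (5, 4, 1, 1); (5, 5, 1, 2)] by vm_compute.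
  by rewrite !addn0 !mul1n addn1; apply.
have /potential_bound/(_ n j 2 2 0 2) : valid_potential 2 6 5 1
  [:: (0, 0, 0, 0); (1, 0, 0, 0); (1, 1, 0, 1); (1, 1, 1, 0); (2, 1, 0, 1);
      (2, 2, 0, 2); (2, 2, 1, 1); (3, 2, 0, 2); (3, 3, 0, 3); (3, 3, 1, 2);
      (4, 3, 0, 1); (4, 3, 1, 0); (4, 4, 0, 2); (4, 4, 1, 1); (5, 4, 0, 2);
      (5, 4, 1, 1); (5, 5, 1, 2)] by vm_compute.
by rewrite !addn0 !mul1n; apply.
Qed.

(** The predecessor is found on the lowest nonzero digit of x, which is 1: the digit 1
    is replaced by 0 using n = 0, and each lower digit 0 of x becomes 1 in n + 2 j. *)
Lemma T3_leading x : a5 x = 0 -> 0 < a3 x ->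
  exists n j, [/\ x = 3 * n + 2 * j + 1, disj (2 * n) j,
    a3 (n + 2 * j) + 1 = a3 x & a5 (n + 2 * j) = 0].
Proof.
elim/base4_ind: x => [|x r Hr Hx IH]; first by rewrite a3_0.
rewrite a3_digit // a5_digit // => H5 H3.
case: r Hr Hx H5 H3 => [|[|[|[|//]]]] _ Hx /= H5 H3; try lia.
  have [] := IH; try lia.
  move=> n [j] [Ex Hd E3 E5]; exists (4 * n + 1), (4 * j).
  have -> : 4 * n + 1 + 2 * (4 * j) = 4 * (n + 2 * j) + 1 by lia.
  rewrite a3_digit // a5_digit // E5; split=> //=; try lia.
  have -> : 2 * (4 * n + 1) = 4 * (2 * n) + 2 by lia.
  by rewrite -[4 * j]addn0 disj4 ?disj0.
exists 0, (2 * x); have -> : 0 + 2 * (2 * x) = 4 * x + 0 by lia.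
by rewrite muln0 disj0l a3_digit // a5_digit //=; split=> //; lia.
Qed.

(** Likewise on the lowest digit r >= 2 of x, which becomes r - 2 using n = 0; each lower
    digit r < 2 becomes r + 2 in n + j. *)
Lemma T5_leading x : 0 < a5 x ->
  exists n j, [/\ x = 5 * n + j + 2, disj (6 * n + 2) j,
    a3 (n + j) = a3 x & a5 (n + j) + 1 = a5 x].
Proof.
elim/base4_ind: x => [|x r Hr Hx IH]; first by rewrite a5_0.
rewrite a3_digit // a5_digit // => H5.
have [lt|ge] := ltnP r 2.
  have [] := IH; try lia.
  move=> n [j] [Ex Hd E3 E5]; exists (4 * n + 1), (4 * j + (r + 1)).
  have -> : 4 * n + 1 + (4 * j + (r + 1)) = 4 * (n + j) + (r + 2) by lia.
  rewrite a3_digit ?a5_digit; try lia.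
  have -> : 6 * (4 * n + 1) + 2 = 4 * (6 * n + 2) + 0 by lia.
  by rewrite disj4 ?disj0l; [split=> //; lia | | lia].
exists 0, (4 * x + (r - 2)); rewrite add0n a3_digit ?a5_digit; try lia.
have -> : 6 * 0 + 2 = 4 * 0 + 2 by [].
rewrite disj4; try lia.
rewrite disj0l andbT; split; try lia.
by case: r Hr ge {Hx H5} => [|[|[|[|]]]].
Qed.

(** * Closed forms for T_3 and T_5 *)

(** The coefficient of Delta ^ (k - 2 N) in T_3 Delta ^ k, for N = i + 1. *)
Definition coef3 k i : bool :=
  [&& 3 * i.+1 <= k, 4 %| k - 3 * i.+1 & disj i ((k - 3 * i.+1) %/ 4)].

(** The coefficient of Delta ^ (k - 4 N) in T_5 Delta ^ k, for N = i + 1. *)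
Definition coef5 k i : bool :=
  [&& 5 * i.+1 <= k, 2 %| k - 5 * i.+1 & disj (3 * i + 2) ((k - 5 * i.+1) %/ 2)].

Lemma coef3E i j : coef3 (3 * i.+1 + 4 * j) i = disj i j.
Proof. by rewrite /coef3 leq_addr addKn dvdn_mulr // mulKn. Qed.

Lemma coef3_out k i : (forall j, k <> 3 * i.+1 + 4 * j) -> coef3 k i = false.
Proof.
move=> H; apply/negP => /and3P[le /dvdnP[j Ej] _]; apply: (H j).
by rewrite -(subnKC le) Ej (mulnC j).
Qed.

Lemma coef5E i j : coef5 (5 * i.+1 + 2 * j) i = disj (3 * i + 2) j.
Proof. by rewrite /coef5 leq_addr addKn dvdn_mulr // mulKn. Qed.

Lemma coef5_out k i : (forall j, k <> 5 * i.+1 + 2 * j) -> coef5 k i = false.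
Proof.
move=> H; apply/negP => /and3P[le /dvdnP[j Ej] _]; apply: (H j).
by rewrite -(subnKC le) Ej (mulnC j).
Qed.

Lemma coef3_rec0 k : coef3 (k + 4) 0 = coef3 k 0.
Proof.
have [/andP[le /dvdnP[j Ej]]|H] := boolP ((3 <= k) && (4 %| k - 3)).
  have -> : k = 3 * 1 + 4 * j by lia.
  by rewrite -addnA -mulnSr !coef3E !disj0l.
rewrite !coef3_out // => j Ej; apply/negP: H; rewrite negbK.
  by apply/andP; split; [|apply/dvdnP; exists j]; lia.
by apply/andP; split; [|apply/dvdnP; exists j.-1]; lia.
Qed.

Lemma coef3_rec k i : coef3 (k + 4) i.+1 = coef3 k i.+1 (+) coef3 (k + 1) i.
Proof.
have [/andP[le /dvdnP[j Ej]]|H] := boolP ((3 * i.+2 <= k + 4) && (4 %| k + 4 - 3 * i.+2)).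
  have Ek : k + 4 = 3 * i.+2 + 4 * j by lia.
  have Ek1 : k + 1 = 3 * i.+1 + 4 * j by lia.
  rewrite Ek Ek1 !coef3E; case: j Ej Ek Ek1 => [|j] Ej Ek Ek1.
    by rewrite !disj0 coef3_out // => j; lia.
  have -> : k = 3 * i.+2 + 4 * j by lia.
  by rewrite coef3E disj_pascal addbC.
have N j : k + 4 <> 3 * i.+2 + 4 * j.
  move=> E; apply/negP: H; rewrite negbK E leq_addr addKn; exact: dvdn_mulr.
rewrite !coef3_out // => j E; first by apply: (N j); lia.
by apply: (N j.+1); lia.
Qed.

Ltac case_disj := repeat match goal with |- context [disj ?i ?j] => case: (disj i j) end.

(** Pascal's rule applied three times, as (1 + y)^3 = 1 + y + y^2 + y^3 modulo 2. *)
Lemma disj_triple a j : disj a.+3 j.+3 (+) disj a.+3 j.+2 (+) disj a.+3 j.+1 (+) disj a.+3 j =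
  disj a j.+3.
Proof.
have -> : disj a j.+3 = disj a.+1 j.+3 (+) disj a.+1 j.+2.
  by rewrite [disj a.+1 j.+3]disj_pascal addbK.
rewrite ![disj a.+3 _.+1]disj_pascal ![disj a.+2 _.+1]disj_pascal.
by case_disj.
Qed.

Lemma coef5_rec0 k : coef5 (k + 6) 0 = coef5 (k + 4) 0 (+) coef5 (k + 2) 0 (+) coef5 k 0.
Proof.
have [/andP[le /dvdnP[j Ej]]|H] := boolP ((5 <= k + 6) && (2 %| k + 6 - 5)).
  have -> : k + 6 = 5 * 1 + 2 * j by lia.
  case: j Ej => [|[|[|j]]] Ej; first by lia.
  - have -> : k + 4 = 5 * 1 + 2 * 0 by lia.
    by rewrite !coef5E !coef5_out // => j; lia.
  - have -> : k + 4 = 5 * 1 + 2 * 1 by lia.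
    have -> : k + 2 = 5 * 1 + 2 * 0 by lia.
    by rewrite !coef5E !coef5_out // => j; lia.
  have -> : k + 4 = 5 * 1 + 2 * j.+2 by lia.
  have -> : k + 2 = 5 * 1 + 2 * j.+1 by lia.
  have -> : k = 5 * 1 + 2 * j by lia.
  rewrite !coef5E !(disj_pascal 1) !(disj_pascal 0) !disj0l.
  by case_disj.
have N j : k + 6 <> 5 * 1 + 2 * j.
  by move=> E; apply/negP: H; rewrite negbK E addKn; apply/andP; split; [lia | exact: dvdn_mulr].
rewrite !coef5_out // => j E; first by apply: (N j.+3); lia.
  by apply: (N j.+2); lia.
by apply: (N j.+1); lia.
Qed.

Lemma coef5_rec k i : coef5 (k + 6) i.+1 =
  coef5 (k + 4) i.+1 (+) coef5 (k + 2) i.+1 (+) coef5 k i.+1 (+) coef5 (k + 1) i.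
Proof.
have Ea : 3 * i.+1 + 2 = (3 * i + 2).+3 by lia.
have [/andP[le /dvdnP[j Ej]]|H] := boolP ((5 * i.+2 <= k + 6) && (2 %| k + 6 - 5 * i.+2)).
  have Ek : k + 6 = 5 * i.+2 + 2 * j by lia.
  have Ek1 : k + 1 = 5 * i.+1 + 2 * j by lia.
  rewrite Ek Ek1 !coef5E Ea; case: j Ej Ek Ek1 => [|[|[|j]]] Ej Ek Ek1.
  - by rewrite !disj0 !coef5_out // => j; lia.
  - have -> : k + 4 = 5 * i.+2 + 2 * 0 by lia.
    rewrite coef5E Ea ![in LHS]disj_pascal !disj0 !coef5_out // => [|j|j]; lia.
  - have -> : k + 4 = 5 * i.+2 + 2 * 1 by lia.
    have -> : k + 2 = 5 * i.+2 + 2 * 0 by lia.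
    rewrite !coef5E Ea ![disj _.+3 _.+1]disj_pascal ![disj _.+2 _.+1]disj_pascal
      ![disj _.+1 _.+1]disj_pascal !disj0 !coef5_out // => [|j]; lia.
  have -> : k + 4 = 5 * i.+2 + 2 * j.+2 by lia.
  have -> : k + 2 = 5 * i.+2 + 2 * j.+1 by lia.
  have -> : k = 5 * i.+2 + 2 * j by lia.
  by rewrite !coef5E Ea -(disj_triple (3 * i + 2) j); case_disj.
have N j : k + 6 <> 5 * i.+2 + 2 * j.
  by move=> E; apply/negP: H; rewrite negbK E leq_addr addKn; exact: dvdn_mulr.
rewrite !coef5_out // => j E.
- by apply: (N j); lia.
- by apply: (N j.+3); lia.
- by apply: (N j.+2); lia.
- by apply: (N j.+1); lia.
Qed.

Local Open Scope ring_scope.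

Lemma psDD (f : pseries 'F_2) : f + f = 0.
Proof. by apply: funext => n; rewrite psD ps0; case: (F2P (f n)) => ->; apply: val_inj. Qed.

Lemma ps_sum_recl (F : nat -> pseries 'F_2) B :
  \sum_(i < B.+1) F i = F 0%N + \sum_(i < B) F i.+1.
Proof. by rewrite big_ord_recl. Qed.

Definition term3 k i : pseries 'F_2 :=
  if coef3 k i then DeltaS ^+ (k - 2 * i.+1) else 0.

Lemma term3_rec0 k : term3 (k + 4) 0 = DeltaS ^+ 4 * term3 k 0.
Proof.
rewrite /term3 coef3_rec0; case: ifP => [/and3P[le _ _]|_]; last by rewrite mulr0.
by rewrite -exprD; congr (_ ^+ _); lia.
Qed.

Lemma term3_rec k i :
  term3 (k + 4) i.+1 = DeltaS ^+ 4 * term3 k i.+1 + DeltaS * term3 (k + 1) i.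
Proof.
rewrite /term3 coef3_rec; have E1 : coef3 (k + 1) i ->
    DeltaS * DeltaS ^+ (k + 1 - 2 * i.+1) = DeltaS ^+ (k + 4 - 2 * i.+2).
  by move/and3P=> [le _ _]; rewrite -exprS; congr (_ ^+ _); lia.
have E2 : coef3 k i.+1 ->
    DeltaS ^+ 4 * DeltaS ^+ (k - 2 * i.+2) = DeltaS ^+ (k + 4 - 2 * i.+2).
  by move/and3P=> [le _ _]; rewrite -exprD; congr (_ ^+ _); lia.
case: (coef3 k i.+1) E2 => [->|_] //; case: (coef3 (k + 1) i) E1 => [->|_] //=;
  by rewrite ?mulr0 ?addr0 ?add0r ?psDD.
Qed.

(** The generating series of the T_3 Delta^k is
    Delta X^3 / (1 + Delta X^3 + Delta^4 X^4), and the closed form is its expansion in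
    powers of Delta X^3 + Delta^4 X^4. Any bound B > k includes all the nonzero terms. *)
Lemma hecke3_power k B : (k < B)%N ->
  (hecke 3 (DeltaS ^+ k) : pseries 'F_2) = \sum_(i < B) term3 k i.
Proof.
have [low step] := hecke3_facts.
elim/ltn_ind: k B => k IH [//|B] lt; have [le|gt] := leqP k 3.
  rewrite low // ps_sum_recl big1 => [|i _]; last by rewrite /term3 /coef3 ifN //; lia.
  rewrite addr0 /term3 /coef3; case: eqP => [->|ne] /=; first by rewrite expr1.
  by rewrite ifN //; lia.
have Ek : k = (k - 4 + 4)%N by lia.
move: (k - 4)%N Ek => n Ek; rewrite {k}Ek in IH lt gt *.
rewrite step addn0 (IH (n + 1)%N _ B) ?(IH n _ B.+1); try lia.
rewrite !(ps_sum_recl (term3 _)) term3_rec0 (eq_bigr _ (fun (i : 'I_B) _ => term3_rec n i)).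
rewrite big_split /= -!mulr_sumr; ring.
Qed.

Definition term5 k i : pseries 'F_2 :=
  if coef5 k i then DeltaS ^+ (k - 4 * i.+1) else 0.

Lemma ps_if_addb3 (a b c : bool) (x y z w : pseries 'F_2) : (a -> x = w) -> (b -> y = w) ->
  (c -> z = w) -> (if a (+) b (+) c then w else 0) =
  (if a then x else 0) + ((if b then y else 0) + (if c then z else 0)).
Proof.
case: a => [->|_] //; case: b => [->|_] //; case: c => [->|_] //=;
  by rewrite ?addr0 ?add0r ?psDD ?addr0.
Qed.

Lemma ps_mul_if (b : bool) (x y : pseries 'F_2) :
  x * (if b then y else 0) = if b then x * y else 0.
Proof. by case: b; rewrite ?mulr0. Qed.

Lemma term5_rec0 k : term5 (k + 6) 0 = DeltaS ^+ 2 * term5 (k + 4) 0 +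
  (DeltaS ^+ 4 * term5 (k + 2) 0 + DeltaS ^+ 6 * term5 k 0).
Proof.
rewrite /term5 coef5_rec0 !ps_mul_if -!exprD; apply: ps_if_addb3 => /and3P[le _ _];
  by congr (_ ^+ _); lia.
Qed.

Lemma term5_rec k i : term5 (k + 6) i.+1 = DeltaS ^+ 2 * term5 (k + 4) i.+1 +
  (DeltaS ^+ 4 * term5 (k + 2) i.+1 + DeltaS ^+ 6 * term5 k i.+1) +
  DeltaS * term5 (k + 1) i.
Proof.
have addb2 (a b : bool) (w x y : pseries 'F_2) : (if a then w else 0) = x ->
    (b -> y = w) -> (if a (+) b then w else 0) = x + (if b then y else 0).
  by move=> <-; case: b => [->|_] //; case: a; rewrite /= ?addr0 ?add0r ?psDD.
rewrite /term5 coef5_rec [in X in _ + X]ps_mul_if -exprS; apply: addb2.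
  rewrite !ps_mul_if -!exprD; apply: ps_if_addb3 => /and3P[le _ _];
    by congr (_ ^+ _); lia.
by move=> /and3P[le _ _]; congr (_ ^+ _); lia.
Qed.

(** With y = Delta^2 X^2, the generating series is
    Delta X^5 / ((1 + y)^3 + Delta X^5), expanded in powers of Delta X^5 / (1 + y)^3. *)
Lemma hecke5_power k B : (k < B)%N ->
  (hecke 5 (DeltaS ^+ k) : pseries 'F_2) = \sum_(i < B) term5 k i.
Proof.
have [low step] := hecke5_facts.
elim/ltn_ind: k B => k IH [//|B] lt; have [le|gt] := leqP k 5.
  rewrite low // ps_sum_recl big1 => [|i _]; last by rewrite /term5 /coef5 ifN //; lia.
  rewrite addr0 /term5 /coef5; case: eqP => [->|ne] /=; first by rewrite expr1.
  by rewrite ifN //; lia.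
have Ek : k = (k - 6 + 6)%N by lia.
move: (k - 6)%N Ek => n Ek; rewrite {k}Ek in IH lt gt *.
rewrite step addn0 (IH (n + 1)%N _ B) ?(IH n _ B.+1) ?(IH (n + 2)%N _ B.+1)
  ?(IH (n + 4)%N _ B.+1); try lia.
rewrite !(ps_sum_recl (term5 _)) term5_rec0 (eq_bigr _ (fun (i : 'I_B) _ => term5_rec n i)).
rewrite 3!big_split /= -!mulr_sumr; ring.
Qed.

(** * General properties of the Hecke operators *)

(** The operators on the ring of power series, where sums make sense. *)
Definition Hecke (p : nat) (f : pseries 'F_2) : pseries 'F_2 := hecke p f.

Lemma Hecke0 p : Hecke p 0 = 0.
Proof. by apply: funext => n; rewrite /Hecke /hecke !ps0 if_same addr0. Qed.

Lemma HeckeD p f g : Hecke p (f + g) = Hecke p f + Hecke p g.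
Proof.
apply: funext => n; rewrite psD /Hecke /hecke !psD; case: ifP => _; last by rewrite !addr0.
by rewrite addrACA.
Qed.

Lemma Hecke_sum p I (r : seq I) (F : I -> pseries 'F_2) :
  Hecke p (\sum_(i <- r) F i) = \sum_(i <- r) Hecke p (F i).
Proof. exact: (big_morph _ (HeckeD p) (Hecke0 p)). Qed.

Lemma HeckeC p q f : prime p -> prime q -> Hecke p (Hecke q f) = Hecke q (Hecke p f).
Proof.
have expand a b : prime a -> prime b -> a != b -> Hecke a (Hecke b f) = fun n =>
    f (a * b * n)%N + (if (b %| n)%N then f (a * (n %/ b))%N else 0) +
    ((if (a %| n)%N then f (b * (n %/ a))%N else 0) +
     (if (a * b %| n)%N then f (n %/ (a * b))%N else 0)).
  move=> pa pb ne; apply: funext => n; rewrite /Hecke /hecke.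
  rewrite mulnA [(b * a)%N]mulnC; congr (_ + _ + _).
    have cop : coprime b a by rewrite prime_coprime // dvdn_prime2 // eq_sym.
    by rewrite (Gauss_dvdr _ cop); case: ifP => // bn; rewrite muln_divA.
  have [/dvdnP[m ->]|na] := boolP (a %| n)%N; last first.
    rewrite ifN ?addr0 //; apply: contra na; apply: dvdn_trans; exact: dvdn_mulr.
  have a0 := prime_gt0 pa.
  by rewrite mulnK // [(m * a)%N]mulnC dvdn_pmul2l // divnMl.
move=> pp pq; have [->//|ne] := eqVneq p q.
rewrite (expand p q) // (expand q p) 1?eq_sym //; apply: funext => n.
by rewrite [(q * p)%N]mulnC addrACA.
Qed.

Lemma Delta_square s : odd s -> DeltaS (s ^ 2)%N = 1.
Proof.
move=> os; have Es : s = (s./2).*2.+1 by rewrite -[LHS]odd_double_half os.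
have lt : (s./2 < (s ^ 2).+1)%N by rewrite -mulnn; nia.
rewrite /DeltaS /Delta (bigD1 (Ordinal lt)) //= -Es eqxx big1 ?addr0 // => i ne.
rewrite eqn_exp2r // [X in _ == X]Es eqSS -!muln2 eqn_pmul2r //.
by rewrite (_ : (_ == _) = false) //; apply: negPf; rewrite -val_eqE in ne.
Qed.

Lemma Delta_nonsquare n : (forall s, odd s -> (s ^ 2)%N <> n) -> DeltaS n = 0.
Proof.
move=> H; rewrite /DeltaS /Delta big1 // => i _; case: eqP => // E.
by case: (H i.*2.+1) => //=; rewrite odd_double.
Qed.

(** The coefficient of q^n in Delta is 1 exactly for n an odd square: p n is a square
    only if p divides n, and p^2 m is one if and only if m is. *)
Lemma Hecke_Delta p : odd_prime p -> Hecke p DeltaS = 0.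
Proof.
case/andP=> pp op; have p0 := prime_gt0 pp; apply: funext => n.
have dvd_sq s m : (s ^ 2 = p * m)%N -> exists2 r, s = (p * r)%N & (m = p * r ^ 2)%N.
  move=> Es; have /dvdnP[r Er] : (p %| s)%N.
    by have := Euclid_dvdX s 2 pp; rewrite andbT => <-; rewrite Es dvdn_mulr.
  exists r; first by rewrite Er mulnC.
  by apply/eqP; rewrite -(eqn_pmul2l p0) -Es Er -!mulnn; apply/eqP; lia.
rewrite /Hecke /hecke ps0; have [/dvdnP[m ->]|dn] := boolP (p %| n)%N; last first.
  rewrite addr0 Delta_nonsquare // => s _ /dvd_sq[r _ En].
  by move: dn; rewrite En dvdn_mulr.
rewrite mulnK //; have [[s [os Es]]|H] := EM (exists s, odd s /\ (s ^ 2)%N = m).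
  rewrite -Es Delta_square //.
  have -> : (p * (s ^ 2 * p) = (p * s) ^ 2)%N by rewrite -!mulnn; lia.
  by rewrite Delta_square ?oddM ?op //; apply: val_inj.
rewrite !Delta_nonsquare ?addr0 // => s os Es; apply: H; first by exists s.
have [r Er Em] := dvd_sq _ _ Es; exists r; split.
  by move: os; rewrite Er oddM op.
by apply/eqP; rewrite -(eqn_pmul2r p0) Em mulnC.
Qed.

(** * The filtration by the height *)

Definition ht x := (a3 x + a5 x)%N.
(** Encodes the domination order on the exponents 2 x + 1 in one integer; the
    lexicographic order on (h, n_5) is respected since n_5 <= h. *)
Definition key x := (ht x * (ht x).+1 + a5 x)%N.

Lemma key_lt x y : (key y < key x)%N = ((ht y < ht x) || (ht y == ht x) && (a5 y < a5 x))%N.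
Proof.
rewrite /key; have : (a5 x <= ht x)%N /\ (a5 y <= ht y)%N by rewrite !leq_addl.
by case: (ltngtP (ht y) (ht x)) => [lt|lt|->] [lx ly] /=; [nia|nia|rewrite ltn_add2l].
Qed.

Lemma key_inj : injective key.
Proof.
move=> x y E; have : ~~ (key y < key x)%N && ~~ (key x < key y)%N by rewrite E ltnn.
rewrite !key_lt; have [lt|lt|Eh] := ltngtP (ht y) (ht x) => //=.
rewrite -!leqNgt -eqn_leq => /eqP E5; apply: a35_inj => //.
by move: Eh; rewrite /ht E5 => /addIn.
Qed.

Definition Dpow x : pseries 'F_2 := DeltaS ^+ x.*2.+1.

Definition span (P : pred nat) (f : pseries 'F_2) : Prop :=
  exists2 s : seq nat, all P s & f = \sum_(x <- s) Dpow x.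

Lemma span0 P : span P 0. Proof. by exists [::]; rewrite ?big_nil. Qed.

Lemma spanD P f g : span P f -> span P g -> span P (f + g).
Proof.
by case=> s Ps -> [t Pt ->]; exists (s ++ t); rewrite ?all_cat ?Ps // big_cat.
Qed.

Lemma span_Dpow (P : pred nat) x : P x -> span P (Dpow x).
Proof. by move=> Px; exists [:: x]; rewrite /= ?Px // big_seq1. Qed.

Lemma span_sub (P Q : pred nat) f : (forall x, P x -> Q x) -> span P f -> span Q f.
Proof. by move=> PQ [s Ps ->]; exists s => //; apply: sub_all Ps. Qed.

Lemma span_sum P I (r : seq I) (C : pred I) (F : I -> pseries 'F_2) :
  (forall i, C i -> span P (F i)) -> span P (\sum_(i <- r | C i) F i).
Proof.
by move=> H; apply: (big_ind (span P)) => //; [exact: span0 | move=> *; exact: spanD].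
Qed.

Lemma span_Hecke p (P Q : pred nat) f : (forall x, P x -> span Q (Hecke p (Dpow x))) ->
  span P f -> span Q (Hecke p f).
Proof.
move=> H [s /allP Ps ->]; rewrite Hecke_sum big_seq; apply: span_sum => x xs.
by apply/H/Ps.
Qed.

Lemma span_pred0 f : span pred0 f -> f = 0.
Proof. by case=> -[|//] _ ->; rewrite big_nil. Qed.

Lemma term3_odd x i : term3 x.*2.+1 i = 0 \/ exists n j, [/\ x = (3 * n + 2 * j + 1)%N,
  disj (2 * n) j, i = (2 * n)%N & term3 x.*2.+1 i = Dpow (n + 2 * j)].
Proof.
rewrite /term3 /coef3; case: and3P => [[le /dvdnP[j Ej]]|_]; last by left.
rewrite Ej mulnK // => dj; right; have Ei : i = (2 * i./2)%N by lia.
exists i./2, j; split => //; first by lia.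
  by rewrite -Ei.
by rewrite /Dpow; congr (_ ^+ _); lia.
Qed.

Lemma term3_even n j : disj (2 * n) j ->
  term3 (3 * n + 2 * j + 1).*2.+1 (2 * n) = Dpow (n + 2 * j).
Proof.
move=> dj; rewrite /term3 (_ : _.*2.+1 = 3 * (2 * n).+1 + 4 * j)%N; last by lia.
by rewrite coef3E dj /Dpow; congr (_ ^+ _); lia.
Qed.

Lemma span_Hecke3 x : span (fun y => (ht y < ht x) && (a3 y + 2 * a5 y < a3 x + 2 * a5 x))%N
  (Hecke 3 (Dpow x)).
Proof.
rewrite /Hecke /Dpow (hecke3_power (ltnSn _)); apply: span_sum => i _.
case: (term3_odd x i) => [->|[n [j [Ex dj _ ->]]]]; first exact: span0.
by apply: span_Dpow; rewrite Ex; have [-> ->] := T3_bound dj.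
Qed.

Lemma term5_odd x i : term5 x.*2.+1 i = 0 \/ exists n j, [/\ x = (5 * n + j + 2)%N,
  disj (6 * n + 2) j, i = (2 * n)%N & term5 x.*2.+1 i = Dpow (n + j)].
Proof.
rewrite /term5 /coef5; case: and3P => [[le /dvdnP[j Ej]]|_]; last by left.
rewrite Ej mulnK // => dj; right; have Ei : i = (2 * i./2)%N by lia.
exists i./2, j; split => //; first by lia.
  by rewrite (_ : 6 * _ = 3 * i)%N; last by lia.
by rewrite /Dpow; congr (_ ^+ _); lia.
Qed.

Lemma term5_even n j : disj (6 * n + 2) j ->
  term5 (5 * n + j + 2).*2.+1 (2 * n) = Dpow (n + j).
Proof.
move=> dj; rewrite /term5 (_ : _.*2.+1 = 5 * (2 * n).+1 + 2 * j)%N; last by lia.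
rewrite coef5E (_ : 3 * (2 * n) = 6 * n)%N; last by lia.
by rewrite dj /Dpow; congr (_ ^+ _); lia.
Qed.

Lemma span_Hecke5 x :
  span (fun y => (ht y < ht x) && (a3 y + 2 * a5 y + 2 <= a3 x + 2 * a5 x))%N
  (Hecke 5 (Dpow x)).
Proof.
rewrite /Hecke /Dpow (hecke5_power (ltnSn _)); apply: span_sum => i _.
case: (term5_odd x i) => [->|[n [j [Ex dj _ ->]]]]; first exact: span0.
by apply: span_Dpow; rewrite Ex; have [-> ->] := T5_bound dj.
Qed.

(** * Dominant exponents *)

Definition lead x (f : pseries 'F_2) : Prop :=
  exists2 r, span (fun y => (key y < key x)%N) r & f = Dpow x + r.

(** Among the terms of T_3 Delta^(2 x + 1), those of height h(x) - 1 have n_5 <= 0 by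
    the second bound of T3_bound: there is only one, given by T3_leading. *)
Lemma lead_Hecke3 x f : a5 x = 0%N -> (0 < a3 x)%N -> lead x f ->
  exists x', [/\ (a3 x').+1 = a3 x, a5 x' = 0%N & lead x' (Hecke 3 f)].
Proof.
move=> x5 x3 [r Hr ->]; have [n [j [Ex dj E3 E5]]] := T3_leading x5 x3.
rewrite addn1 in E3; set x' := (n + 2 * j)%N in E3 E5; exists x'; split=> //.
have lt : (2 * n < x.*2.+2)%N by lia.
have Et : term3 x.*2.+1 (2 * n) = Dpow x' by rewrite Ex term3_even.
exists (\sum_(i < x.*2.+2 | i != Ordinal lt) term3 x.*2.+1 i + Hecke 3 r); last first.
  rewrite HeckeD [RHS]addrA; congr (_ + Hecke _ _).
  have -> : Hecke 3 (Dpow x) = \sum_(i < x.*2.+2) term3 x.*2.+1 i := hecke3_power (ltnSn _).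
  by rewrite (bigD1 (Ordinal lt)) //= Et.
apply: spanD.
  apply: span_sum => i ne; case: (term3_odd x i) => [->|[n1 [j1 [Ex1 dj1 Ei ->]]]].
    exact: span0.
  apply: span_Dpow; rewrite key_lt; have [] := T3_bound dj1; rewrite -Ex1 x5.
  set y := (n1 + 2 * j1)%N => lt1 lt2.
  have : y <> x'.
    move=> Ey; move: ne; rewrite -val_eqE /= Ei; apply/negP; rewrite negbK eqn_pmul2l //.
    by apply/eqP; move: Ey; rewrite /y /x'; lia.
  move=> nyx; rewrite /ht E5.
  have [y5|y5] := posnP (a5 y); last by lia.
  have : a3 y <> a3 x' by move=> Ey; apply: nyx; apply: a35_inj => //; rewrite E5.
  lia.
apply: span_Hecke Hr => y; rewrite key_lt x5 ltn0 andbF orbF => lty.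
apply: span_sub (span_Hecke3 y) => z /andP[ltz _]; rewrite key_lt; apply/orP; left.
move: lty ltz; rewrite /ht E5 x5; lia.
Qed.

(** The terms of height h(x) - 1 have n_5 <= n_5(x) - 1 by the second bound of T5_bound,
    with equality only for the one given by T5_leading. *)
Lemma lead_Hecke5 x f : (0 < a5 x)%N -> lead x f ->
  exists x', [/\ a3 x' = a3 x, (a5 x').+1 = a5 x & lead x' (Hecke 5 f)].
Proof.
move=> x5 [r Hr ->]; have [n [j [Ex dj E3 E5]]] := T5_leading x5.
rewrite addn1 in E5; set x' := (n + j)%N in E3 E5; exists x'; split=> //.
have lt : (2 * n < x.*2.+2)%N by lia.
have Et : term5 x.*2.+1 (2 * n) = Dpow x' by rewrite Ex term5_even.
exists (\sum_(i < x.*2.+2 | i != Ordinal lt) term5 x.*2.+1 i + Hecke 5 r); last first.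
  rewrite HeckeD [RHS]addrA; congr (_ + Hecke _ _).
  have -> : Hecke 5 (Dpow x) = \sum_(i < x.*2.+2) term5 x.*2.+1 i := hecke5_power (ltnSn _).
  by rewrite (bigD1 (Ordinal lt)) //= Et.
apply: spanD.
  apply: span_sum => i ne; case: (term5_odd x i) => [->|[n1 [j1 [Ex1 dj1 Ei ->]]]].
    exact: span0.
  apply: span_Dpow; rewrite key_lt; have [] := T5_bound dj1; rewrite -Ex1.
  set y := (n1 + j1)%N => lt1 lt2.
  have : y <> x'.
    move=> Ey; move: ne; rewrite -val_eqE /= Ei; apply/negP; rewrite negbK eqn_pmul2l //.
    by apply/eqP; move: Ey; rewrite /y /x'; lia.
  move=> nyx; rewrite /ht.
  have [E|ne5] := eqVneq (a5 y) (a5 x'); last by lia.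
  have : a3 y <> a3 x' by move=> Ey; apply: nyx; apply: a35_inj.
  lia.
apply: span_Hecke Hr => y; rewrite key_lt => lty.
apply: span_sub (span_Hecke5 y) => z; rewrite key_lt; move: lty; rewrite /ht; lia.
Qed.

Lemma lead_ht0 x f : ht x = 0%N -> lead x f -> f = DeltaS.
Proof.
move=> x0 [r Hr ->]; have Ex : x = 0%N.
  by apply: a35_inj; rewrite ?a3_0 ?a5_0; move: x0; rewrite /ht; lia.
have -> : r = 0.
  apply: span_pred0; apply: span_sub Hr => y; rewrite key_lt Ex /ht a3_0 a5_0.
  by rewrite !ltn0 andbF.
by rewrite addr0 Ex /Dpow expr1.
Qed.

Lemma iter_lead x f : lead x f -> iter (a3 x) (Hecke 3) (iter (a5 x) (Hecke 5) f) = DeltaS.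
Proof.
move En : (a5 x) => n; elim: n x En f => [|n IH] x En f Lf; last first.
  have x5 : (0 < a5 x)%N by rewrite En.
  have [x' [E3 E5 L']] := lead_Hecke5 x5 Lf.
  by rewrite iterSr -E3; apply: IH => //; lia.
rewrite /=; move Em : (a3 x) => m; elim: m x Em En f Lf => [|m IH] x Em En f Lf.
  by apply: lead_ht0 Lf; rewrite /ht En Em.
have x3 : (0 < a3 x)%N by rewrite Em.
have [x' [E3 E5 L']] := lead_Hecke3 En x3 Lf.
by rewrite iterSr; apply: (IH x') => //; lia.
Qed.

(** * The height drops under every T_p *)

Lemma evS_sum (P : {poly 'F_2}) :
  evS P = \sum_(i < size P | P`_i != 0) DeltaS ^+ i.
Proof.
rewrite -[P in LHS]coefK poly_def rmorph_sum [RHS]big_mkcond /=; apply: eq_bigr => i _.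
case: (F2P P`_i) => ->; first by rewrite scale0r rmorph0 eqxx.
by rewrite scale1r rmorphXn /= evS_X.
Qed.

(** The series whose exponents are all odd, or all even, according to b. *)
Definition supp_parity b (f : pseries 'F_2) : Prop := forall n, odd n != b -> f n = 0.

Lemma supp_parityD b f g : supp_parity b f -> supp_parity b g -> supp_parity b (f + g).
Proof. by move=> Hf Hg n ob; rewrite psD Hf // Hg // addr0. Qed.

Lemma supp_parity_sum b I (r : seq I) (C : pred I) (F : I -> pseries 'F_2) :
  (forall i, C i -> supp_parity b (F i)) -> supp_parity b (\sum_(i <- r | C i) F i).
Proof.
by move=> H; apply: (big_ind (supp_parity b)) => //; move=> *; exact: supp_parityD.
Qed.

Lemma supp_parityN b f : supp_parity b (- f) <-> supp_parity b f.
Proof. by have -> : - f = f by apply/eqP; rewrite eq_sym -subr_eq0 opprK psDD. Qed.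

(** All the exponents in Delta are odd squares. *)
Lemma Delta_parity i : supp_parity (odd i) (DeltaS ^+ i).
Proof.
have ev m : supp_parity false (DeltaS ^+ m.*2).
  by move=> n on; rewrite -muln2 exprM sqr_ps; case: (odd n) on.
rewrite -[i in DeltaS ^+ i]odd_double_half; case: (odd i); last exact: ev.
rewrite exprS => n on; rewrite psM big1 // => j _.
have [oj|ej] := boolP (odd j).
  by rewrite ev ?mulr0 //; move: (ltn_ord j) oj on; lia.
rewrite Delta_nonsquare ?mul0r // => s os Es; move: ej; rewrite -Es oddX os //.
Qed.

Lemma Hecke_parity p f : odd p -> supp_parity true f -> supp_parity true (Hecke p f).
Proof.
move=> op Hf n on; rewrite /Hecke /hecke Hf ?oddM ?op //.
case: ifP => [/dvdnP[m En]|_]; last by rewrite addr0.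
rewrite add0r Hf //; rewrite En mulnK; last by case: (p) op.
by move: on; rewrite En oddM op andbT.
Qed.

(** The even powers in the polynomial T_p Delta^k have even exponents in q, whereas T_p
    preserves the series with odd exponents; so their sum is 0. *)
Lemma span_Hecke_odd p f : odd_prime p -> span xpredT f -> span xpredT (Hecke p f).
Proof.
move=> pp; apply: span_Hecke => x _; have [P HP] := hecke_Delta_power x.*2.+1 pp.
have op : odd p by case/andP: pp.
have EP : Hecke p (Dpow x) = evS P by rewrite evSE -HP qexpE.
set A := \sum_(i < size P | (P`_i != 0) && odd i) DeltaS ^+ i.
set B := \sum_(i < size P | (P`_i != 0) && ~~ odd i) DeltaS ^+ i.
have EAB : Hecke p (Dpow x) = A + B by rewrite EP evS_sum (bigID (fun i : 'I__ => odd i)).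
have HA : supp_parity true A.
  by apply: supp_parity_sum => i /andP[_ oi]; have := @Delta_parity i; rewrite oi.
have HB : supp_parity false B.
  by apply: supp_parity_sum => i /andP[_ oi]; have := @Delta_parity i; rewrite (negPf oi).
have HB' : supp_parity true B.
  have -> : B = Hecke p (Dpow x) - A by rewrite EAB addrC addKr.
  apply: supp_parityD; last by apply/supp_parityN.
  apply: Hecke_parity => //; have := @Delta_parity x.*2.+1.
  by rewrite /= odd_double.
have B0 : B = 0.
  by apply: funext => n; case on : (odd n); [apply: HB | apply: HB']; rewrite on.
rewrite EAB B0 addr0; apply: span_sum => i /andP[_ oi].
by rewrite -[nat_of_ord i]odd_double_half oi; apply: span_Dpow.
Qed.

Lemma max_key (s : seq nat) : s != [::] ->
  exists2 x, x \in s & forall y, y \in s -> (key y <= key x)%N.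
Proof.
elim: s => // x [|x' s] IH _.
  by exists x; rewrite ?mem_head // => y; rewrite inE => /eqP->.
have [z zs Hz] := IH isT; have [le|lt] := leqP (key x) (key z).
  exists z; first by rewrite inE zs orbT.
  by move=> y; rewrite inE => /predU1P[->|/Hz].
exists x; rewrite ?mem_head // => y; rewrite inE => /predU1P[->//|/Hz le].
exact: leq_trans le (ltnW lt).
Qed.

(** A repeated exponent of maximal key cancels with its copy, until the maximal one
    occurs only once. *)
Lemma span_lead P f : span P f -> f <> 0 -> exists2 x, P x & lead x f.
Proof.
case=> s; have [n] := ubnP (size s); elim: n s => // n IH s lt Ps Ef nf.
have [s0|ns] := eqVneq s [::]; first by case: nf; rewrite Ef s0 big_nil.
have [x xs Hx] := max_key ns; have px := perm_to_rem xs.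
have {}Ef : f = Dpow x + \sum_(y <- rem x s) Dpow y.
  by rewrite Ef (perm_big _ px) big_cons.
have [xr|nx] := boolP (x \in rem x s).
  apply: (IH (rem x (rem x s))) => //.
  - by move: lt; rewrite (perm_size px) /= (perm_size (perm_to_rem xr)) /=; lia.
  - by apply/allP => y /mem_rem/mem_rem; apply: (allP Ps).
  - by rewrite Ef (perm_big _ (perm_to_rem xr)) big_cons addrA psDD add0r.
exists x; first exact: (allP Ps).
exists (\sum_(y <- rem x s) Dpow y) => //; exists (rem x s) => //.
apply/allP => y yr; rewrite ltn_neqAle Hx ?(mem_rem yr) // andbT.
by apply: contraNneq nx => /key_inj E; rewrite -{1}E.
Qed.

Notation height_lt g := (span (fun y => ht y < g)%N).

Lemma height_iter p a g f : p \in [:: 3; 5]%N -> height_lt (a + g) f ->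
  height_lt g (iter a (Hecke p) f).
Proof.
move=> p35; elim: a f => [|a IH] f Hf //; rewrite iterSr; apply: IH.
apply: span_Hecke Hf => x; rewrite addSn ltnS => lt.
move: p35; rewrite !inE => /orP[] /eqP->.
  by apply: span_sub (span_Hecke3 x) => y /andP[lt' _]; apply: leq_trans lt' lt.
by apply: span_sub (span_Hecke5 x) => y /andP[lt' _]; apply: leq_trans lt' lt.
Qed.

Lemma Hecke_iter p q a f : prime p -> prime q ->
  Hecke p (iter a (Hecke q) f) = iter a (Hecke q) (Hecke p f).
Proof. by move=> pp pq; elim: a f => //= a IH f; rewrite HeckeC // IH. Qed.

Lemma DeltaS_neq0 : DeltaS <> 0.
Proof. by move/(congr1 (fun f : pseries 'F_2 => f 1%N)); rewrite Delta1 ps0. Qed.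

(** If T_p f had a dominant exponent x of height at least g, the a3 x + a5 x operators
    of iter_lead would send T_p f to Delta and f to some w of height 0. Then w is 0 or
    Delta, so that T_p w = 0, whereas T_p w = Delta by commutation. *)
Lemma Hecke_height p g f : odd_prime p -> height_lt g.+1 f -> height_lt g (Hecke p f).
Proof.
move=> pp Hf; have p_prime : prime p by case/andP: pp.
have spT : span xpredT (Hecke p f) by apply: span_Hecke_odd pp _; apply: span_sub Hf.
have [->|nz] := EM (Hecke p f = 0); first exact: span0.
have [x _ Lx] := span_lead spT nz.
have [lt|ge] := ltnP (ht x) g.
  case: Lx => r Hr ->; apply: spanD; first exact: span_Dpow.
  by apply: span_sub Hr => y; rewrite key_lt => /orP[/ltn_trans|/andP[/eqP-> _]]; auto.
exfalso; have := iter_lead Lx; rewrite -Hecke_iter // -Hecke_iter //.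
set w := iter _ _ _ => Ew.
have Hw : height_lt 1 w.
  apply: height_iter => //; apply: height_iter => //.
  apply: span_sub Hf => y /leq_trans; apply; move: ge; rewrite /ht; lia.
have [w0|wn] := EM (w = 0); first by move: Ew; rewrite w0 Hecke0 => /esym/DeltaS_neq0.
have [z z0 Lz] := span_lead Hw wn.
have Ew' : w = DeltaS by apply: lead_ht0 Lz; move: z0; rewrite ltnS leqn0 => /eqP.
by move: Ew; rewrite Ew' Hecke_Delta // => /esym/DeltaS_neq0.
Qed.

Lemma foldr_height ps g f : all odd_prime ps -> height_lt (size ps + g) f ->
  height_lt g (foldr Hecke f ps).
Proof.
elim: ps g => //= p ps IH g /andP[pp Pps] Hf; apply: Hecke_height => //.
by apply: IH => //; rewrite addnS.
Qed.

Lemma decomposition_lead (f : pseries 'F_2) m ms : decomposition f (m :: ms) ->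
  lead m./2 f.
Proof.
case=> odds srt Ef; have dom_key a b : odd a -> odd b ->
    dominates a b = (key b./2 < key a./2)%N.
  move=> oa ob; rewrite key_lt /ht /a3 /a5.
  have E c : odd c -> (c./2).*2.+1 = c by move=> oc; rewrite -[RHS]odd_double_half oc.
  by rewrite !E.
have /andP[om oms] := odds.
have Hms : all (fun c => key c./2 < key m./2)%N ms.
  have {}srt : path (fun a b => key b./2 < key a./2)%N m ms.
    move: srt => /=; clear Ef; elim: ms m om oms odds => //= a s IH m om /andP[oa os] _.
    by case/andP=> d1 d2; rewrite -dom_key // d1 IH // oa.
  by apply: order_path_min srt => a b c lab lbc; apply: ltn_trans lbc lab.
have Edpow c : odd c -> (qexp Delta c : pseries 'F_2) = Dpow c./2.
  by move=> oc; rewrite qexpE /Dpow; congr (_ ^+ _); rewrite -[LHS]odd_double_half oc.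
exists (\sum_(c <- ms) Dpow c./2).
  rewrite big_seq; apply: span_sum => c cs; apply: span_Dpow.
  exact: (allP Hms).
apply: funext => n; rewrite Ef /sum_Delta_powers big_cons psD -Edpow //; congr (_ + _).
rewrite ps_sum big_seq [RHS]big_seq; apply: eq_bigr => c cs.
by rewrite -Edpow // (allP oms).
Qed.

Theorem mainTheorem1 (f : qseries) (m1 : nat) (ms : seq nat) :
  calF f -> ~ (f =1 qzero) -> decomposition f (m1 :: ms) ->
  iter (n3 m1) (hecke 3) (iter (n5 m1) (hecke 5) f) =1 Delta
  /\ nilpotence_order f (Some (h m1).+1).
Proof.
move=> _ nf dec; have Lf := decomposition_lead dec.
set x := m1./2 in Lf; have Em : m1 = x.*2.+1.
  by case: dec => /andP[om _] _ _; rewrite -[LHS]odd_double_half om.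
have E3 : n3 m1 = a3 x by rewrite Em.
have E5 : n5 m1 = a5 x by rewrite Em.
have Eh : h m1 = ht x by rewrite /h E3 E5.
have main : iter (n3 m1) (hecke 3) (iter (n5 m1) (hecke 5) f) = Delta.
  by rewrite E3 E5; apply: iter_lead Lf.
split; first by rewrite main.
split=> // [ps sz ops|g ann].
  have Hf : height_lt (size ps + 0) (f : pseries 'F_2).
    rewrite sz addn0 Eh; case: Lf => r Hr ->; apply: spanD; first exact: span_Dpow.
    by apply: span_sub Hr => y; rewrite key_lt => /orP[/leqW|/andP[/eqP-> _]].
  have := foldr_height ops Hf => /span_pred0 Z.
  by move=> n; have := congr1 (fun f : pseries 'F_2 => f n) Z; rewrite ps0.
rewrite ltnNge; apply/negP => le.
pose ps := nseq (n3 m1) 3%N ++ nseq (n5 m1) 5%N.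
have ops : all odd_prime ps by rewrite all_cat !all_nseq /= !orbT.
have sps : size ps = h m1 by rewrite size_cat !size_nseq.
have Eps : foldr hecke f ps = Delta.
  rewrite foldr_cat -main; elim: (n3 m1) => [|a IH] /=; last by rewrite IH.
  by elim: (n5 m1) => //= b ->.
have : foldr hecke f (drop (h m1 - g) ps) = (0 : pseries 'F_2).
  apply: funext => n; rewrite ann ?ps0 //; first by rewrite size_drop sps subKn.
  by apply/allP => p /mem_drop; apply: (allP ops).
move=> Z; apply: DeltaS_neq0; rewrite -[LHS]Eps -(cat_take_drop (h m1 - g) ps) foldr_cat Z.
by elim: (take _ _) => //= p s ->; apply: Hecke0.
Qed.
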